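(* Let $\beta>0$ and assume $V:\mathbb T\to\mathbb R$ has a weak derivative $V'$ in $L^2(\mathbb T)$. Then there exists $C=C(\mu_\beta^V)>0$ such that, for every $N\ge10$ and $r>0$, $$\mathbb P_N\Big(\mathrm W_1(\mu_N,\mu_\beta^V)>r\Big)\le e^{-\beta\left(\frac1{8\pi}Nr^2-5\log N-C\right)} .$$
   Context: $\mathbb T=[-\pi,\pi]\simeq\mathbb R/2\pi\mathbb Z$ is equipped with the metric $(x,y)\mapsto|e^{ix}-e^{iy}|$. $V$ is continuous and normalized (by adding a constant) so that $\mu_0^V(dx):=e^{-V(x)}\frac{dx}{2\pi}$ is a probability measure. $\mathbb P_N$ is the probability measure on $\mathbb T^N$ $$d\mathbb P_N(x_1,\dots,x_N)=\frac1{Z_N}\prod_{i<j}|e^{ix_i}-e^{ix_j}|^{\frac{2\beta}N}\prod_{i=1}^Ne^{-V(x_i)}\frac{dx_i}{2\pi},$$ with $Z_N>0$ the normalization constant, and $\mu_N=\frac1N\sum_{i=1}^N\delta_{x_i}$ is the empirical measure. For a probability measure $\mu$ on $\mathbb T$, $\mathcal E(\mu)=\iint\log|\sin(\frac{x-y}2)|^{-1}\mu(dx)\mu(dy)$, $\mathcal K(\mu|\mu_0^V)=\int\log\frac{d\mu}{d\mu_0^V}\,d\mu$ is the relative entropy ($+\infty$ if $\mu\not\ll\mu_0^V$), $F_\beta^V(\mu)=\beta\mathcal E(\mu)+\mathcal K(\mu|\mu_0^V)$, and $\mu_\beta^V$ is the unique minimizer of $F_\beta^V$ over probability measures on $\mathbb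 T$. $\mathrm W_1(\mu,\nu)=\inf_\pi\iint|e^{ix}-e^{iy}|\,\pi(dx,dy)$, the infimum being over probability measures $\pi$ on $\mathbb T\times\mathbb T$ with marginals $\mu$ and $\nu$. *)

(* Defs.v *)
From HB Require Import structures.
From mathcomp Require Import all_boot all_order all_algebra.
From mathcomp Require Import all_classical all_reals all_analysis.
From mathcomp Require Import measurable_realfun complex.

Set Implicit Arguments.
Unset Strict Implicit.
Unset Printing Implicit Defensive.

Import Order.TTheory GRing.Theory Num.Theory.
Import numFieldNormedType.Exports.

Local Open Scope classical_set_scope.
Local Open Scope ring_scope.

(* The torus T = R/2piZ is handled through real representatives: functions on T
   are 2pi-periodic functions on R, and Borel probability measures on T are
   Borel probability measures on R carried by the fundamental domain ]-pi, pi]. *)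
Section torus.
Context {R : realType}.
Local Notation TR := (measurableTypeR R).
Implicit Types (x y : R) (V : R -> R).

Definition torus : set R := `]- pi, pi].

Definition torus_fun V := forall x, V (x + 2 * pi) = V x.

Definition torus_prob (mu : probability TR R) := (mu torus = 1)%E.

Definition cexp x : R[i] := Complex (cos x) (sin x).

Definition chord x y : R := ComplexField.Normc.normc (cexp x - cexp y).

Lemma ltNpi_pi : - pi < pi :> R.
Proof. by rewrite gtrN// pi_gt0. Qed.

(* dx / (2 pi) on [-pi, pi] *)
Definition haar : probability TR R := uniform_prob ltNpi_pi.

Definition test_function (phi : R -> R) :=
  torus_fun phi /\ forall n x, derivable (derive1n n phi) x 1.

Definition weak_derivative V V' := forall phi, test_function phi ->
  \int[haar]_x (V x * derive1 phi x) = - \int[haar]_x (V' x * phi x).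

End torus.

Section reference_measure.
Context {R : realType} (V : R -> R) (cV : continuous V)
  (nV : (\int[haar]_x (expR (- V x))%:E = 1)%E).

(* e^{-V} dx/(2pi); the proof arguments make it canonically a probability. *)
Definition mu0 of continuous V & (\int[haar]_x (expR (- V x))%:E = 1)%E :
  set (measurableTypeR R) -> \bar R := fun A => (\int[haar]_(x in A) (expR (- V x))%:E)%E.

Let mu00 : mu0 cV nV set0 = 0%E.
Proof. exact: integral_set0. Qed.

Let mu0_ge0 A : (0 <= mu0 cV nV A)%E.
Proof. by apply: integral_ge0 => x _; rewrite lee_fin expR_ge0. Qed.

Let mu0_sigma_additive : semi_sigma_additive (mu0 cV nV).
Proof.
apply: semi_sigma_additive_nng_induced => [|x]; last by rewrite lee_fin expR_ge0.
apply/measurable_EFinP; apply: measurableT_comp => //; apply: measurableT_comp => //.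
exact: continuous_measurable_fun.
Qed.

HB.instance Definition _ :=
  isMeasure.Build _ _ _ (mu0 cV nV) mu00 mu0_ge0 mu0_sigma_additive.

Let mu0_setT : mu0 cV nV setT = 1%E.
Proof. exact: nV. Qed.

HB.instance Definition _ :=
  @Measure_isProbability.Build _ _ R (mu0 cV nV) mu0_setT.

End reference_measure.

Section functionals.
Context {R : realType}.
Local Notation TR := (measurableTypeR R).
Local Open Scope ereal_scope.

(* [lne 0 = -oo], so the kernel is +oo on the diagonal. *)
Definition log_kernel (x y : R) : \bar R := - lne `|sin ((x - y) / 2)|%:E.

Definition log_energy (mu : probability TR R) : \bar R :=
  \int[mu]_x \int[mu]_y log_kernel x y.

Definition relative_entropy (mu nu : probability TR R) : \bar R :=
  if `[< mu `<< nu >] then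
    \int[mu]_x lne (Radon_Nikodym (charge_of_finite_measure mu) nu x)
  else +oo.

Definition free_energy (beta : R) (V : R -> R) (cV : continuous V)
    (nV : \int[haar]_x (expR (- V x))%:E = 1) (mu : probability TR R) : \bar R :=
  beta%:E * log_energy mu + relative_entropy mu (mu0 cV nV).

(* Minimizers are in fact unique, by strict convexity of the free energy. *)
Definition equilibrium_measure (beta : R) (V : R -> R) (cV : continuous V)
    (nV : \int[haar]_x (expR (- V x))%:E = 1) (mu : probability TR R) :=
  torus_prob mu /\ forall nu : probability TR R, torus_prob nu ->
    free_energy beta cV nV mu <= free_energy beta cV nV nu.

Definition coupling (mu nu : {measure set TR -> \bar R})
    (gamma : probability (TR * TR)%type R) :=
  forall A, measurable A ->
    gamma (A `*` setT) = mu A /\ gamma (setT `*` A) = nu A.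

Definition W1 (mu nu : {measure set TR -> \bar R}) : \bar R :=
  ereal_inf [set \int[gamma]_z (chord z.1 z.2)%:E | gamma in coupling mu nu].

End functionals.

Section power_probability.
Context d (T : measurableType d) (R : realType).

Definition tuple_cons n (p : T * n.-tuple T) : n.+1.-tuple T :=
  [tuple of p.1 :: p.2].

Lemma measurable_tuple_cons n : measurable_fun setT (@tuple_cons n).
Proof. exact: measurable_cons. Qed.

HB.instance Definition _ n :=
  isMeasurableFun.Build _ _ _ _ (@tuple_cons n) (@measurable_tuple_cons n).

Fixpoint power_prob (P : probability T R) n : probability (n.-tuple T) R :=
  match n with
  | 0 => dirac [tuple]
  | m.+1 => distribution (P \x power_prob P m)%E (@tuple_cons m)
  end.

End power_probability.

Section gas.
Context {R : realType} (beta : R) (V : R -> R) (N : nat).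
Local Notation TR := (measurableTypeR R).
Local Open Scope ereal_scope.

Definition gas_weight (x : N.-tuple TR) : R :=
  ((\prod_(i < N) \prod_(j < N | (i < j)%N)
      chord (tnth x i) (tnth x j) `^ (2 * beta / N%:R)) *
   \prod_(i < N) expR (- V (tnth x i)))%R.

(* Densities on T^N are taken with respect to the product of the dx_i/(2pi),
   and the partition function is a positive real for continuous V. *)
Definition partition_function : R :=
  fine (\int[power_prob haar N]_x (gas_weight x)%:E).

Definition gas_prob (A : set (N.-tuple TR)) : \bar R :=
  partition_function^-1%:E *
  \int[power_prob haar N]_(x in A) (gas_weight x)%:E.

End gas.

Definition empirical_measure {R : realType} (N : nat) (x : N.-tuple (measurableTypeR R)) :
    {measure set (measurableTypeR R) -> \bar R} :=
  mscale (N%:R^-1)%:nng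
    (msum (fun i => dirac (nth 0 x i : measurableTypeR R)) N).

(* Main.v *)
Require Import Defs.
From HB Require Import structures.
From mathcomp Require Import all_boot all_order all_algebra.
From mathcomp Require Import all_classical all_reals all_analysis.
From mathcomp Require Import measurable_realfun ring lra.

Set Implicit Arguments.
Unset Strict Implicit.
Unset Printing Implicit Defensive.

Import Order.TTheory GRing.Theory Num.Theory.
Import numFieldNormedType.Exports.

Local Open Scope classical_set_scope.
Local Open Scope ring_scope.

(** Let G(x, y) = - log |sin((x - y)/2)|. Up to a constant that cancels with
    Z_N, a configuration has the weight exp(- (2 beta/N) sum_(i<j) G(x_i, x_j))
    prod_i e^(-V(x_i)), so that with P the empirical measure the interaction is
    beta N E(P), the infinite diagonal of E being left out. Let U(x) be the
    integral of G(x, y) mu(dy), where mu is the equilibrium measure.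

    Euler-Lagrange equation ([equilibrium_density]). A comparison of mu with
    (1 - t) mu + t q mu_0, where q = e^(-2 beta U) / Z, yields as t -> 0 that
    K(mu) + 2 beta int U dmu is at most its value at q mu_0. By
    [gibbs_identity] this functional is, up to a constant, the Bregman
    divergence from q of the density with respect to mu_0. Hence mu = q mu_0; in
    particular mu <= M dx/(2 pi) for some M.

    Denominator ([integral_gas_weight_ge]). When e^(-V) dx/(2 pi) is expressed
    through mu, Z_N becomes Z^N times the mean under mu^N of
    exp(2 beta sum_i U(x_i) - (2 beta/N) sum_(i<j) G(x_i, x_j)), and Jensen's
    inequality gives the lower bound Z^N exp(beta (N + 1) E(mu)).

    Numerator ([interaction_le]). The kernel G is replaced by a smaller kernel
    softlog d that is at most log(2/d) on the diagonal. If I(P, S) denotes the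
    mutual energy for this kernel, [softlog_energy_gap] states that
    2 I(P, mu) + r^2/(8 pi) <= I(P, P) + I(mu, mu) as soon as W1(P, mu) > r. As
    mu has a bounded density, I(P, mu) is the mean of U under P up to
    O(sqrt d) ([potential_le_softlog]), and I(mu, mu) <= E(mu). With d = N^(-4)
    the interaction is thus at most exp(- beta (N r^2/(8 pi) - N E(mu) -
    4 log N - O(1))) prod_i e^(-2 beta U(x_i)), and the integral of the last
    product against prod_i e^(-V(x_i)) dx_i/(2 pi) is the same Z^N as in the
    denominator. The quotient is at most exp(- beta (N r^2/(8 pi) + E(mu) -
    4 log N - O(1))), where the O(1) depends on M only.

    The gap inequality. For a kernel phi(|x - y|) with phi convex and invariant
    under t -> 2 pi - t, integrating phi'' twice gives, up to terms that depend
    on one of the measures only, I(P, S) = int int_(z<w) phi''(w - z) P(]z, w])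
    S(]z, w]) dz dw ([convex_kernel_energy]). Hence I(P, P) - 2 I(P, S) + I(S, S)
    is a weighted square integral of (P - S)(]z, w]), with a weight bounded
    below. On the other side W1(P, S) is at most 2 pi times the mean of
    |(P - S)(]z, w])| ([W1_le_mean]): cut the circle at any point and couple P
    and S by their quantile functions read from that point. *)

(** * Integration against densities and over finite powers *)

Section integral_tools.
Context d (T : measurableType d) (R : realType).
Local Open Scope ereal_scope.

(** The event of the theorem is not known to be measurable, so that the
    integral over it must be bounded without measurability of A or of f. This is
    possible because the integral of a nonnegative function is a supremum over
    the simple functions below it. *)
Lemma ge0_le_integral_set (mu : {measure set T -> \bar R}) (A : set T)
    (f g : T -> \bar R) :
  (forall x, A x -> 0 <= f x) -> (forall x, 0 <= g x) ->
  (forall x, A x -> f x <= g x) ->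
  \int[mu]_(x in A) f x <= \int[mu]_x g x.
Proof.
move=> f0 g0 fg; rewrite !ge0_integralE// ge_ereal_sup// => _ [h /= hf <-].
apply: ereal_sup_ubound; exists h => // x; apply: le_trans (hf x) _.
rewrite /patch; have [xA|_] := boolP (x \in A); rewrite ?in_setT//.
by apply: fg; rewrite inE in xA.
Qed.

Lemma integral_prob_cst (P : probability T R) (c : \bar R) :
  \int[P]_x c = c.
Proof. by rewrite integral_cst// [X in _ * X](@probability_setT _ _ _ P) mule1. Qed.

Variables (nu : {finite_measure set T -> \bar R})
  (mu : {sigma_finite_measure set T -> \bar R}) (f : T -> R).
Hypotheses (mf : measurable_fun setT f) (f0 : forall x, (0 <= f x)%R).
Hypothesis nuf : forall A, measurable A -> nu A = \int[mu]_(x in A) (f x)%:E.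

Lemma density_dominates : nu `<< mu.
Proof.
apply/null_content_dominatesP => A mA muA0.
by rewrite nuf//; apply: null_set_integral => //; apply/measurable_EFinP/measurable_funTS.
Qed.

Lemma density_integrable : mu.-integrable setT (EFin \o f).
Proof.
apply/integrableP; split; first exact/measurable_EFinP.
under eq_integral do rewrite gee0_abs ?lee_fin//.
by rewrite -nuf// -ge0_fin_numE// fin_num_measure.
Qed.

Lemma density_Radon_Nikodym :
  ae_eq mu setT (EFin \o f) (Radon_Nikodym (charge_of_finite_measure nu) mu).
Proof.
apply: integral_ae_eq => //; first exact: density_integrable.
  by apply: measurable_int; apply: Radon_Nikodym_integrable; exact: density_dominates.
move=> E _ mE; rewrite -Radon_Nikodym_integral//; last exact: density_dominates.
by rewrite /= -nuf.
Qed.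

(** Both the density f and the Radon-Nikodym derivative integrate to nu over
    every measurable set, so they agree almost everywhere. *)
Lemma ge0_integral_density (k : T -> \bar R) :
  measurable_fun setT k -> (forall x, 0 <= k x) ->
  \int[nu]_x k x = \int[mu]_x (k x * (f x)%:E).
Proof.
move=> mk k0; have numu := density_dominates.
rewrite -(Radon_Nikodym_SigmaFinite.change_of_variables numu)//.
apply: ae_eq_integral => //.
- apply: emeasurable_funM => //.
  by apply: measurable_int; exact: Radon_Nikodym_SigmaFinite.f_integrable.
- by apply: emeasurable_funM => //; exact/measurable_EFinP.
apply: ae_eqe_mul2l.
have h1 := ae_eq_Radon_Nikodym_SigmaFinite numu (@measurableT _ T).
have h2 := ae_eq_sym density_Radon_Nikodym.
exact: ae_eq_trans h1 h2.
Qed.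

End integral_tools.

Section power_prob_integrals.
Context d (T : measurableType d) (R : realType) (P : probability T R).
Local Open Scope ereal_scope.

Lemma integral_power_prob0 (F : 0.-tuple T -> \bar R) :
  measurable_fun setT F -> (forall t, 0 <= F t) ->
  \int[power_prob P 0]_t F t = F [tuple].
Proof. by move=> mF F0; rewrite /= integral_dirac// diracT mul1e. Qed.

Lemma integral_power_probS n (F : n.+1.-tuple T -> \bar R) :
  measurable_fun setT F -> (forall t, 0 <= F t) ->
  \int[power_prob P n.+1]_t F t =
  \int[P]_x \int[power_prob P n]_t F [tuple of x :: t].
Proof.
move=> mF F0.
rewrite [LHS](ge0_integral_pushforward (@measurable_tuple_cons _ T n))//.
rewrite preimage_setT fubini_tonelli1//.
  by apply: measurableT_comp => //; exact: measurable_tuple_cons.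
by move=> x; exact: F0.
Qed.

Lemma measurable_cons_r n (x : T) :
  measurable_fun setT (fun t : n.-tuple T => [tuple of x :: t]).
Proof. by apply: measurable_cons => //; exact: measurable_id. Qed.

Lemma integral_power_prob_prod (f : T -> R) n :
  measurable_fun setT f -> (forall x, (0 <= f x)%R) ->
  \int[power_prob P n]_t (\prod_(i < n) f (tnth t i))%:E =
  (\int[P]_x (f x)%:E) ^+ n.
Proof.
move=> mf f0; elim: n => [|n IHn].
  under eq_integral do rewrite big_ord0.
  rewrite integral_cst// mul1e expe0; exact: (@probability_setT _ _ _ (power_prob P 0)).
have mprod k : measurable_fun setT (fun t : k.-tuple T => (\prod_(i < k) f (tnth t i))%R).
  apply: measurable_prod => i _ //.
  by apply: measurableT_comp => //; exact: measurable_tnth.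
have prod0 k (t : k.-tuple T) : (0 <= \prod_(i < k) f (tnth t i))%R.
  by apply: prodr_ge0 => i _.
rewrite integral_power_probS//; last 2 first.
- by apply/measurable_EFinP; exact: mprod.
- by move=> t; rewrite lee_fin.
transitivity (\int[P]_x ((f x)%:E * (\int[P]_x (f x)%:E) ^+ n)).
  apply: eq_integral => x _; rewrite -IHn -ge0_integralZl//; last first.
  - by rewrite lee_fin.
  - by move=> t _; rewrite lee_fin.
  - by apply/measurable_EFinP; exact: mprod.
  apply: eq_integral => t _; rewrite big_ord_recl tnth0 EFinM.
  by congr (_ * _%:E); apply: eq_bigr => i _; rewrite tnthS.
rewrite ge0_integralZr// ?expeS//; first exact/measurable_EFinP.
- by move=> x _; rewrite lee_fin.
- by apply: expe_ge0; apply: integral_ge0 => x _; rewrite lee_fin.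
Qed.

End power_prob_integrals.

(** * Transport on the circle through distribution functions *)

Section distribution_function.
Context {R : realType}.
Local Notation TR := (measurableTypeR R).
Implicit Types P S : probability TR R.

Definition distr_fun P (x : R) : R := fine (P `]-oo, x]%classic).

Lemma distr_funE P x : (distr_fun P x)%:E = P `]-oo, x]%classic.
Proof. by rewrite fineK// fin_num_measure. Qed.

Lemma distr_fun_ge0 P x : 0 <= distr_fun P x.
Proof. by rewrite -lee_fin distr_funE. Qed.

Lemma distr_fun_le1 P x : distr_fun P x <= 1.
Proof. by rewrite -lee_fin distr_funE probability_le1. Qed.

Lemma distr_fun_nd P : nondecreasing_fun (distr_fun P).
Proof.
move=> x y xy; rewrite -lee_fin !distr_funE le_measure ?inE//.
exact: subset_itvl.
Qed.

Lemma measurable_distr_fun P D : measurable D -> measurable_fun D (distr_fun P).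
Proof. by move=> mD; apply: nondecreasing_measurable => //; exact: distr_fun_nd. Qed.

Let idTR : TR -> R := idfun.
#[local] HB.instance Definition _ :=
  @isMeasurableFun.Build _ _ _ _ idTR (@measurable_id _ _ setT).

(** [distr_fun P] is the cumulative distribution function of the identity, seen
    as a random variable under P. *)
Lemma distr_fun_rc P : right_continuous (distr_fun P).
Proof.
move=> a; apply: fine_cvg; rewrite fineK ?fin_num_measure//.
exact: (@cdf_right_continuous _ _ _ P (idTR : {RV P >-> R}) a).
Qed.

Lemma measure_itvoc P (a b : R) : a <= b ->
  P `]a, b]%classic = (distr_fun P b - distr_fun P a)%:E.
Proof.
move=> ab; rewrite EFinB !distr_funE.
have -> : `]a, b]%classic = `]-oo, b]%classic `\` `]-oo, a]%classic.
  by rewrite -[RHS]setCK setCD setCitvl setUC -[LHS]setCK setCitv.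
rewrite measureD ?setIidr//; first exact: subset_itvl.
by rewrite -ge0_fin_numE// fin_num_measure.
Qed.

Lemma eq_distr_fun P S : distr_fun P =1 distr_fun S ->
  forall A, measurable A -> P A = S A.
Proof.
move=> PS A mA; apply: (@measure_unique _ _ TR (@ocitv R) (fun n => `]-n%:R, n%:R]%classic)).
- by [].
- exact: ocitvI.
- by move=> n; exact: is_ocitv.
- exact: bigcup_itvT.
- move=> _ [[a b]] _ <- /=; have [ab|ba] := leP a b.
    by rewrite !measure_itvoc// !PS.
  by rewrite set_itv_ge ?measure0// bnd_simp -leNgt ltW.
- by move=> k; rewrite -ge0_fin_numE// fin_num_measure.
- exact: mA.
Qed.

End distribution_function.

Section uniform01.
Context {R : realType}.
Local Notation TR := (measurableTypeR R).
Local Open Scope ereal_scope.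

Definition unif01 : probability TR R := uniform_prob (@ltr01 R).

Lemma integral_unif01 (f : TR -> \bar R) : measurable_fun setT f ->
  (forall x, 0 <= f x) ->
  \int[unif01]_u f u = \int[lebesgue_measure]_(u in `]0%R, 1%R]) f u.
Proof.
move=> mf f0; rewrite /unif01 integral_uniform// subr0 invr1 mul1e.
by rewrite -integral_itv_obnd_cbnd//; exact: measurable_funTS.
Qed.

Lemma eq_integral_unif01 (f g : TR -> \bar R) : measurable_fun setT f ->
  measurable_fun setT g -> (forall x, 0 <= f x) -> (forall x, 0 <= g x) ->
  (forall u, (0 < u <= 1)%R -> f u = g u) ->
  \int[unif01]_u f u = \int[unif01]_u g u.
Proof.
move=> mf mg f0 g0 fg; rewrite !integral_unif01//; apply: eq_integral => u.
by rewrite inE/= in_itv/= => /fg.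
Qed.

Lemma measurable_ler_cst (c : R) :
  measurable_fun (setT : set TR) (fun u : TR => ((u <= c)%R%:R : R)).
Proof.
apply: nonincreasing_measurable => // x y xy.
by rewrite ler_nat; case: (leP y c) => // yc; rewrite (le_trans xy yc).
Qed.

Lemma integral_unif01_ler (c : R) : (0 <= c <= 1)%R ->
  \int[unif01]_u ((u <= c)%R%:R)%:E = c%:E.
Proof.
move=> /andP[c0 c1]; rewrite integral_unif01//; last first.
- by apply/measurable_EFinP; exact: measurable_ler_cst.
transitivity (\int[lebesgue_measure]_(u in `]0%R, 1%R]) (\1_`]0%R, c]%classic u)%:E).
  apply: eq_integral => u; rewrite inE/= in_itv/= => /andP[u0 u1].
  by rewrite indicE mem_setE in_itv/= u0.
rewrite integral_indic//= setIidl; last first.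
  by apply: subset_itvl; rewrite bnd_simp.
rewrite lebesgue_measure_itv/= lte_fin; case: ltP => [|c00]; first by rewrite sube0.
by congr EFin; apply/eqP; rewrite eq_le c0.
Qed.

Lemma integral_unif01_dist (c e : R) : (0 <= c <= 1)%R -> (0 <= e <= 1)%R ->
  \int[unif01]_u (`|(u <= c)%R%:R - (u <= e)%R%:R|)%:E = `|c - e|%:E.
Proof.
wlog ce : c e / (c <= e)%R => [hw c01 e01|c01 e01].
  have [/hw|/ltW/hw] := leP c e; first exact.
  rewrite distrC => <-//; apply: eq_integral => u _; by rewrite distrC.
have h u : `|(u <= c)%R%:R - (u <= e)%R%:R|%R = ((u <= e)%R%:R - (u <= c)%R%:R)%R :> R.
  rewrite ler0_norm ?opprB// subr_le0 ler_nat.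
  by case: (leP u c) => // uc; rewrite (le_trans uc ce).
under eq_integral do rewrite h EFinB.
rewrite integralB//.
- by rewrite !integral_unif01_ler// -EFinB ler0_norm ?opprB// subr_le0.
- apply/integrableP; split; first by apply/measurable_EFinP; exact: measurable_ler_cst.
  by under eq_integral do rewrite gee0_abs ?lee_fin//; rewrite integral_unif01_ler// ltry.
- apply/integrableP; split; first by apply/measurable_EFinP; exact: measurable_ler_cst.
  by under eq_integral do rewrite gee0_abs ?lee_fin//; rewrite integral_unif01_ler// ltry.
Qed.

End uniform01.

Section chord.
Context {R : realType}.
Implicit Types x y : R.
Local Notation TR := (measurableTypeR R).

Lemma chordE x y : chord x y = 2 * `|sin ((x - y) / 2)|.
Proof.
pose u := (x - y) / 2; pose v := (x + y) / 2.
have -> : x = v + u by rewrite /u /v; field.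
have -> : y = v - u by rewrite /u /v; field.
have -> : (v + u - (v - u)) / 2 = u by field.
rewrite /chord /cexp /= sinD sinB cosD cosB.
have -> : (cos v * cos u - sin v * sin u - (cos v * cos u + sin v * sin u)) ^+ 2 +
   (sin v * cos u + cos v * sin u - (sin v * cos u - cos v * sin u)) ^+ 2 =
   (2 * sin u) ^+ 2 by have := cos2Dsin2 v; nra.
by rewrite sqrtr_sqr normrM gtr0_norm.
Qed.

Lemma chord_ge0 x y : 0 <= chord x y.
Proof. by rewrite chordE mulr_ge0. Qed.

Lemma chordC x y : chord x y = chord y x.
Proof. by rewrite !chordE -opprB mulNr sinN normrN. Qed.

Lemma abs_sin_le x : `|sin x| <= `|x|.
Proof.
wlog x0 : x / 0 <= x => [hw|].
  have [/hw//|/ltW x0] := leP 0 x; rewrite -normrN -sinN -(normrN x).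
  by apply: hw; rewrite oppr_ge0.
have [|c _] := @MVT_segment R sin cos 0 x x0 (fun z _ => is_derive_sin z).
  by apply: continuous_subspaceT; exact: continuous_sin.
rewrite sin0 !subr0 => ->; rewrite normrM ler_piMl//.
by rewrite ler_norml cos_geN1 cos_le1.
Qed.

Lemma chord_le x y : chord x y <= `|x - y|.
Proof.
rewrite chordE; have := abs_sin_le ((x - y) / 2).
by rewrite [X in _ <= X]normrM (gtr0_norm (_ : 0 < 2^-1)) ?invr_gt0//; lra.
Qed.

Lemma chord_addl2pi x y : chord (x + 2 * pi) y = chord x y.
Proof.
rewrite !chordE; have -> : (x + 2 * pi - y) / 2 = (x - y) / 2 + pi by field.
by rewrite sinDpi normrN.
Qed.

Lemma measurable_chord : measurable_fun setT (fun z : TR * TR => chord z.1 z.2).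
Proof.
under eq_fun do rewrite chordE.
apply: measurable_funM => //; apply: measurableT_comp => //.
apply: (@measurableT_comp _ _ _ _ _ _ (@sin R)).
  by apply: continuous_measurable_fun; exact: continuous_sin.
by apply: measurable_funM => //; apply: measurable_funB.
Qed.

End chord.

Section quantile.
Context {R : realType}.
Local Notation TR := (measurableTypeR R).
Variables (P : probability TR R) (a b : R).
Hypotheses (ab : a < b) (Fa : distr_fun P a = 0) (Fb : distr_fun P b = 1).

Let level (u : R) : set R :=
  [set x | a <= x <= b /\ (u <= distr_fun P x \/ x = b)].

Definition quantile (u : R) : R := inf (level u).

Let level_b u : level u b.
Proof. by split; [rewrite lexx ltW|right]. Qed.

Let level_lb u : lbound (level u) a.
Proof. by move=> x [/andP[]]. Qed.

Let level_has_inf u : has_inf (level u).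
Proof. by split; [exists b|exists a; exact: level_lb]. Qed.

Lemma quantile_ge u : a <= quantile u.
Proof. by apply: lb_le_inf; [exists b|exact: level_lb]. Qed.

Lemma quantile_le u : quantile u <= b.
Proof. by apply: ge_inf; [case: (level_has_inf u)|]. Qed.

Lemma quantile_nd : nondecreasing_fun quantile.
Proof.
move=> u v uv; apply: le_inf; last 2 first.
- by exists b.
- exact: level_has_inf.
move=> _ [x [xab h] <-]; exists (- x); split=> //; exists x => //; split => //.
by case: h => [h|]; [left; exact: le_trans h|right].
Qed.

Lemma measurable_quantile : measurable_fun (setT : set TR) (quantile : TR -> TR).
Proof. by apply: nondecreasing_measurable => //; exact: quantile_nd. Qed.

Lemma quantile_le_iff u x : 0 < u <= 1 -> (quantile u <= x) = (u <= distr_fun P x).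
Proof.
move=> /andP[u0 u1]; apply/idP/idP => [qx|ux]; last first.
  have [xa|ax] := ltP x a.
    have := distr_fun_nd P (ltW xa); rewrite Fa => /(le_trans ux).
    by rewrite leNgt u0.
  have [bx|xb] := leP b x; first exact: le_trans (quantile_le u) bx.
  apply: ge_inf; first by case: (level_has_inf u).
  by split; [rewrite ax ltW|left].
apply: le_trans (distr_fun_nd P qx).
rewrite leNgt; apply/negP => Fu.
have [e /= e0 he] := cvgr_lt _ (@distr_fun_rc _ P (quantile u)) _ Fu.
have [y [yab yu] yqe] := inf_adherent e0 (level_has_inf u).
have qy : quantile u <= y by apply: ge_inf; [case: (level_has_inf u)|split].
have uFy : u <= distr_fun P y by case: yu => // ->; rewrite Fb.
move: qy; rewrite le_eqVlt => /predU1P[qy|qy].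
  by move: Fu; rewrite qy ltNge uFy.
suff : distr_fun P y < u by rewrite ltNge uFy.
apply: he => //; rewrite /ball_/= ltr0_norm ?subr_lt0// opprB ltrBlDr addrC.
exact: yqe.
Qed.

End quantile.

Lemma measurable_natr_bool d (T : measurableType d) (R : realType) (b : T -> bool) :
  measurable_fun setT b -> measurable_fun setT (fun x => (b x)%:R : R).
Proof.
move=> mb; apply: (eq_measurable_fun (fun x => if b x then 1 else 0 : R)).
  by move=> x _; case: (b x).
exact: measurable_fun_ifT.
Qed.

(** The integrand is 1 on one of the two arcs with ends x and y, the one that
    avoids the cut point x0, and the chord is at most the length of either arc. *)
Lemma le_chord_crossings (R : realType) (x0 x y : R) :
  - pi <= x0 <= pi -> - pi <= x <= pi -> - pi <= y <= pi ->
  ((chord x y)%:E <= \int[lebesgue_measure]_(z in `[(- pi)%R, pi])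
    (`|((x <= z)%R%:R - (x <= x0)%R%:R) - ((y <= z)%R%:R - (y <= x0)%R%:R)|)%:E)%E.
Proof.
wlog xy : x y / x <= y => [hw x0pi xpi ypi|x0pi xpi ypi].
  have [/hw|/ltW/hw] := leP x y; first exact.
  rewrite chordC => /(_ x0pi ypi xpi) h; apply: le_trans h _.
  by under eq_integral do rewrite distrC.
pose D : set R := `[- pi, pi]%classic.
have {}hw (E : set R) : measurable E -> E `<=` D ->
    (forall z, E z -> 1 <= `|((x <= z)%R%:R - (x <= x0)%R%:R) -
       ((y <= z)%R%:R - (y <= x0)%R%:R)| :> R) ->
    (lebesgue_measure E <= \int[lebesgue_measure]_(z in D)
    (`|((x <= z)%R%:R - (x <= x0)%R%:R) - ((y <= z)%R%:R - (y <= x0)%R%:R)|)%:E)%E.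
  move=> mE ED hE; rewrite -(setIidl ED) -integral_indic//; last exact: measurable_itv.
  apply: ge0_le_integral => //.
  - exact: measurable_itv.
  - exact/measurable_EFinP/measurable_funTS/measurable_indic.
  - apply/measurable_EFinP/measurable_funTS/measurableT_comp => //.
    apply: measurable_funB; apply: measurable_funB => //;
      by apply: measurable_natr_bool; apply: measurable_fun_ler.
  - move=> z _; rewrite lee_fin indicE.
    have [zE|_] := boolP (z \in E); last exact: normr_ge0.
    by apply: hE; rewrite inE in zE.
have dich (s t : R) : s <= t \/ t < s by case: leP; [left|right].
have [xx0|x0x] := dich x x0; last first.
  apply: le_trans (hw `[x, y[%classic _ _ _) => //.
  - rewrite lebesgue_measure_itv/= lte_fin; case: ltP => [xy'|yx].
      rewrite -EFinB lee_fin; apply: le_trans (chord_le x y) _.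
      by rewrite ler0_norm ?subr_le0// opprB.
    have -> : x = y by apply/eqP; rewrite eq_le xy.
    by rewrite chordE subrr mul0r sin0 normr0 mulr0.
  - by rewrite /D => z /=; rewrite !in_itv/= => /andP[? ?]; apply/andP; split; lra.
  - move=> z /=; rewrite in_itv/= => /andP[-> zy].
    rewrite (leNgt y) zy (leNgt x) x0x (leNgt y) (lt_le_trans x0x xy)/= !subr0.
    by rewrite normr1.
have [yx0|x0y] := dich y x0.
  apply: le_trans (hw `[x, y[%classic _ _ _) => //.
  - rewrite lebesgue_measure_itv/= lte_fin; case: ltP => [xy'|yx].
      rewrite -EFinB lee_fin; apply: le_trans (chord_le x y) _.
      by rewrite ler0_norm ?subr_le0// opprB.
    have -> : x = y by apply/eqP; rewrite eq_le xy.
    by rewrite chordE subrr mul0r sin0 normr0 mulr0.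
  - by rewrite /D => z /=; rewrite !in_itv/= => /andP[? ?]; apply/andP; split; lra.
  - move=> z /=; rewrite in_itv/= => /andP[-> zy].
    by rewrite (leNgt y) zy xx0 yx0 subrr sub0r /= sub0r opprK normr1.
apply: le_trans (hw (`[- pi, x[ `|` `[y, pi])%classic _ _ _) => //.
- have -> : lebesgue_measure (`[- pi, x[ `|` `[y, pi])%classic =
      (lebesgue_measure `[(- pi)%R, x[%classic + lebesgue_measure `[y, pi]%classic)%E.
    apply: measureU => //.
    by rewrite -subset0 => z [] /=; rewrite !in_itv/= => /andP[_ zx] /andP[yz _]; lra.
  rewrite !lebesgue_measure_itv/= !lte_fin.
  have xy' : x < y := le_lt_trans xx0 x0y.
  have h : chord x y <= (x + pi) + (pi - y).
    rewrite -chord_addl2pi; apply: le_trans (chord_le _ _) _.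
    by rewrite ger0_norm; lra.
  by case: ltP => h1; case: ltP => h2;
    rewrite -?EFinB -?EFinD ?adde0 ?add0e ?lee_fin; lra.
- exact: measurableU.
- by rewrite /D => z [] /=; rewrite !in_itv/= => /andP[? ?]; apply/andP; split; lra.
- have zxy z : z < x \/ y <= z -> ((x <= z)%R%:R - (y <= z)%R%:R = 0 :> R).
    move=> [zx|yz]; first by rewrite !leNgt zx (lt_le_trans zx xy) subrr.
    by rewrite yz (le_trans xy yz) subrr.
  move=> z h; have /subr0_eq -> : (x <= z)%R%:R - (y <= z)%R%:R = 0 :> R.
    by apply: zxy; case: h => /=; rewrite in_itv/= => /andP[? ?]; [left|right].
  by rewrite xx0 (leNgt y x0) x0y /= subr0 addrAC subrr sub0r normrN normr1.
Qed.

Section circle_transport.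
Context {R : realType}.
Local Notation TR := (measurableTypeR R).
Variables (P : probability TR R) (tP : torus_prob P) (x0 : R).
Hypothesis x0pi : - pi <= x0 <= pi.

Let F := distr_fun P.
Let p := F x0.
Let npi_pi : - pi < pi :> R. Proof. exact: ltNpi_pi. Qed.

Lemma torus_distr_funNpi : distr_fun P (- pi) = 0.
Proof.
have h := measure_itvoc P (ltW npi_pi); have := tP; rewrite /torus_prob /torus h.
move=> /eqP; rewrite eqe => /eqP e; have := distr_fun_le1 P pi; have := distr_fun_ge0 P (- pi).
by move: e; lra.
Qed.

Lemma torus_distr_funpi : distr_fun P pi = 1.
Proof.
have h := measure_itvoc P (ltW npi_pi); have := tP; rewrite /torus_prob /torus h.
move=> /eqP; rewrite eqe => /eqP e; have := distr_fun_le1 P pi; have := distr_fun_ge0 P (- pi).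
by move: e; lra.
Qed.

(** The quantile function of P on the circle read from x0 instead of from
    - pi: the levels are shifted cyclically by the mass p of ]- pi, x0]. *)
Definition circle_quantile (u : TR) : TR :=
  if u <= 1 - p then quantile P (- pi) pi (u + p)
  else quantile P (- pi) pi (u + p - 1).

Lemma circle_quantile_in u : - pi <= circle_quantile u <= pi.
Proof.
by rewrite /circle_quantile; case: ifP => _;
  rewrite quantile_ge ?quantile_le// ?torus_distr_funNpi ?torus_distr_funpi.
Qed.

Lemma measurable_circle_quantile : measurable_fun setT circle_quantile.
Proof.
apply: measurable_fun_ifT => //.
- by apply: measurable_fun_ler.
- apply: (measurableT_comp (measurable_quantile P npi_pi)) => //.
  exact: measurable_funD.
- apply: (measurableT_comp (measurable_quantile P npi_pi)) => //.
  by apply: measurable_funB => //; exact: measurable_funD.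
Qed.

(** The mass of the arc that runs counterclockwise from x0 to z. *)
Definition circle_distr (z : R) : R := F z - p + (z < x0)%R%:R.

Lemma circle_distr01 z : 0 <= circle_distr z <= 1.
Proof.
rewrite /circle_distr /p.
have [zx|xz] := ltP z x0.
  have := distr_fun_nd P (ltW zx); have := distr_fun_ge0 P z.
  by have := distr_fun_le1 P x0; rewrite /F /=; lra.
have := distr_fun_nd P xz; have := distr_fun_ge0 P x0.
by have := distr_fun_le1 P z; rewrite /F /=; lra.
Qed.

Lemma circle_quantile_leE u z : 0 < u <= 1 ->
  ((circle_quantile u <= z)%R%:R : R) =
  (u <= circle_distr z)%R%:R - (z < x0)%R%:R + (1 - (u <= 1 - p)%R%:R).
Proof.
move=> /andP[u0 u1]; have p0 : 0 <= p := distr_fun_ge0 P x0.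
have p1 : p <= 1 := distr_fun_le1 P x0.
have Fz0 : 0 <= F z := distr_fun_ge0 P z.
have Fz1 : F z <= 1 := distr_fun_le1 P z.
have qle v : 0 < v <= 1 -> (quantile P (- pi) pi v <= z) = (v <= F z).
  by move=> hv; rewrite (quantile_le_iff npi_pi)// ?torus_distr_funNpi ?torus_distr_funpi.
rewrite /circle_quantile /circle_distr; have [up|up] := leP u (1 - p).
  rewrite qle; last by apply/andP; split; lra.
  have [zx|xz] /= := ltP z x0.
    have Fzp : F z <= p := distr_fun_nd P (ltW zx).
    by case: leP => h1; case: leP => h2 /=; lra.
  by case: leP => h1; case: leP => h2 /=; lra.
rewrite qle; last by apply/andP; split; lra.
have [zx|xz] /= := ltP z x0.
  by case: leP => h1; case: leP => h2 /=; lra.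
have Fzp : p <= F z := distr_fun_nd P xz.
by case: leP => h1; case: leP => h2 /=; lra.
Qed.

(** Two laws with the same distribution function agree, and
    [circle_quantile_leE] computes the distribution function of the image. *)
Lemma circle_quantile_law A : measurable A ->
  pushforward unif01 circle_quantile A = P A.
Proof.
pose q : {mfun TR >-> TR} := HB.pack circle_quantile
  (isMeasurableFun.Build _ _ _ _ _ measurable_circle_quantile).
move: A; apply: (@eq_distr_fun _ (distribution unif01 q)) => z; rewrite {1}/distr_fun.
set mu := (X in fine (X _)).
have mq : measurable_fun setT (fun u : TR => ((circle_quantile u <= z)%R%:R : R)).
  apply: measurable_natr_bool; apply: measurable_fun_ler => //.
  exact: measurable_circle_quantile.
have -> : mu `]-oo, z]%classic =
    (\int[unif01]_u ((circle_quantile u <= z)%R%:R)%:E)%E.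
  transitivity (unif01 ((circle_quantile @^-1` `]-oo, z]) `&` setT)).
    by rewrite setIT.
  rewrite -integral_indic//; last first.
    by rewrite -[X in measurable X]setTI; exact: measurable_circle_quantile.
  apply: eq_integral => u _; rewrite indicE; congr ((_ : bool)%:R%:E).
  by apply/idP/idP; rewrite inE/= in_itv.
have p01 : 0 <= 1 - p <= 1.
  by rewrite subr_ge0 distr_fun_le1/= gerBl distr_fun_ge0.
set I := (\int[unif01]_u _)%E.
suff : (I + ((z < x0)%R%:R + (1 - p))%:E = (circle_distr z + 1)%:E)%E.
  case: I => [i| |]//; rewrite -EFinD => /eqP; rewrite eqe => /eqP /=.
  by rewrite /circle_distr -/(F z); lra.
rewrite EFinD -(integral_unif01_ler p01).
have -> : ((z < x0)%R%:R : R)%:E = (\int[unif01]_u ((z < x0)%R%:R : R)%:E)%E.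
  by rewrite integral_prob_cst.
rewrite /I EFinD -(integral_unif01_ler (circle_distr01 z)).
have -> : (1 = \int[unif01]_u (1 : R)%:E :> \bar R)%E.
  by rewrite integral_prob_cst.
have mc c : measurable_fun setT (fun u : TR => ((u <= c)%R%:R)%:E : \bar R).
  by apply/measurable_EFinP; exact: measurable_ler_cst.
rewrite -!ge0_integralD//; try by [move=> *; rewrite -?EFinD lee_fin ?addr_ge0|
  exact/measurable_EFinP|apply: emeasurable_funD => //; exact/measurable_EFinP].
apply: eq_integral_unif01.
- apply: emeasurable_funD; first exact/measurable_EFinP.
  exact: emeasurable_funD.
- exact: emeasurable_funD.
- by move=> u; rewrite -!EFinD lee_fin !addr_ge0.
- by move=> u; rewrite -!EFinD lee_fin !addr_ge0.
move=> u u01; rewrite circle_quantile_leE// -!EFinD; congr EFin; lra.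
Qed.

End circle_transport.

Section haar_integrals.
Context {R : realType}.
Local Notation TR := (measurableTypeR R).
Local Open Scope ereal_scope.

Lemma integral_haar (f : TR -> \bar R) : measurable_fun setT f ->
  (forall x, 0 <= f x) ->
  \int[haar]_x f x =
  (2 * pi)^-1%:E * \int[lebesgue_measure]_(x in `[(- pi)%R, pi]) f x.
Proof.
by move=> mf f0; rewrite /haar integral_uniform//; congr ((_^-1)%:E * _); ring.
Qed.

Lemma integral_haar_lebesgue (f : TR -> \bar R) : measurable_fun setT f ->
  (forall x, 0 <= f x) ->
  \int[lebesgue_measure]_(x in `[(- pi)%R, pi]) f x =
  (2 * pi)%:E * \int[haar]_x f x.
Proof.
move=> mf f0; rewrite integral_haar// muleA -EFinM mulfV ?mul1e//.
by rewrite mulf_neq0// gt_eqF// pi_gt0.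
Qed.

Lemma le_integral_haar (f g : TR -> \bar R) : measurable_fun setT f ->
  measurable_fun setT g -> (forall x, 0 <= f x) -> (forall x, 0 <= g x) ->
  (forall x, (- pi <= x <= pi)%R -> f x <= g x) ->
  \int[haar]_x f x <= \int[haar]_x g x.
Proof.
move=> mf mg f0 g0 fg; rewrite !integral_haar//; apply: lee_pmul => //.
- by rewrite lee_fin invr_ge0 mulr_ge0// pi_ge0.
- by apply: integral_ge0.
by apply: ge0_le_integral => //; exact: measurable_funTS.
Qed.

End haar_integrals.

Section W1_bounds.
Context {R : realType}.
Local Notation TR := (measurableTypeR R).
Local Open Scope ereal_scope.

Lemma W1_le_map (P S : probability TR R) (X Y : TR -> TR) :
  measurable_fun setT X -> measurable_fun setT Y ->
  (forall A, measurable A -> pushforward unif01 X A = P A) ->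
  (forall A, measurable A -> pushforward unif01 Y A = S A) ->
  W1 P S <= \int[unif01]_u (chord (X u) (Y u))%:E.
Proof.
move=> mX mY XP YS.
pose XY (u : TR) : TR * TR := (X u, Y u).
have mXY : measurable_fun setT XY by apply/measurable_fun_pairP; split.
pose mfXY : {mfun TR >-> (TR * TR)%type} := HB.pack XY (isMeasurableFun.Build _ _ _ _ _ mXY).
apply: ereal_inf_lbound; exists (distribution unif01 mfXY : probability _ _).
  move=> A mA; split.
    transitivity (pushforward unif01 X A); last exact: XP.
    rewrite /distribution /pushforward; congr (unif01 _).
    by apply/seteqP; split => u //= [].
  transitivity (pushforward unif01 Y A); last exact: YS.
  rewrite /distribution /pushforward; congr (unif01 _).
  by apply/seteqP; split => u //= [].
rewrite ge0_integral_distribution//.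
- by apply/measurable_EFinP; exact: measurable_chord.
- by move=> z; rewrite lee_fin chord_ge0.
Qed.

(** The circular quantiles of P and S at the same level form a coupling. By
    [le_chord_crossings] its cost is at most the measure of the points z that
    separate the two quantiles; for a fixed z, the set of levels for which this
    happens has as measure the difference of the masses given to the arc from x0
    to z. *)
Lemma W1_le_cut (P S : probability TR R) (x0 : R) :
  torus_prob P -> torus_prob S -> (- pi <= x0 <= pi)%R ->
  W1 P S <= (2 * pi)%:E * \int[haar]_x
    `|(distr_fun P x - distr_fun S x) - (distr_fun P x0 - distr_fun S x0)|%:E.
Proof.
move=> tP tS x0pi.
pose X := circle_quantile P x0; pose Y := circle_quantile S x0.
have mX : measurable_fun setT X by exact: measurable_circle_quantile.
have mY : measurable_fun setT Y by exact: measurable_circle_quantile.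
apply: le_trans (W1_le_map mX mY (@circle_quantile_law _ _ tP x0)
  (@circle_quantile_law _ _ tS x0)) _.
pose g (u z : TR) : R :=
  `|((X u <= z)%R%:R - (X u <= x0)%R%:R) - ((Y u <= z)%R%:R - (Y u <= x0)%R%:R)|%R.
have mg : measurable_fun setT (fun w : TR * TR => (g w.1 w.2)).
  apply: measurableT_comp => //; apply: measurable_funB; apply: measurable_funB => //;
    by apply: measurable_natr_bool; apply: measurable_fun_ler => //; exact: measurableT_comp.
have mgE : measurable_fun setT (fun w : TR * TR => (g w.1 w.2)%:E).
  exact/measurable_EFinP.
have g0 (w : TR * TR) : 0 <= (g w.1 w.2)%:E by rewrite lee_fin normr_ge0.
have g0' u z : 0 <= (g u z)%:E by exact: (g0 (u, z)).
have mgl u : measurable_fun setT (fun z : TR => (g u z)%:E).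
  exact: (measurableT_comp mgE (pair1_measurable u)).
have mgr z : measurable_fun setT (fun u : TR => (g u z)%:E).
  exact: (measurableT_comp mgE (pair2_measurable z)).
have twopi0 : 0 <= (2 * pi : R)%:E by rewrite lee_fin mulr_ge0// pi_ge0.
have mF : measurable_fun setT (fun u : TR => \int[haar]_z (g u z)%:E).
  exact: (measurable_fun_fubini_tonelli_F _ mgE g0).
apply: (@le_trans _ _ (\int[unif01]_u ((2 * pi)%:E * \int[haar]_z (g u z)%:E))).
  apply: ge0_le_integral => //.
  - by move=> u _; rewrite lee_fin chord_ge0.
  - have mXY := measurable_fun_pair mX mY.
    by apply/measurable_EFinP; exact: (measurableT_comp measurable_chord mXY).
  - exact: emeasurable_funM.
  - move=> u _; rewrite -integral_haar_lebesgue//.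
    apply: le_chord_crossings => //; exact: circle_quantile_in.
rewrite ge0_integralZl//; last by move=> u _; exact: integral_ge0.
apply: lee_pmul => //.
  by apply: integral_ge0 => u _; exact: integral_ge0.
rewrite (fubini_tonelli (fun w : TR * TR => (g w.1 w.2)%:E))//=.
apply: le_integral_haar => //.
- exact: (measurable_fun_fubini_tonelli_G _ mgE g0).
- apply/measurable_EFinP; apply: measurableT_comp => //; apply: measurable_funB => //.
  by apply: measurable_funB; exact: measurable_distr_fun.
- by move=> z; exact: integral_ge0.
move=> z zpi.
have -> : \int[unif01]_u (g u z)%:E = \int[unif01]_u
   (`|(u <= circle_distr P x0 z)%R%:R - (u <= circle_distr S x0 z)%R%:R|)%:E.
  apply: eq_integral_unif01 => //.
  - apply/measurable_EFinP; apply: measurableT_comp => //.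
    by apply: measurable_funB; exact: measurable_ler_cst.
  move=> u u01; rewrite /g !circle_quantile_leE//.
  have e (Q : probability TR R) : circle_distr Q x0 x0 = 0%R.
    by rewrite /circle_distr subrr ltxx addr0.
  rewrite !e; congr (`|_|%:E); ring.
rewrite integral_unif01_dist ?circle_distr01// lee_fin /circle_distr.
by rewrite le_eqVlt; apply/orP; left; apply/eqP; congr (`|_|)%R; ring.
Qed.

Lemma W1_le_mean (P S : probability TR R) :
  torus_prob P -> torus_prob S ->
  W1 P S <= (2 * pi)%:E * \int[haar]_y \int[haar]_x
    `|(distr_fun P x - distr_fun S x) - (distr_fun P y - distr_fun S y)|%:E.
Proof.
move=> tP tS; have twopi0 : 0 <= (2 * pi : R)%:E by rewrite lee_fin mulr_ge0// pi_ge0.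
pose D (w : TR * TR) :=
  `|(distr_fun P w.2 - distr_fun S w.2) - (distr_fun P w.1 - distr_fun S w.1)|%:E.
have mD : measurable_fun setT D.
  apply/measurable_EFinP/measurableT_comp => //.
  by apply: measurable_funB; apply: measurable_funB; apply: measurableT_comp => //;
    exact: measurable_distr_fun.
have D0 w : 0 <= D w by rewrite lee_fin.
have mI := measurable_fun_fubini_tonelli_F (m2 := haar) _ mD D0.
rewrite -(@integral_prob_cst _ TR R haar (W1 P S)) -ge0_integralZl//; last first.
  by move=> y _; apply: integral_ge0 => x _; exact: (D0 (y, x)).
have W0 : 0 <= W1 P S.
  apply: le_ereal_inf_tmp => _ [gam _ <-]; apply: integral_ge0 => z _.
  by rewrite lee_fin chord_ge0.
apply: le_integral_haar => //.
- by apply: emeasurable_funM.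
- by move=> y; apply: mule_ge0 => //; apply: integral_ge0 => x _; exact: (D0 (y, x)).
by move=> y ypi; exact: W1_le_cut.
Qed.

End W1_bounds.

(** * Energies of convex kernels on the circle *)

Section torus_integrals.
Context {R : realType}.
Local Notation TR := (measurableTypeR R).
Local Open Scope ereal_scope.
Variables (P : probability TR R) (tP : torus_prob P).

Lemma torus_ae : {ae P, forall x, torus x}.
Proof.
exists (~` torus); split.
- by apply: measurableC; exact: measurable_itv.
- rewrite probability_setC//; last exact: measurable_itv.
  by rewrite tP subee.
- by move=> x.
Qed.

Lemma le_integral_torus (f g : TR -> \bar R) : measurable_fun setT f ->
  measurable_fun setT g -> (forall x, 0 <= f x) -> (forall x, 0 <= g x) ->
  (forall x, torus x -> f x <= g x) -> \int[P]_x f x <= \int[P]_x g x.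
Proof.
move=> mf mg f0 g0 fg; apply: ae_ge0_le_integral => //.
case: (torus_ae) => N [mN PN sN]; exists N; split=> //.
by apply: subset_trans sN; apply: subsetC => x /= tx _; exact: fg.
Qed.

End torus_integrals.

Lemma haar_torus_prob (R : realType) : torus_prob (haar : probability (measurableTypeR R) R).
Proof.
rewrite /torus_prob -[X in haar X]setIT -integral_indic//; last exact: measurable_itv.
have twopi0 : 0 < 2 * pi :> R by rewrite mulr_gt0// pi_gt0.
rewrite integral_haar//; last first.
  by apply/measurable_EFinP; apply: measurable_indic; exact: measurable_itv.
have -> : (\int[lebesgue_measure]_(x in `[(- pi)%R, pi]) (\1_torus x : R)%:E =
    lebesgue_measure (`](- pi)%R, pi]%classic : set R))%E.
  rewrite integral_indic//=; last exact: measurable_itv.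
  by rewrite setIidl//; exact: subset_itv_oc_cc.
rewrite lebesgue_measure_itv/= lte_fin ltNpi_pi -EFinB -EFinM; congr EFin.
have -> : pi - - pi = 2 * pi :> R by ring.
by rewrite mulVf// gt_eqF.
Qed.

Section product_probability.
Context d1 d2 (T1 : measurableType d1) (T2 : measurableType d2) (R : realType).
Local Open Scope ereal_scope.

Definition prod_prob (P : probability T1 R) (S : probability T2 R) :
  probability (T1 * T2)%type R := (P \x S)%E.

Lemma integral_prod_prob (P : probability T1 R) (S : probability T2 R)
    (f : T1 * T2 -> \bar R) : measurable_fun setT f -> (forall u, 0 <= f u) ->
  \int[prod_prob P S]_u f u = \int[P]_x \int[S]_y f (x, y).
Proof. by move=> mf f0; rewrite -(fubini_tonelli1 f). Qed.

Lemma integral_iter (P : probability T1 R) (S : probability T2 R)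
    (f : T1 -> T2 -> \bar R) : measurable_fun setT (fun u => f u.1 u.2) ->
  (forall x y, 0 <= f x y) ->
  \int[P]_x \int[S]_y f x y = \int[prod_prob P S]_u f u.1 u.2.
Proof. by move=> mf f0; rewrite integral_prod_prob. Qed.

Lemma measurable_integral_l (S : probability T2 R) (f : T1 -> T2 -> \bar R) :
  measurable_fun setT (fun u => f u.1 u.2) -> (forall x y, 0 <= f x y) ->
  measurable_fun setT (fun x => \int[S]_y f x y).
Proof.
move=> mf f0.
exact: (measurable_fun_fubini_tonelli_F (m2 := S) _ mf (fun u => f0 u.1 u.2)).
Qed.

Lemma integral_swap (P : probability T1 R) (S : probability T2 R)
    (f : T1 -> T2 -> \bar R) :
  measurable_fun setT (fun u => f u.1 u.2) -> (forall x y, 0 <= f x y) ->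
  \int[P]_x \int[S]_y f x y = \int[S]_y \int[P]_x f x y.
Proof.
move=> mf f0.
exact: (@fubini_tonelli _ _ _ _ _ P S _ mf (fun u => f0 u.1 u.2)).
Qed.

End product_probability.

Lemma le_integral_torus2 (R : realType) (P S : probability (measurableTypeR R) R)
    (f g : measurableTypeR R * measurableTypeR R -> \bar R) :
  torus_prob P -> torus_prob S -> measurable_fun setT f ->
  measurable_fun setT g -> (forall u, 0 <= f u)%E -> (forall u, 0 <= g u)%E ->
  (forall x y, torus x -> torus y -> f (x, y) <= g (x, y))%E ->
  (\int[prod_prob P S]_u f u <= \int[prod_prob P S]_u g u)%E.
Proof.
move=> tP tS mf mg f0 g0 fg; rewrite !integral_prod_prob//.
apply: le_integral_torus => //.
- exact: (measurable_fun_fubini_tonelli_F (m2 := S)).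
- exact: (measurable_fun_fubini_tonelli_F (m2 := S)).
- by move=> x; apply: integral_ge0.
- by move=> x; apply: integral_ge0.
move=> x tx; apply: le_integral_torus => //; last by move=> y; exact: fg.
- exact: (measurableT_comp mf (pair1_measurable x)).
- exact: (measurableT_comp mg (pair1_measurable x)).
Qed.

Lemma nneg_ltyE (R : realType) (x : \bar R) :
  (0 <= x)%E -> (x < +oo)%E -> exists2 r : R, 0 <= r & x = r%:E.
Proof. by case: x => [r| |]// r0 _; exists r. Qed.

Section ftc.
Context {R : realType}.

Lemma integral_is_derive (f F : R -> R) (a b : R) : a <= b ->
  (forall x, a <= x <= b -> is_derive x 1 F (f x)) ->
  (forall x, a <= x <= b -> {for x, continuous f}) ->
  (\int[lebesgue_measure]_(x in `[a, b]) (f x)%:E = (F b - F a)%:E)%E.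
Proof.
move=> ab dF cf; move: ab; rewrite le_eqVlt => /predU1P[<-|ab].
  by rewrite set_itv1 integral_set1 subrr.
have cF x : a <= x <= b -> {for x, continuous F}.
  move=> xab; apply: differentiable_continuous; apply/derivable1_diffP.
  by have [] := dF _ xab.
rewrite EFinB; apply: continuous_FTC2 => //.
- by apply: continuous_in_subspaceT => x; rewrite inE/= in_itv/= => /cf.
- split.
  + by move=> x; rewrite in_itv/= => /andP[/ltW ax /ltW xb]; have [] := dF x; rewrite ?ax.
  + by apply: cvg_at_right_filter; apply: cF; rewrite lexx ltW.
  + by apply: cvg_at_left_filter; apply: cF; rewrite lexx ltW.
- move=> x; rewrite in_itv/= => /andP[/ltW ax /ltW xb].
  have xab : a <= x <= b by rewrite ax.
  by have [_ <-] := dF x xab; rewrite derive1E.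
Qed.

End ftc.

(** Allows the terms of [convex_kernel_energy] to be taken as reals. *)
Lemma real_sum_lty (R : realType) (k r : R) (q a b : \bar R) : 0 < k ->
  (0 <= q -> 0 <= a -> 0 <= b -> r%:E = k%:E * q + (a + b) ->
  q < +oo /\ a < +oo)%E.
Proof.
move=> k0; case: q => [q| |]//; case: a => [a| |]//; case: b => [b| |]//.
- by move=> *; rewrite !ltry.
- by rewrite gt0_muley// lte_fin.
- by rewrite gt0_muley// lte_fin.
- by rewrite gt0_muley// lte_fin.
- by rewrite gt0_muley// lte_fin.
Qed.

Section convex_kernel.
Context {R : realType}.
Local Notation TR := (measurableTypeR R).
Variables (phi phi1 phi2 : R -> R) (c : R).
Hypotheses (dphi : forall t, 0 <= t <= 2 * pi -> is_derive t 1 phi (phi1 t))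
  (dphi1 : forall t, 0 <= t <= 2 * pi -> is_derive t 1 phi1 (phi2 t))
  (cphi2 : forall t, 0 <= t <= 2 * pi -> {for t, continuous phi2})
  (phi_sym : forall t, phi (2 * pi - t) = phi t)
  (phi_ge0 : forall t, 0 <= phi t) (phi2_ge0 : forall t, 0 <= phi2 t)
  (phi2_ge : forall t, 0 <= t <= 2 * pi -> c <= phi2 t)
  (c_ge0 : 0 <= c)
  (mphi : measurable_fun setT phi) (mphi2 : measurable_fun setT phi2).

Let W (z w : R) : R := ((z < w)%R%:R * phi2 (w - z))%R.
Let chi (x z w : R) : R := (z < x <= w)%R%:R.

Lemma convex_kernel_inner (z y : R) : - pi <= z <= pi -> z <= y <= pi ->
  (\int[lebesgue_measure]_(w in `[y, pi]) (phi2 (w - z))%:E =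
   (phi1 (pi - z) - phi1 (y - z))%:E)%E.
Proof.
move=> zpi /andP[zy ypi].
apply: (@integral_is_derive _ (fun w => phi2 (w - z)) (fun w => phi1 (w - z))) => //.
  move=> w wy; have h : 0 <= w - z <= 2 * pi by lra.
  have := dphi1 h => hd.
  rewrite -[phi2 _]mulr1; apply: (@is_derive1_comp _ phi1 (fun w => w - z)) => //.
  by rewrite -[X in is_derive _ _ _ X](subr0 1); apply: is_deriveB.
move=> w wy; have h : 0 <= w - z <= 2 * pi by lra.
apply: (@continuous_comp _ _ _ (fun w => w - z) phi2); last exact: cphi2.
by apply: cvgB; [exact: cvg_id|exact: cvg_cst].
Qed.

Let phi1_continuous (y z : R) : - pi <= z -> z <= y <= pi ->
  {for z, continuous (fun z => phi1 (pi - z) - phi1 (y - z))}.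
Proof.
move=> pz zy.
have cphi1 a : z <= a <= pi -> {for z, continuous (fun z => phi1 (a - z))}.
  move=> za; apply: (@continuous_comp _ _ _ (fun z => a - z) phi1).
    by apply: cvgB; [exact: cvg_cst|exact: cvg_id].
  apply: differentiable_continuous; apply/derivable1_diffP.
  have h : 0 <= a - z <= 2 * pi by lra.
  by have [] := dphi1 h.
by apply: cvgB; apply: cphi1; lra.
Qed.

Lemma convex_kernel_outer (x y : R) : - pi <= x -> x <= y <= pi ->
  (\int[lebesgue_measure]_(z in `[(- pi)%R, x]) (phi1 (pi - z) - phi1 (y - z))%:E =
   (phi (y - x) + phi (2 * pi) - phi (pi + x) - phi (pi + y))%:E)%E.
Proof.
move=> pix /andP[xy ypi].
pose F z := phi (y - z) - phi (pi - z).
have dF a z : z <= a <= pi -> - pi <= z ->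
   is_derive z 1 (fun z => phi (a - z)) (- phi1 (a - z)).
  move=> za pz; have h : 0 <= a - z <= 2 * pi by lra.
  have := dphi h => hd.
  rewrite -mulrN1; apply: (@is_derive1_comp _ phi (fun z => a - z)) => //.
  by rewrite -[X in is_derive _ _ _ X](sub0r 1); apply: is_deriveB.
transitivity (F x - F (- pi))%:E; last first.
  rewrite /F opprK; congr EFin.
  have -> : pi + pi = 2 * pi :> R by ring.
  have -> : phi (pi - x) = phi (pi + x) by rewrite -phi_sym; congr phi; ring.
  have -> : pi + y = y + pi :> R by ring.
  ring.
apply: (@integral_is_derive _ (fun z => phi1 (pi - z) - phi1 (y - z)) F) => //.
  move=> z zx; rewrite /F.
  have -> : phi1 (pi - z) - phi1 (y - z) = - phi1 (y - z) - (- phi1 (pi - z)) by ring.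
  by apply: is_deriveB; apply: dF; lra.
by move=> z zx; apply: phi1_continuous; lra.
Qed.

Local Open Scope ereal_scope.

Let mW : measurable_fun setT (fun u : TR * TR => (W u.1 u.2)%:E).
Proof.
apply/measurable_EFinP; apply: measurable_funM.
  by apply: measurable_natr_bool; apply: measurable_fun_ltr.
apply: (@measurableT_comp _ _ _ _ _ _ (phi2 : TR -> TR)) => //.
exact: measurable_funB.
Qed.

Let W0 z w : (0 <= W z w)%R.
Proof. by rewrite mulr_ge0. Qed.

Let chi0 x z w : (0 <= chi x z w)%R. Proof. by []. Qed.

Let mchi3 : measurable_fun setT
  (fun v : TR * (TR * TR) => (chi v.1 v.2.1 v.2.2 : R)).
Proof.
apply: measurable_natr_bool; apply: measurable_and.
  apply: measurable_fun_ltr => //; exact: measurableT_comp.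
apply: measurable_fun_ler => //; exact: measurableT_comp.
Qed.

Let lam := (haar : probability TR R).

(** The kernel is a superposition of tents: integrating phi'' once in w and
    once in z recovers phi up to its values at the ends, and the product of the
    indicators of z < x <= w and z < y <= w confines (z, w) to z < min(x, y),
    max(x, y) <= w. *)
Lemma convex_kernelE (x y : R) : torus x -> torus y ->
  (phi `|x - y| + phi (2 * pi))%:E =
  ((2 * pi) ^+ 2)%:E * \int[lam]_z \int[lam]_w (W z w * (chi x z w * chi y z w))%:E
  + (phi (pi + x) + phi (pi + y))%:E.
Proof.
wlog xy : x y / (x <= y)%R => [hw tx ty|].
  have [/hw|/ltW/hw] := leP x y; first exact.
  move=> /(_ ty tx); rewrite distrC => ->; rewrite [(phi (pi + x) + _)%R]addrC.
  have -> // : \int[lam]_z \int[lam]_w (W z w * (chi y z w * chi x z w))%:E =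
      \int[lam]_z \int[lam]_w (W z w * (chi x z w * chi y z w))%:E.
  apply: eq_integral => z _; apply: eq_integral => w _.
  by rewrite [(chi y _ _ * _)%R]mulrC.
rewrite /torus /= !in_itv/= => /andP[/ltW pix xpi] /andP[/ltW piy ypi].
pose f (u : TR * TR) := (W u.1 u.2 * (chi x u.1 u.2 * chi y u.1 u.2))%:E.
have f0 u : 0 <= f u by rewrite lee_fin !mulr_ge0.
have mf : measurable_fun setT f.
  apply/measurable_EFinP; apply: measurable_funM; first exact/measurable_EFinP.
  by apply: measurable_funM; apply: (measurableT_comp mchi3 (pair1_measurable _)).
have twopi0 : (0 <= 2 * pi :> R)%R by rewrite mulr_ge0// pi_ge0.
have mF := measurable_fun_fubini_tonelli_F (m2 := lam) f mf f0.
have F0 z : 0 <= fubini_F lam f z by apply: integral_ge0.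
have inner z : (- pi <= z <= pi)%R -> (2 * pi)%:E * fubini_F lam f z =
    if (z < x)%R then (phi1 (pi - z) - phi1 (y - z))%:E else 0.
  move=> zpi; rewrite /fubini_F /lam -integral_haar_lebesgue//; last first.
    exact: (measurableT_comp mf (pair1_measurable z)).
  case: ifPn => [zx|]; last first.
    rewrite -leNgt => xz; apply: integral0_eq => w _.
    by rewrite /f /chi /= ltNge xz/= mul0r mulr0.
  rewrite -convex_kernel_inner//; last by rewrite ypi andbT (le_trans (ltW zx)).
  have -> : `[y, pi]%classic = `[(- pi)%R, pi]%classic `&` [set w | (y <= w)%R].
    apply/seteqP; split => w /=; rewrite !in_itv/=.
      by move=> /andP[yw ->]; rewrite (le_trans piy yw).
    by move=> [/andP[_ ->] ->].
  rewrite integral_mkcondr; apply: eq_integral => w _; rewrite patchE.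
  have zy := lt_le_trans zx xy.
  have -> : (w \in [set w | (y <= w)%R]) = (y <= w)%R.
    by apply/idP/idP; rewrite inE.
  rewrite /f /chi /W /= zx zy/=; case: (leP y w) => yw /=; last by rewrite !mulr0.
  by rewrite (le_trans xy yw) (lt_le_trans zy yw) !mulr1 mul1r.
have -> : ((2 * pi) ^+ 2)%:E * \int[lam]_z \int[lam]_w (W z w * (chi x z w * chi y z w))%:E
   = (phi (y - x) + phi (2 * pi) - phi (pi + x) - phi (pi + y))%:E.
  transitivity ((2 * pi)%:E * \int[lam]_z ((2 * pi)%:E * fubini_F lam f z)).
    by rewrite ge0_integralZl// muleA -EFinM -expr2.
  rewrite -integral_haar_lebesgue//; last 2 first.
  - exact: emeasurable_funM.
  - by move=> z; rewrite mule_ge0.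
  rewrite -convex_kernel_outer ?xy//.
  have -> : \int[lebesgue_measure]_(z in `[(- pi)%R, x]) (phi1 (pi - z) - phi1 (y - z))%:E
    = \int[lebesgue_measure]_(z in `[(- pi)%R, x[) (phi1 (pi - z) - phi1 (y - z))%:E.
    rewrite integral_itv_bndo_bndc//; apply/measurable_EFinP.
    apply: subspace_continuous_measurable_fun => //.
    apply: continuous_in_subspaceT => z; rewrite inE/= in_itv/= => /andP[pz /ltW zx].
    by apply: phi1_continuous => //; rewrite (le_trans zx xy).
  have -> : `[(- pi)%R, x[%classic = `[(- pi)%R, pi]%classic `&` [set z | (z < x)%R].
    apply/seteqP; split => z /=; rewrite !in_itv/=.
      by move=> /andP[-> zx]; rewrite zx (ltW (lt_le_trans zx xpi)).
    by move=> [/andP[-> _] ->].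
  rewrite integral_mkcondr; apply: eq_integral => z; rewrite inE/= in_itv/= => zpi.
  rewrite patchE inner//.
  by have -> : (z \in [set z | (z < x)%R]) = (z < x)%R by apply/idP/idP; rewrite inE.
rewrite -EFinD distrC ger0_norm ?subr_ge0//; congr EFin; ring.
Qed.

Let I (P S : probability TR R) := \int[P]_x \int[S]_y (phi `|x - y|%R)%:E.

Let mphid : measurable_fun setT (fun u : TR * TR => phi `|u.1 - u.2|%R).
Proof.
apply: (measurableT_comp mphi); apply: measurableT_comp => //.
exact: measurable_funB.
Qed.

Let rho (P : probability TR R) (z w : R) : R := distr_fun P w - distr_fun P z.

Let integral_chi (P : probability TR R) z w : (z <= w)%R ->
  \int[P]_x (chi x z w)%:E = (rho P z w)%:E.
Proof.
move=> zw; rewrite /rho -measure_itvoc//.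
transitivity (P (`]z, w]%classic `&` setT)); last by rewrite setIT.
rewrite -integral_indic//; apply: eq_integral => x _; rewrite indicE /chi; congr ((_ : bool)%:R%:E).
by apply/idP/idP; rewrite inE/= in_itv.
Qed.

Let A (P : probability TR R) := \int[P]_x (phi (pi + x))%:E.

Let Q (P S : probability TR R) :=
  \int[lam]_z \int[lam]_w (W z w * (rho P z w * rho S z w))%:E.

Let mrho (P : probability TR R) : measurable_fun setT (fun u : TR * TR => rho P u.1 u.2).
Proof. by apply: measurable_funB; apply: measurableT_comp => //; exact: measurable_distr_fun. Qed.

Let W_rho_ge0 P S z w : (0 <= W z w * (rho P z w * rho S z w))%R.
Proof.
rewrite /W; case: (ltP z w) => [zw|_]; last by rewrite !mul0r.
by rewrite mulr_ge0 ?mulr_ge0// subr_ge0; apply: distr_fun_nd; exact: ltW.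
Qed.

Let mI : measurable_fun setT (fun u : TR * TR => (phi `|u.1 - u.2|%R)%:E).
Proof. exact/measurable_EFinP. Qed.

Let mA (b : R) : measurable_fun setT (fun x : TR => (phi (b + x)%R)%:E).
Proof.
by apply/measurable_EFinP; apply: (measurableT_comp mphi); exact: measurable_funD.
Qed.

Let g (u v : TR * TR) : \bar R :=
  (W v.1 v.2 * (chi u.1 v.1 v.2 * chi u.2 v.1 v.2))%:E.

Let g0 u v : 0 <= g u v.
Proof. by rewrite lee_fin !mulr_ge0. Qed.

Let mg : measurable_fun setT (fun uv : (TR * TR) * (TR * TR) => g uv.1 uv.2).
Proof.
apply/measurable_EFinP; apply: measurable_funM.
  by have /measurable_EFinP mW' := mW; exact: (measurableT_comp mW').
apply: measurable_funM.
  apply: (@measurableT_comp _ _ _ _ _ _ _ _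
    (fun uv : (TR * TR) * (TR * TR) => (uv.1.1, uv.2)) mchi3).
  by apply: measurable_fun_pair => //; exact: measurableT_comp.
apply: (@measurableT_comp _ _ _ _ _ _ _ _
  (fun uv : (TR * TR) * (TR * TR) => (uv.1.2, uv.2)) mchi3).
by apply: measurable_fun_pair => //; exact: measurableT_comp.
Qed.

Let mrr (P S : probability TR R) :
  measurable_fun setT (fun v : TR * TR => (W v.1 v.2 * (rho P v.1 v.2 * rho S v.1 v.2))%:E).
Proof.
apply/measurable_EFinP; apply: measurable_funM; first exact/measurable_EFinP.
by apply: measurable_funM; exact: mrho.
Qed.

(** Integrate [convex_kernelE] against P and S and exchange the integrals: the
    indicator of z < x <= w integrates to the increment of the distribution
    function. *)
Lemma convex_kernel_energy (P S : probability TR R) : torus_prob P -> torus_prob S ->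
  I P S + (phi (2 * pi))%:E = ((2 * pi) ^+ 2)%:E * Q P S + (A P + A S).
Proof.
move=> tP tS; pose lam2 := prod_prob lam lam; pose PS := prod_prob P S.
pose K u := \int[lam2]_v g u v.
have K0 u : 0 <= K u by exact: integral_ge0.
have mK : measurable_fun setT K.
  exact: measurable_integral_l.
have c0' : 0 <= (phi (2 * pi))%:E by rewrite lee_fin.
have twopi0 : 0 <= ((2 * pi) ^+ 2 : R)%:E by rewrite lee_fin sqr_ge0.
have b0 x : 0 <= (phi (pi + x)%R)%:E by rewrite lee_fin.
have mb1 : measurable_fun setT (fun u : TR * TR => (phi (pi + u.1)%R)%:E).
  exact: (measurableT_comp (mA pi)).
have mb2 : measurable_fun setT (fun u : TR * TR => (phi (pi + u.2)%R)%:E).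
  exact: (measurableT_comp (mA pi)).
have -> : I P S = \int[PS]_u (phi `|u.1 - u.2|%R)%:E.
  by rewrite integral_prod_prob// => u; rewrite lee_fin.
rewrite -(@integral_prob_cst _ _ R PS (phi (2 * pi))%:E) -ge0_integralD//; last first.
  by move=> u _; rewrite lee_fin.
transitivity (\int[PS]_u (((2 * pi) ^+ 2)%:E * K u +
    ((phi (pi + u.1)%R)%:E + (phi (pi + u.2)%R)%:E))).
  have h x y : torus x -> torus y -> (phi `|x - y|%R)%:E + (phi (2 * pi))%:E =
      ((2 * pi) ^+ 2)%:E * K (x, y) + ((phi (pi + x)%R)%:E + (phi (pi + y)%R)%:E).
    move=> tx ty; rewrite -!EFinD convex_kernelE// /K integral_prod_prob//.
    exact: (measurableT_comp mg (pair1_measurable (x, y))).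
  have m1 : measurable_fun setT (fun u : TR * TR => (phi `|u.1 - u.2|%R)%:E + (phi (2 * pi))%:E).
    exact: emeasurable_funD.
  have m2 : measurable_fun setT (fun u : TR * TR => ((2 * pi) ^+ 2)%:E * K u +
    ((phi (pi + u.1)%R)%:E + (phi (pi + u.2)%R)%:E)).
    by apply: emeasurable_funD; [exact: emeasurable_funM|exact: emeasurable_funD].
  have p1 (u : TR * TR) : 0 <= (phi `|u.1 - u.2|%R)%:E + (phi (2 * pi))%:E.
    by rewrite adde_ge0// lee_fin.
  have p2 (u : TR * TR) : 0 <= ((2 * pi) ^+ 2)%:E * K u +
    ((phi (pi + u.1)%R)%:E + (phi (pi + u.2)%R)%:E).
    by rewrite !adde_ge0// mule_ge0.
  by apply/eqP; rewrite eq_le; apply/andP; split; apply: le_integral_torus2 => // x y tx ty;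
    rewrite /= h.
rewrite ge0_integralD//; last 4 first.
- by move=> u _; rewrite mule_ge0.
- exact: emeasurable_funM.
- by move=> u _; rewrite adde_ge0.
- exact: emeasurable_funD.
rewrite ge0_integralZl// ge0_integralD//.
congr (_ + (_ + _)).
- congr (_ * _).
  rewrite /K integral_swap//=.
  rewrite /Q -(integral_prod_prob lam lam (f := fun v : TR * TR =>
    (W v.1 v.2 * (rho P v.1 v.2 * rho S v.1 v.2))%:E))//; last first.
    by move=> v; rewrite lee_fin W_rho_ge0.
  apply: eq_integral => -[z w] _ /=.
  rewrite integral_prod_prob//; last exact: (measurableT_comp mg (pair2_measurable (z, w))).
  rewrite /g /= /W; case: (ltP z w) => zw; last first.
    rewrite !mul0r; apply: integral0_eq => x _; apply: integral0_eq => y _.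
    by rewrite !mul0r.
  have mchi : measurable_fun setT (fun x : TR => (chi x z w)%:E).
    apply/measurable_EFinP.
    exact: (measurableT_comp mchi3 (pair2_measurable (z, w))).
  have chi0E x : 0 <= (chi x z w)%:E by rewrite lee_fin.
  have phi20E : 0 <= (phi2 (w - z))%:E by rewrite lee_fin.
  under eq_integral => x _.
    under eq_integral => y _ do rewrite mul1r mulrA EFinM.
    rewrite ge0_integralZl//; last by rewrite lee_fin mulr_ge0.
    rewrite integral_chi; last exact: ltW.
    rewrite EFinM -muleA muleCA.
    over.
  rewrite /= ge0_integralZr//; last first.
    by rewrite mule_ge0// lee_fin subr_ge0; apply: distr_fun_nd; exact: ltW.
  rewrite integral_chi; last exact: ltW.
  by rewrite muleCA -!EFinM mul1r.
- rewrite integral_prod_prob//; apply: eq_integral => x _.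
  by rewrite /= integral_prob_cst.
- by rewrite integral_prod_prob//= integral_prob_cst.
Qed.

Let Del (P S : probability TR R) (z w : R) : R := rho P z w - rho S z w.

Let mDel P S : measurable_fun setT (fun u : TR * TR => Del P S u.1 u.2).
Proof. by apply: measurable_funB; exact: mrho. Qed.

Let mDel2r P S : measurable_fun setT (fun u : TR * TR => (Del P S u.1 u.2 ^+ 2)%R).
Proof. exact: measurable_funX. Qed.

Let mDel2 P S : measurable_fun setT (fun u : TR * TR => (Del P S u.1 u.2 ^+ 2)%:E).
Proof. by apply/measurable_EFinP; exact: mDel2r. Qed.

Let mlt : measurable_fun setT (fun u : TR * TR => ((u.1 < u.2)%R%:R : R)).
Proof. by apply: measurable_natr_bool; apply: measurable_fun_ltr. Qed.

Let mltDel P S : measurable_fun setT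
  (fun u : TR * TR => ((u.1 < u.2)%R%:R * Del P S u.1 u.2 ^+ 2)%:E).
Proof.
by apply/measurable_EFinP; apply: measurable_funM => //; exact: mDel2r.
Qed.

(** The squared increment is symmetric in the two cut points, whereas the
    weight of [convex_kernel_energy] lives on z < w. *)
Let half_square P S :
  \int[lam]_z \int[lam]_w (Del P S z w ^+ 2)%:E =
  2%:E * \int[lam]_z \int[lam]_w ((z < w)%R%:R * Del P S z w ^+ 2)%:E.
Proof.
have lt0 z w : 0 <= ((z < w)%R%:R * Del P S z w ^+ 2)%:E.
  by rewrite lee_fin mulr_ge0// sqr_ge0.
have gt0 z w : 0 <= ((w < z)%R%:R * Del P S z w ^+ 2)%:E.
  by rewrite lee_fin mulr_ge0// sqr_ge0.
have mgt : measurable_fun setT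
    (fun u : TR * TR => ((u.2 < u.1)%R%:R * Del P S u.1 u.2 ^+ 2)%:E).
  apply/measurable_EFinP; apply: measurable_funM; last exact: mDel2r.
  by apply: measurable_natr_bool; apply: measurable_fun_ltr.
rewrite integral_iter//; last by move=> z w; rewrite lee_fin sqr_ge0.
transitivity (\int[prod_prob lam lam]_u
   (((u.1 < u.2)%R%:R * Del P S u.1 u.2 ^+ 2)%:E +
    ((u.2 < u.1)%R%:R * Del P S u.1 u.2 ^+ 2)%:E)).
  apply: eq_integral => -[z w] _ /=; rewrite -EFinD -mulrDl.
  have [zw|wz|->] := ltgtP z w; rewrite ?addr0 ?add0r ?mul1r//.
  by rewrite /Del /rho !subrr mul0r expr0n.
rewrite ge0_integralD// !integral_prod_prob//.
rewrite [X in _ + X]integral_swap//.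
have -> : \int[lam]_w \int[lam]_z ((w < z)%R%:R * Del P S z w ^+ 2)%:E =
    \int[lam]_z \int[lam]_w ((z < w)%R%:R * Del P S z w ^+ 2)%:E.
  apply: eq_integral => z _; apply: eq_integral => w _; congr (_ * _)%:E.
  by rewrite -sqrrN; congr (_ ^+ 2)%R; rewrite /Del /rho; ring.
by rewrite mule_natl mule2n.
Qed.

(** The terms that depend on one measure only cancel in I(P, P) - 2 I(P, S) +
    I(S, S), which leaves a weighted square. All energies are finite, so the
    cancellation can be carried out in the reals. *)
Lemma convex_kernel_gap (P S : probability TR R) : torus_prob P -> torus_prob S ->
  I P S < +oo -> I P P < +oo -> I S S < +oo ->
  2%:E * I P S + (2^-1 * c * (2 * pi) ^+ 2)%:E *
    \int[lam]_z \int[lam]_w (Del P S z w ^+ 2)%:E <= I P P + I S S.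
Proof.
move=> tP tS IPS IPP ISS.
have QE (P' S' : probability TR R) : Q P' S' = \int[prod_prob lam lam]_v
    (W v.1 v.2 * (rho P' v.1 v.2 * rho S' v.1 v.2))%:E.
  by rewrite integral_prod_prob// => v; rewrite lee_fin W_rho_ge0.
have mWD : measurable_fun setT (fun v : TR * TR => (W v.1 v.2 * Del P S v.1 v.2 ^+ 2)%:E).
  apply/measurable_EFinP; apply: measurable_funM; last exact: mDel2r.
  exact/measurable_EFinP.
have QWE : Q P P + Q S S = 2%:E * Q P S +
    \int[prod_prob lam lam]_v (W v.1 v.2 * Del P S v.1 v.2 ^+ 2)%:E.
  rewrite !QE -ge0_integralZl//; last first.
    by move=> v _; rewrite lee_fin W_rho_ge0.
  rewrite -!ge0_integralD//; last 5 first.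
  - by move=> v _; rewrite mule_ge0 ?lee_fin ?W_rho_ge0.
  - exact: emeasurable_funM.
  - by move=> v _; rewrite lee_fin mulr_ge0// sqr_ge0.
  - by move=> v _; rewrite lee_fin W_rho_ge0.
  - by move=> v _; rewrite lee_fin W_rho_ge0.
  apply: eq_integral => v _; rewrite -!EFinD; congr EFin; rewrite /Del; ring.
have QW : (2^-1 * c)%:E * \int[lam]_z \int[lam]_w (Del P S z w ^+ 2)%:E
    <= \int[prod_prob lam lam]_v (W v.1 v.2 * Del P S v.1 v.2 ^+ 2)%:E.
  rewrite half_square muleA -EFinM mulrAC mulVf// mul1r.
  rewrite integral_iter//; last by move=> z w; rewrite lee_fin mulr_ge0// sqr_ge0.
  rewrite -ge0_integralZl//; last by move=> u _; rewrite lee_fin mulr_ge0// sqr_ge0.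
  apply: le_integral_torus2 => //.
  - exact: haar_torus_prob.
  - exact: haar_torus_prob.
  - exact: emeasurable_funM.
  - by move=> u; rewrite mule_ge0// lee_fin mulr_ge0// sqr_ge0.
  - by move=> u; rewrite lee_fin mulr_ge0// sqr_ge0.
  move=> z w; rewrite /torus/= !in_itv/= => zpi wpi.
  rewrite -EFinM lee_fin mulrA ler_wpM2r ?sqr_ge0// /W.
  have [zw|_] := ltP z w; last by rewrite mulr0 mul0r.
  rewrite mulr1 mul1r; apply: phi2_ge; lra.
have k0 : (0 < (2 * pi) ^+ 2 :> R)%R by rewrite exprn_gt0// mulr_gt0// pi_gt0.
have Q0 (P' S' : probability TR R) : 0 <= Q P' S'.
  by apply: integral_ge0 => z _; apply: integral_ge0 => w _; rewrite lee_fin W_rho_ge0.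
have A0 (P' : probability TR R) : 0 <= A P' by apply: integral_ge0 => z _; rewrite lee_fin.
have I0 (P' S' : probability TR R) : 0 <= I P' S'.
  by apply: integral_ge0 => z _; apply: integral_ge0 => w _; rewrite lee_fin.
have D0 : 0 <= \int[lam]_z \int[lam]_w (Del P S z w ^+ 2)%:E.
  by apply: integral_ge0 => z _; apply: integral_ge0 => w _; rewrite lee_fin sqr_ge0.
have fin (P' S' : probability TR R) : torus_prob P' -> torus_prob S' ->
    I P' S' < +oo -> Q P' S' < +oo /\ A P' < +oo.
  move=> tP' tS' /(nneg_ltyE (I0 P' S')) [i _ iE].
  have := convex_kernel_energy tP' tS'; rewrite iE -EFinD.
  exact: real_sum_lty.
have [QPSy APy] := fin _ _ tP tS IPS.
have [QPPy _] := fin _ _ tP tP IPP.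
have [QSSy ASy] := fin _ _ tS tS ISS.
have := convex_kernel_energy tP tS; have := convex_kernel_energy tP tP.
have := convex_kernel_energy tS tS; move: QW QWE.
set X := \int[prod_prob lam lam]_v _; have X0 : 0 <= X.
  by apply: integral_ge0 => v _; rewrite lee_fin mulr_ge0// sqr_ge0.
have [ips _ ->] := nneg_ltyE (I0 _ _) IPS.
have [ipp _ ->] := nneg_ltyE (I0 _ _) IPP.
have [iss _ ->] := nneg_ltyE (I0 _ _) ISS.
have [qps _ ->] := nneg_ltyE (Q0 _ _) QPSy.
have [qpp _ ->] := nneg_ltyE (Q0 _ _) QPPy.
have [qss _ ->] := nneg_ltyE (Q0 _ _) QSSy.
have [ap _ ->] := nneg_ltyE (A0 _) APy.
have [as' _ ->] := nneg_ltyE (A0 _) ASy.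
move: X0; case: X => [x _|_ _|//]; last by rewrite -EFinM -EFinD.
rewrite [(2^-1 * c * _)%R]mulrC (EFinM ((2 * pi) ^+ 2)) -(muleA ((2 * pi) ^+ 2)%:E).
set Y := (2^-1 * c)%:E * _; have Y0 : 0 <= Y by rewrite mule_ge0// lee_fin mulr_ge0.
move=> Yx; move: Y0 Yx; case: Y => [y| |]// _; rewrite lee_fin => yx.
rewrite -!EFinM -!EFinD lee_fin => /eqP; rewrite eqe => /eqP QWE.
move=> /eqP; rewrite eqe => /eqP ESS.
move=> /eqP; rewrite eqe => /eqP EPP.
move=> /eqP; rewrite eqe => /eqP EPS.
have := ler_wpM2l (ltW k0) yx.
have : ((2 * pi) ^+ 2 * (qpp + qss) = (2 * pi) ^+ 2 * (2 * qps + x))%R by rewrite QWE.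
lra.
Qed.

End convex_kernel.

(** * Regularization of the logarithmic kernel *)

Lemma measurable_invr d (T : measurableType d) (R : realType) (f : T -> R) :
  measurable_fun setT f -> (forall x, 0 <= f x) ->
  measurable_fun setT (fun x => (f x)^-1).
Proof.
move=> mf f0; apply: (eq_measurable_fun (fun x => f x `^ (- 1))).
  by move=> x _; rewrite powR_inv1.
apply: (@measurableT_comp _ _ _ _ _ _ (fun y : R => y `^ (- 1))) => //.
Qed.

Section trigonometric_bounds.
Context {R : realType}.
Implicit Types t u x y : R.

Lemma cosB_abs u : cos `|u| = cos u.
Proof. by have [_|_] := ler0P u; rewrite ?cosN. Qed.

Lemma ler_cos_abs x y : `|x| <= `|y| -> `|y| <= pi -> cos y <= cos x.
Proof.
move=> xy ypi; rewrite -(cosB_abs x) -(cosB_abs y) leNgt ltr_cos ?in_itv/=.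
- by rewrite -leNgt.
- by rewrite normr_ge0.
- by rewrite normr_ge0 (le_trans xy).
Qed.

Lemma cos_lipschitz x y : cos x <= cos y + `|x - y|.
Proof.
pose s := (x + y) / 2; pose d := (x - y) / 2.
have -> : cos x = cos (s + d) by congr cos; rewrite /s /d; field.
have -> : cos y = cos (s - d) by congr cos; rewrite /s /d; field.
have -> : x - y = 2 * d by rewrite /d; field.
rewrite cosD cosB normrM (gtr0_norm (_ : 0 < 2))//.
have h1 := sin_max s; have h2 := abs_sin_le d.
have := ler_pM (normr_ge0 _) (normr_ge0 _) h1 h2; rewrite -normrM mul1r.
by have := ler_norm (- (sin s * sin d)); rewrite normrN; lra.
Qed.

(** The mean value theorem for sin on [0, u/2] together with the duplication
    formula; cos^2 >= 1/2 on [0, pi/4]. *)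
Lemma sin_ge_half u : 0 <= u <= pi / 2 -> u / 2 <= sin u.
Proof.
move=> /andP[u0 upi]; have pi0 := pi_gt0 R.
have c2 (v : R) : 0 <= v <= pi / 4 -> 2^-1 <= cos v ^+ 2.
  move=> /andP[v0 vpi]; have h : 0 <= cos (v *+ 2).
    by apply: cos_ge0_pihalf; rewrite -mulr_natl; apply/andP; split; lra.
  by move: h; rewrite cos_mulr2n -mulr_natl; lra.
have c0 (v : R) : 0 <= v <= pi / 4 -> 0 <= cos v.
  by move=> vpi; apply: cos_ge0_pihalf; apply/andP; split; lra.
have u20 : 0 <= u / 2 by lra.
have [|c cin] := @MVT_segment R sin cos 0 (u / 2) u20 (fun z _ => is_derive_sin z).
  by apply: continuous_subspaceT; exact: continuous_sin.
rewrite sin0 !subr0 => E; move: cin; rewrite in_itv/= => /andP[c_0 cu].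
have u4 : 0 <= u / 2 <= pi / 4 by apply/andP; split; lra.
have c4 : 0 <= c <= pi / 4 by apply/andP; split; lra.
have cc : cos (u / 2) <= cos c by apply: ler_cos_abs; rewrite !ger0_norm//; lra.
have -> : u = (u / 2) *+ 2 by rewrite -mulr_natl; field.
rewrite sin_mulr2n E -mulr_natl.
have h1 := c2 _ u4; have h2 := c0 _ u4; have h3 := c0 _ c4.
have h4 : 2^-1 <= cos (u / 2) * cos c.
  by apply: le_trans h1 _; rewrite expr2 ler_wpM2l.
by have := ler_wpM2l u20 h4; rewrite -mulr_natl; lra.
Qed.

Lemma abs_sin_half x y : torus x -> torus y ->
  `|sin ((x - y) / 2)| = cos ((pi - `|x - y|) / 2).
Proof.
rewrite /torus /= !in_itv/= => xpi ypi; have pi0 := pi_gt0 R.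
have -> : (pi - `|x - y|) / 2 = - (`|x - y| / 2 - pi / 2) by field.
rewrite cosN cosBpihalf.
wlog xy : x y xpi ypi / y <= x => [hw|].
  have [/hw->//|/ltW/hw] := leP y x.
  by rewrite distrC => <-//; rewrite -opprB mulNr sinN normrN.
rewrite (@ger0_norm _ (x - y)) ?subr_ge0// ger0_norm//.
by apply: sin_ge0_pi; lra.
Qed.

End trigonometric_bounds.

Section softlog.
Context {R : realType}.
Local Notation TR := (measurableTypeR R).
Variable d : R.
Hypotheses (d0 : 0 < d) (d1 : d < 1).
Implicit Types t x y : R.

(** On the circle |sin((x - y)/2)| = cos((pi - |x - y|)/2); shrinking the angle
    by the factor 1 - d keeps the cosine away from 0. The resulting function of
    t = |x - y| stays convex and symmetric around pi. *)
Definition softlog t : R := - ln (cos ((1 - d) * (pi - t) / 2)).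

Let th t : R := (1 - d) * (pi - t) / 2.
Let softlog1 t : R := - ((1 - d) / 2) * tan (th t).
Let softlog2 t : R := ((1 - d) / 2) ^+ 2 * (cos (th t)) ^- 2.

Lemma softlog_cos_gt0 t : 0 <= t <= 2 * pi -> 0 < cos (th t).
Proof.
move=> ht; have pi0 := pi_gt0 R; apply: cos_gt0_pihalf; rewrite /th.
have h1 : (1 - d) * `|pi - t| <= (1 - d) * pi.
  have d2 : 0 <= 1 - d by rewrite subr_ge0 ltW.
  apply: (ler_wpM2l d2); rewrite ler_norml; move/andP: ht => [? ?]; apply/andP; split; lra.
have h2 : (1 - d) * pi < pi by rewrite gtr_pMl// ltrBlDr ltrDl.
have := ler_norm ((1 - d) * (pi - t)); have := ler_norm (- ((1 - d) * (pi - t))).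
rewrite normrN normrM (@gtr0_norm _ (1 - d)) ?subr_gt0//.
clear d0 d1 ht.
by move=> h3 h4; apply/andP; split; lra.
Qed.

Let is_derive_th t : is_derive t 1 th (- ((1 - d) / 2)).
Proof.
have -> : th = (fun s => ((1 - d) / 2) * (pi - s)).
  by apply/funext => s; rewrite /th; field.
rewrite -mulrN1; apply: (@is_derive1_comp _ ( *%R ((1 - d) / 2)) (fun s => pi - s)).
  rewrite -[X in is_derive _ _ _ X]mulr1; exact: is_deriveZ.
by rewrite -[X in is_derive _ _ _ X](sub0r 1); apply: is_deriveB.
Qed.

Lemma is_derive_softlog t : 0 <= t <= 2 * pi ->
  is_derive t 1 softlog (softlog1 t).
Proof.
move=> /softlog_cos_gt0 ct.
have -> : softlog = - (fun s => ln (cos (th s))) by [].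
have -> : softlog1 t = - ((cos (th t))^-1 * (- sin (th t) * - ((1 - d) / 2))).
  by rewrite /softlog1 /tan; ring.
apply: is_deriveN; apply: (@is_derive1_comp _ (@ln R) (fun s => cos (th s))).
  exact: is_derive1_ln.
by apply: (@is_derive1_comp _ (@cos R) th); solve [exact: is_derive_cos | exact: is_derive_th].
Qed.

Lemma is_derive_softlog1 t : 0 <= t <= 2 * pi ->
  is_derive t 1 softlog1 (softlog2 t).
Proof.
move=> /softlog_cos_gt0 ct.
have -> : softlog2 t = - ((1 - d) / 2) * ((cos (th t)) ^- 2 * - ((1 - d) / 2)).
  by rewrite /softlog2; ring.
apply: (@is_deriveZ _ _ _ (fun s => tan (th s))).
apply: (@is_derive1_comp _ (@tan R) th).
  by apply: is_derive_tan; rewrite gt_eqF.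
exact: is_derive_th.
Qed.

Lemma softlog2_continuous t : 0 <= t <= 2 * pi -> {for t, continuous softlog2}.
Proof.
move=> /softlog_cos_gt0 ct; rewrite /softlog2.
have cth : {for t, continuous th}.
  by apply: differentiable_continuous; apply/derivable1_diffP; have [] := is_derive_th t.
have cc : {for t, continuous (fun s => cos (th s))}.
  by apply: (@continuous_comp _ _ _ th (@cos R)) => //; exact: continuous_cos.
apply: cvgM; first exact: cvg_cst.
apply: cvgV; first by rewrite expf_neq0// gt_eqF.
have -> : (fun x => cos (th x) ^+ 2) = (fun x => cos (th x) * cos (th x)).
  by apply/funext => x; rewrite expr2.
by rewrite expr2; exact: cvgM.
Qed.

Lemma softlog_sym t : softlog (2 * pi - t) = softlog t.
Proof. by rewrite /softlog -[X in _ = - ln X]cosN; congr (- ln (cos _)); field. Qed.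

Lemma softlog_ge0 t : 0 <= softlog t.
Proof. by rewrite oppr_ge0 ln_le0// cos_le1. Qed.

Let softlog2_ge0 t : 0 <= softlog2 t.
Proof. by rewrite mulr_ge0 ?sqr_ge0// invr_ge0 sqr_ge0. Qed.

Let softlog2_ge t : 0 <= t <= 2 * pi -> ((1 - d) / 2) ^+ 2 <= softlog2 t.
Proof.
move=> /softlog_cos_gt0 ct; rewrite ler_peMr ?sqr_ge0//.
by rewrite invf_ge1 ?exprn_gt0// expr_le1 ?cos_le1// ltW.
Qed.

Let measurable_cos_th : measurable_fun setT (fun t : TR => cos (th t) : R).
Proof.
apply: (@measurableT_comp _ _ _ _ _ _ (@cos R)).
  by apply: continuous_measurable_fun; exact: continuous_cos.
by apply: measurable_funM => //; apply: measurable_funM => //; exact: measurable_funB.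
Qed.

Lemma measurable_softlog : measurable_fun setT (softlog : TR -> R).
Proof.
apply: measurableT_comp => //; apply: measurableT_comp => //.
Qed.

Let measurable_softlog2 : measurable_fun setT (softlog2 : TR -> R).
Proof.
apply: measurable_funM => //; apply: measurable_invr; last by move=> t; exact: sqr_ge0.
exact: measurable_funX.
Qed.

(** [convex_kernel_gap] with phi'' = ((1 - d)/2)^2 / cos^2 >= ((1 - d)/2)^2. *)
Lemma softlog_gap (P S : probability TR R) : torus_prob P -> torus_prob S ->
  let I (P S : probability TR R) :=
    (\int[P]_x \int[S]_y (softlog `|x - y|%R)%:E)%E in
  (I P S < +oo -> I P P < +oo -> I S S < +oo ->
  2%:E * I P S + (2^-1 * ((1 - d) / 2) ^+ 2 * (2 * pi) ^+ 2)%:E *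
    \int[haar]_z \int[haar]_w (((distr_fun P w - distr_fun P z) -
      (distr_fun S w - distr_fun S z)) ^+ 2)%:E <= I P P + I S S)%E.
Proof.
move=> tP tS I.
exact: (convex_kernel_gap is_derive_softlog is_derive_softlog1 softlog2_continuous
  softlog_sym softlog_ge0 softlog2_ge0 softlog2_ge (sqr_ge0 _) measurable_softlog
  measurable_softlog2).
Qed.

End softlog.

Section inverse_sqrt.
Context {R : realType}.
Local Notation TR := (measurableTypeR R).
Implicit Types a b s x y : R.

Definition isqrt s : R := (Num.sqrt s)^-1.

Lemma isqrt_ge0 s : 0 <= isqrt s.
Proof. by rewrite invr_ge0 sqrtr_ge0. Qed.

Lemma isqrt_le s t : 0 < s -> s <= t -> isqrt t <= isqrt s.
Proof.
by move=> s0 st; rewrite lef_pV2 ?posrE ?sqrtr_gt0// ?ler_wsqrtr// (lt_le_trans s0).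
Qed.

Lemma isqrt_div4 s : 0 <= s -> isqrt (s / 4) = 2 * isqrt s.
Proof.
move=> s0; rewrite /isqrt sqrtrM// sqrtrV//.
have -> : Num.sqrt (4 : R) = 2 by rewrite (_ : 4 = 2 ^+ 2) ?sqrtr_sqr ?ger0_norm//; ring.
by rewrite invfM invrK mulrC.
Qed.

Lemma measurable_isqrt : measurable_fun setT (isqrt : TR -> R).
Proof.
apply: measurable_invr; last by move=> s; exact: sqrtr_ge0.
by apply: continuous_measurable_fun; exact: sqrt_continuous.
Qed.

Lemma is_derive_sqrt2 s : 0 < s -> is_derive s 1 (fun s : R => 2 * Num.sqrt s) (isqrt s).
Proof.
move=> s0; have -> : isqrt s = 2 * (2 * Num.sqrt s)^-1.
  by rewrite /isqrt invfM mulrA mulfV// mul1r.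
by apply: (@is_deriveZ _ _ _ (@Num.sqrt R)); exact: is_derive1_sqrt.
Qed.

Lemma isqrt_continuous s : 0 < s -> {for s, continuous isqrt}.
Proof.
by move=> s0; apply: cvgV; [rewrite gt_eqF// sqrtr_gt0|exact: sqrt_continuous].
Qed.

Local Open Scope ereal_scope.

(** Exhaust the half-open interval by the intervals [a + 1/n, b], where the
    primitive 2 sqrt is smooth. *)
Lemma integral_isqrt_right a b : (a <= b)%R ->
  \int[lebesgue_measure]_(y in `[a, b]) (isqrt (y - a))%:E <= (2 * Num.sqrt (b - a))%:E.
Proof.
move=> ab; have mf D : measurable_fun D (fun y : TR => (isqrt (y - a))%:E).
  apply/measurable_EFinP/measurable_funTS.
  by apply: (measurableT_comp measurable_isqrt); exact: measurable_funB.
rewrite -integral_itv_obnd_cbnd// itv_open_bnd_bigcup.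
have := @ge0_nondecreasing_set_cvg_integral _ TR R
  (fun n => `[(a + n.+1%:R^-1)%R, b]%classic) (fun y => (isqrt (y - a))%:E) lebesgue_measure.
move=> /(_ _ _ _ _)/cvg_lim <-//.
- apply: lime_le.
    apply: ereal_nondecreasing_is_cvgn => n m nm; apply: ge0_subset_integral => //.
    + by move=> y _; rewrite lee_fin isqrt_ge0.
    + by apply: subset_itvr; rewrite bnd_simp lerD2l lef_pV2 ?posrE// ler_nat.
  near=> n; have [anb|ban] := leP (a + n.+1%:R^-1)%R b; last first.
    rewrite set_itv_ge ?integral_set0 ?lee_fin ?mulr_ge0 ?sqrtr_ge0//.
    by rewrite bnd_simp -ltNge.
  have n0 : (0 < n.+1%:R^-1 :> R)%R by rewrite invr_gt0.
  have dF x : (a + n.+1%:R^-1 <= x <= b)%R ->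
      is_derive x 1%R (fun y => 2 * Num.sqrt (y - a))%R (isqrt (x - a)).
    move=> /andP[ax xb]; have xa : (0 < x - a)%R by rewrite subr_gt0 (lt_le_trans _ ax)// ltrDl.
    rewrite -[isqrt _]mulr1.
    apply: (@is_derive1_comp _ (fun s => 2 * Num.sqrt s)%R (fun y => y - a)%R).
      exact: is_derive_sqrt2.
    by rewrite -[X in is_derive _ _ _ X](subr0 1%R); apply: is_deriveB.
  have cf x : (a + n.+1%:R^-1 <= x <= b)%R -> {for x, continuous (fun y => isqrt (y - a))}.
    move=> /andP[ax xb]; have xa : (0 < x - a)%R by rewrite subr_gt0 (lt_le_trans _ ax)// ltrDl.
    apply: (@continuous_comp _ _ _ (fun w => w - a)%R isqrt); last exact: isqrt_continuous.
    by apply: cvgB; [exact: cvg_id|exact: cvg_cst].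
  rewrite (integral_is_derive anb dF cf).
  by rewrite lee_fin gerBl mulr_ge0// sqrtr_ge0.
- move=> n m nm; apply/subsetPset; apply: subset_itvr.
  by rewrite bnd_simp lerD2l lef_pV2 ?posrE// ler_nat.
- by move=> n y _; rewrite lee_fin isqrt_ge0.
- exact: mf.
Unshelve. all: by end_near. Qed.

Lemma integral_isqrt_left a b : (a <= b)%R ->
  \int[lebesgue_measure]_(y in `[a, b]) (isqrt (b - y))%:E <= (2 * Num.sqrt (b - a))%:E.
Proof.
move=> ab; have mf D : measurable_fun D (fun y : TR => (isqrt (b - y))%:E).
  apply/measurable_EFinP/measurable_funTS.
  by apply: (measurableT_comp measurable_isqrt); exact: measurable_funB.
rewrite -integral_itv_bndo_bndc// itv_bnd_open_bigcup.
have := @ge0_nondecreasing_set_cvg_integral _ TR R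
  (fun n => `[a, (b - n.+1%:R^-1)%R]%classic) (fun y => (isqrt (b - y))%:E) lebesgue_measure.
move=> /(_ _ _ _ _)/cvg_lim <-//.
- apply: lime_le.
    apply: ereal_nondecreasing_is_cvgn => n m nm; apply: ge0_subset_integral => //.
    + by move=> y _; rewrite lee_fin isqrt_ge0.
    + by apply: subset_itvl; rewrite bnd_simp lerB// lef_pV2 ?posrE// ler_nat.
  near=> n; have [anb|ban] := leP a (b - n.+1%:R^-1)%R; last first.
    rewrite set_itv_ge ?integral_set0 ?lee_fin ?mulr_ge0 ?sqrtr_ge0//.
    by rewrite bnd_simp -ltNge.
  have n0 : (0 < n.+1%:R^-1 :> R)%R by rewrite invr_gt0.
  have dF x : (a <= x <= b - n.+1%:R^-1)%R ->
      is_derive x 1%R (fun y => - (2 * Num.sqrt (b - y)))%R (isqrt (b - x)).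
    move=> /andP[ax xb]; have xa : (0 < b - x)%R by rewrite subr_gt0 (le_lt_trans xb)// gtrBl.
    rewrite -[isqrt _]opprK -[X in (- X)%R]mulrN1; apply: is_deriveN.
    apply: (@is_derive1_comp _ (fun s => 2 * Num.sqrt s)%R (fun y => b - y)%R).
      exact: is_derive_sqrt2.
    by rewrite -[X in is_derive _ _ _ X](sub0r 1%R); apply: is_deriveB.
  have cf x : (a <= x <= b - n.+1%:R^-1)%R -> {for x, continuous (fun y => isqrt (b - y))}.
    move=> /andP[ax xb]; have xa : (0 < b - x)%R by rewrite subr_gt0 (le_lt_trans xb)// gtrBl.
    apply: (@continuous_comp _ _ _ (fun w => b - w)%R isqrt); last exact: isqrt_continuous.
    by apply: cvgB; [exact: cvg_cst|exact: cvg_id].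
  rewrite (integral_is_derive anb dF cf).
  by rewrite lee_fin opprK addrC gerBl mulr_ge0// sqrtr_ge0.
- move=> n m nm; apply/subsetPset; apply: subset_itvl.
  by rewrite bnd_simp lerB// lef_pV2 ?posrE// ler_nat.
- by move=> n y _; rewrite lee_fin isqrt_ge0.
- exact: mf.
Unshelve. all: by end_near. Qed.

End inverse_sqrt.

Section kernel_bounds.
Context {R : realType}.
Local Notation TR := (measurableTypeR R).
Implicit Types d t x y : R.

Lemma ln1Dsqr_le (u : R) : 0 <= u -> ln (1 + u ^+ 2) <= 2 * u.
Proof.
move=> u0; apply: (@le_trans _ _ (ln ((1 + u) ^+ 2))).
  rewrite ler_ln ?posrE ?ltr_pwDl ?sqr_ge0//; last by rewrite exprn_gt0// ltr_pwDl.
  by rewrite sqrrD expr1n; lra.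
rewrite lnXn ?ltr_pwDl//; have : -1 < u by lra.
by move=> /le_ln1Dx; rewrite mulr2n; lra.
Qed.

Lemma softlog_le0 d t : 0 < d -> d < 1 -> 0 <= t <= 2 * pi -> softlog d t <= softlog d 0.
Proof.
move=> d0 d1 ht; have pi0 := pi_gt0 R; rewrite /softlog lerN2 ler_ln ?posrE.
- have d2 : 0 <= 1 - d by rewrite subr_ge0 ltW.
  apply: ler_cos_abs; rewrite !normrM !(ger0_norm d2) ?subr0 (ger0_norm (ltW pi0)).
    rewrite ler_wpM2r// ler_wpM2l// ler_norml.
    by move/andP: ht => [? ?]; apply/andP; split; lra.
  rewrite (@ger0_norm _ 2^-1)//.
  have : (1 - d) * pi <= pi by rewrite ger_pMl//; lra.
  by lra.
- by apply: softlog_cos_gt0 => //; apply/andP; split; lra.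
- exact: softlog_cos_gt0.
Qed.

Lemma softlog0_le d : 0 < d -> d < 1 -> softlog d 0 <= ln 2 - ln d.
Proof.
move=> d0 d1; have pi2 := pi_ge2 R.
have -> : ln 2 - ln d = - ln (d / 2).
  by rewrite ln_div ?posrE// opprB.
rewrite /softlog subr0 lerN2 ler_ln ?posrE ?divr_gt0//; last first.
  by have := @softlog_cos_gt0 R d d0 d1 0; rewrite subr0; apply; apply/andP; split; lra.
have -> : (1 - d) * pi / 2 = - (d * pi / 2 - pi / 2) by field.
rewrite cosN cosBpihalf; apply: (le_trans _ (sin_ge_half _)).
  have := ler_wpM2l (ltW d0) pi2; lra.
have : d * pi <= pi by rewrite ger_pMl//; lra.
have : 0 <= d * pi by rewrite mulr_ge0//; lra.
by move=> ? ?; apply/andP; split; lra.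
Qed.

Lemma log_kernelE x y : torus x -> torus y -> 0 < cos ((pi - `|x - y|) / 2) ->
  log_kernel x y = (- ln (cos ((pi - `|x - y|) / 2)))%:E.
Proof. by move=> tx ty c0; rewrite /log_kernel abs_sin_half// lne_EFin. Qed.

Lemma torus_dist x y : torus x -> torus y -> 0 <= `|x - y| <= 2 * pi.
Proof.
rewrite /torus/= !in_itv/= => xpi ypi; rewrite normr_ge0/= ler_norml.
by move/andP: xpi => [? ?]; move/andP: ypi => [? ?]; apply/andP; split; lra.
Qed.

Lemma softlog_le_kernel d x y : 0 < d -> d < 1 -> torus x -> torus y ->
  ((softlog d `|x - y|)%:E <= log_kernel x y)%E.
Proof.
move=> d0 d1 tx ty; have pi0 := pi_gt0 R; have ht := torus_dist tx ty.
have [c0|c0] := ltP 0 (cos ((pi - `|x - y|) / 2)); last first.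
  by rewrite /log_kernel abs_sin_half// le0_lneNy ?lee_fin// leey.
rewrite log_kernelE// lee_fin lerN2 ler_ln ?posrE//; last exact: softlog_cos_gt0.
have d2 : 0 <= 1 - d by rewrite subr_ge0 ltW.
have tpi : `|pi - `|x - y| | <= pi.
  by rewrite ler_norml; move/andP: ht => [? ?]; apply/andP; split; lra.
apply: ler_cos_abs; rewrite !normrM ?(ger0_norm d2) (@ger0_norm _ 2^-1)//.
  by rewrite ler_wpM2r// ler_piMl//; lra.
by lra.
Qed.

(** An integrable bound for the inverse square root of cos((pi - |x - y|)/2).
    This cosine vanishes at y = x and when x and y approach opposite ends of
    ]- pi, pi]; both ends are included whatever the position of x. *)
Definition singularity x y : R :=
  2 * (isqrt `|x - y| + isqrt (y + pi) + isqrt (pi - y)).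

Lemma isqrt_cos_le x y : torus x -> - pi < y < pi -> x != y ->
  0 < cos ((pi - `|x - y|) / 2) /\
  isqrt (cos ((pi - `|x - y|) / 2)) <= singularity x y.
Proof.
rewrite /torus/= in_itv/= => /andP[x1 x2] /andP[y1 y2] xy; have pi0 := pi_gt0 R.
set t := `|x - y|; have t0 : 0 < t by rewrite normr_gt0 subr_eq0.
have i1 := isqrt_ge0 t; have i2 := isqrt_ge0 (y + pi); have i3 := isqrt_ge0 (pi - y).
have cs (u : R) : cos ((pi - u) / 2) = sin (u / 2).
  by rewrite -cosBpihalf -cosN; congr cos; field.
have [tpi|pit] := leP t pi.
  have h : t / 4 <= cos ((pi - t) / 2).
    rewrite cs; have := @sin_ge_half R (t / 2); have -> : t / 2 / 2 = t / 4 by field.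
    by apply; apply/andP; split; lra.
  split; first by apply: lt_le_trans h; rewrite divr_gt0.
  apply: le_trans (isqrt_le _ h) _; first by rewrite divr_gt0.
  by rewrite isqrt_div4 ?(ltW t0)// /singularity -/t; lra.
have [s [s0 st hs]] : exists s, [/\ 0 < s, s <= 2 * pi - t &
    isqrt s <= isqrt (y + pi) + isqrt (pi - y)].
  rewrite /t; have [yx|xy'] := leP y x.
    by exists (y + pi); rewrite ger0_norm ?subr_ge0//; split; lra.
  by exists (pi - y); rewrite ltr0_norm ?subr_lt0//; split; lra.
have h : s / 4 <= cos ((pi - t) / 2).
  have -> : (pi - t) / 2 = - ((pi - (2 * pi - t)) / 2) by field.
  rewrite cosN cs; have := @sin_ge_half R ((2 * pi - t) / 2).
  have -> : (2 * pi - t) / 2 / 2 = (2 * pi - t) / 4 by field.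
  move=> H; apply: le_trans (H _); first lra.
  by apply/andP; split; lra.
split; first by apply: lt_le_trans h; rewrite divr_gt0.
apply: le_trans (isqrt_le _ h) _; first by rewrite divr_gt0.
by rewrite isqrt_div4 ?(ltW s0)// /singularity -/t; lra.
Qed.

(** With c and c' the cosines at the true and at the shrunk angle, the two
    kernels differ by log(c'/c), where c' <= c + 2 d as the angles differ by at
    most d pi/2 <= 2 d. Now log(1 + 2 d/c) <= 2 sqrt(2 d/c), whose inverse square
    root singularity is integrable. *)
Lemma kernel_le_softlog d x y : 0 < d -> d < 1 -> torus x ->
  - pi < y < pi -> x != y ->
  (log_kernel x y <= (softlog d `|x - y| + 2 * Num.sqrt (2 * d) * singularity x y)%:E)%E.
Proof.
move=> d0 d1 tx hy xy; have [c0 cb] := isqrt_cos_le tx hy xy.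
have pi0 := pi_gt0 R.
have ty : torus y by rewrite /torus/= in_itv/=; move/andP: hy => [-> /ltW ->].
have ht := torus_dist tx ty; rewrite log_kernelE// lee_fin.
set c := cos _ in c0 cb *; set ca := cos ((1 - d) * (pi - `|x - y|) / 2).
have ca0 : 0 < ca by exact: softlog_cos_gt0.
have cac : ca <= c + 2 * d.
  apply: le_trans (cos_lipschitz _ ((pi - `|x - y|) / 2)) _; rewrite lerD2l.
  have -> : (1 - d) * (pi - `|x - y|) / 2 - (pi - `|x - y|) / 2 =
    - (d * ((pi - `|x - y|) / 2)) by field.
  rewrite normrN normrM (gtr0_norm d0) mulrC ler_wpM2r ?(ltW d0)//.
  have [/andP[_ pi2] _] := pihalf_02_cos_pihalf R.
  by rewrite ler_norml; move/andP: ht => [? ?]; apply/andP; split; lra.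
have -> : - ln c = softlog d `|x - y| + ln (ca / c).
  by rewrite /softlog -/ca ln_div ?posrE// addKr.
rewrite lerD2l; set u := Num.sqrt (2 * d) * isqrt c.
have u0 : 0 <= u by rewrite mulr_ge0 ?isqrt_ge0 ?sqrtr_ge0.
have u2 : u ^+ 2 = 2 * d / c.
  by rewrite exprMn sqr_sqrtr ?mulr_ge0 ?(ltW d0)// exprVn sqr_sqrtr// ltW.
apply: (@le_trans _ _ (2 * u)).
  apply: le_trans _ (ln1Dsqr_le u0); rewrite u2.
  rewrite ler_ln ?posrE ?divr_gt0//; last by rewrite ltr_pwDl// divr_ge0 ?mulr_ge0 ?ltW.
  have -> : 1 + 2 * d / c = (c + 2 * d) / c by rewrite [RHS]mulrDl mulfV// gt_eqF.
  by rewrite ler_wpM2r// invr_ge0 ltW.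
by rewrite -mulrA ler_wpM2l// ler_wpM2l// sqrtr_ge0.
Qed.

Lemma measurable_singularity x : measurable_fun setT (singularity x : TR -> R).
Proof.
apply: measurable_funM => //; apply: measurable_funD; last first.
  by apply: (measurableT_comp measurable_isqrt); exact: measurable_funB.
apply: measurable_funD; apply: (measurableT_comp measurable_isqrt).
  by apply: measurableT_comp => //; exact: measurable_funB.
exact: measurable_funD.
Qed.

Lemma singularity_ge0 x y : 0 <= singularity x y.
Proof. by rewrite mulr_ge0// !addr_ge0// isqrt_ge0. Qed.

(** Each inverse square root has integral at most 2 sqrt(2 pi); the one at x
    counts for both sides of x. *)
Definition singularity_mass : R := (2 * pi)^-1 * (2 * (8 * Num.sqrt (2 * pi))).

Lemma integral_singularity x : - pi <= x <= pi ->
  (\int[haar]_y (singularity x y)%:E <= singularity_mass%:E)%E.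
Proof.
move=> /andP[x1 x2]; have pi0 := pi_gt0 R; have npi : - pi < pi :> R := ltNpi_pi.
rewrite integral_haar; last 2 first.
- by apply/measurable_EFinP; exact: measurable_singularity.
- by move=> y; rewrite lee_fin singularity_ge0.
rewrite EFinM lee_pmul2l ?lte_fin ?invr_gt0 ?mulr_gt0//.
have m1 D : measurable_fun D (fun y : TR => (isqrt `|x - y|)%:E).
  apply/measurable_EFinP/measurable_funTS; apply: (measurableT_comp measurable_isqrt).
  by apply: measurableT_comp => //; exact: measurable_funB.
have m2 D : measurable_fun D (fun y : TR => (isqrt (y + pi))%:E).
  apply/measurable_EFinP/measurable_funTS; apply: (measurableT_comp measurable_isqrt).
  exact: measurable_funD.
have m3 D : measurable_fun D (fun y : TR => (isqrt (pi - y))%:E).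
  apply/measurable_EFinP/measurable_funTS; apply: (measurableT_comp measurable_isqrt).
  exact: measurable_funB.
have p1 y : (0 <= (isqrt `|x - y|)%:E)%E by rewrite lee_fin isqrt_ge0.
have p2 y : (0 <= (isqrt (y + pi))%:E)%E by rewrite lee_fin isqrt_ge0.
have p3 y : (0 <= (isqrt (pi - y))%:E)%E by rewrite lee_fin isqrt_ge0.
rewrite (eq_integral (fun y : TR => 2%:E * ((isqrt `|x - y|)%:E + (isqrt (y + pi))%:E +
    (isqrt (pi - y))%:E))%E); last by move=> y _; rewrite -!EFinD -EFinM.
rewrite ge0_integralZl//; last 2 first.
- by apply: emeasurable_funD => //; exact: emeasurable_funD.
- by move=> y _; rewrite !adde_ge0.
rewrite EFinM lee_pmul2l ?lte_fin//.
rewrite ge0_integralD//; last 2 first.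
- by move=> y _; rewrite adde_ge0.
- exact: emeasurable_funD.
rewrite ge0_integralD//.
have sq (s t : R) : s <= t -> t - s <= 2 * pi ->
    2 * Num.sqrt (t - s) <= 2 * Num.sqrt (2 * pi).
  by move=> st ts; rewrite ler_wpM2l// ler_wsqrtr.
have i2 : (\int[lebesgue_measure]_(y in `[(- pi)%R, pi]) (isqrt (y + pi))%:E <=
    (2 * Num.sqrt (2 * pi) : R)%:E)%E.
  rewrite (eq_integral (fun y : TR => (isqrt (y - - pi))%:E)); last first.
    by move=> y _; rewrite opprK.
  by apply: le_trans (integral_isqrt_right (ltW npi)) _; rewrite lee_fin; apply: sq; lra.
have i3 : (\int[lebesgue_measure]_(y in `[(- pi)%R, pi]) (isqrt (pi - y))%:E <=
    (2 * Num.sqrt (2 * pi) : R)%:E)%E.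
  by apply: le_trans (integral_isqrt_left (ltW npi)) _; rewrite lee_fin; apply: sq; lra.
have i1 : (\int[lebesgue_measure]_(y in `[(- pi)%R, pi]) (isqrt `|x - y|)%:E <=
    (2 * Num.sqrt (2 * pi) + 2 * Num.sqrt (2 * pi))%:E)%E.
  have -> : `[(- pi), pi]%classic = `[(- pi), x]%classic `|` `]x, pi]%classic.
    by rewrite -itv_bndbnd_setU// bnd_simp.
  rewrite ge0_integral_setU//; last first.
    apply/disj_setPS => y [] /=; rewrite !in_itv/= => /andP[_ yx] /andP[xy _].
    by move: yx; rewrite leNgt xy.
  rewrite EFinD; apply: leeD.
    rewrite (eq_integral (fun y : TR => (isqrt (x - y))%:E)); last first.
      by move=> y; rewrite inE/= in_itv/= => /andP[_ yx]; rewrite ger0_norm ?subr_ge0.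
    by apply: le_trans (integral_isqrt_left x1) _; rewrite lee_fin; apply: sq; lra.
  rewrite (eq_integral (fun y : TR => (isqrt (y - x))%:E)); last first.
    move=> y; rewrite inE/= in_itv/= => /andP[xy _].
    by rewrite distrC ger0_norm ?subr_ge0// ltW.
  rewrite integral_itv_obnd_cbnd; last first.
    apply/measurable_EFinP/measurable_funTS; apply: (measurableT_comp measurable_isqrt).
    exact: measurable_funB.
  by apply: le_trans (integral_isqrt_right x2) _; rewrite lee_fin; apply: sq; lra.
have -> : 8 * Num.sqrt (2 * pi) = (2 * Num.sqrt (2 * pi) + 2 * Num.sqrt (2 * pi))
   + 2 * Num.sqrt (2 * pi) + 2 * Num.sqrt (2 * pi) :> R by ring.
by rewrite 2!EFinD; apply: leeD => //; apply: leeD.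
Qed.

End kernel_bounds.

(** * Logarithmic energy and potential *)

Section kernel_energy.
Context {R : realType}.
Local Notation TR := (measurableTypeR R).
Local Open Scope ereal_scope.
Implicit Types P S : probability TR R.

Lemma log_kernel_ge0 x y : 0 <= log_kernel x y :> \bar R.
Proof. by rewrite oppe_ge0 lne_le0 lee_fin sin_max. Qed.

Lemma log_kernelC (x y : R) : log_kernel x y = log_kernel y x.
Proof. by rewrite /log_kernel -(opprB y x) mulNr sinN normrN. Qed.

Lemma measurable_log_kernel :
  measurable_fun setT (fun u : TR * TR => log_kernel u.1 u.2).
Proof.
have ms : measurable_fun setT (fun u : TR * TR => `|sin ((u.1 - u.2) / 2)|%R).
  apply: measurableT_comp => //; apply: (@measurableT_comp _ _ _ _ _ _ (@sin R)).
    by apply: continuous_measurable_fun; exact: continuous_sin.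
  by apply: measurable_funM => //; exact: measurable_funB.
apply: (eq_measurable_fun (fun u : TR * TR =>
    if (`|sin ((u.1 - u.2) / 2)| <= 0)%R then +oo
    else (- ln `|sin ((u.1 - u.2) / 2)|)%:E)).
  by move=> u _; rewrite /log_kernel/=; case: ifPn.
apply: measurable_fun_ifT => //; first exact: measurable_fun_ler.
by apply/measurable_EFinP; apply: measurableT_comp => //; exact: measurableT_comp.
Qed.

Lemma measurable_log_kernel_l (x : R) : measurable_fun setT (fun y : TR => log_kernel x y).
Proof. exact: (measurableT_comp measurable_log_kernel (pair1_measurable x)). Qed.

Definition potential (mu : probability TR R) (x : R) : \bar R := \int[mu]_y log_kernel x y.

Lemma potential_ge0 mu x : 0 <= potential mu x.
Proof. by apply: integral_ge0 => y _; exact: log_kernel_ge0. Qed.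

Lemma measurable_potential mu : measurable_fun setT (potential mu : TR -> _).
Proof.
apply: measurable_integral_l; first exact: measurable_log_kernel.
by move=> x y; exact: log_kernel_ge0.
Qed.

Definition softlog_energy (d : R) P S := \int[P]_x \int[S]_y (softlog d `|x - y|%R)%:E.

Lemma measurable_softlog_dist d : measurable_fun setT
  (fun u : TR * TR => (softlog d `|u.1 - u.2|%R)%:E).
Proof.
apply/measurable_EFinP; apply: (measurableT_comp (measurable_softlog d)).
by apply: measurableT_comp => //; exact: measurable_funB.
Qed.

Lemma measurable_softlog_dist_l d (x : R) : measurable_fun setT
  (fun y : TR => (softlog d `|x - y|%R)%:E).
Proof. exact: (measurableT_comp (measurable_softlog_dist d) (pair1_measurable x)). Qed.

Lemma softlog_energy_lty d P S : (0 < d)%R -> (d < 1)%R -> torus_prob P -> torus_prob S ->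
  softlog_energy d P S < +oo.
Proof.
move=> d0 d1 tP tS; apply: (@le_lt_trans _ _ (softlog d 0)%:E); last exact: ltry.
rewrite -(@integral_prob_cst _ TR R P (softlog d 0)%:E).
apply: le_integral_torus => //.
- apply: measurable_integral_l; first exact: measurable_softlog_dist.
  by move=> x y; rewrite lee_fin softlog_ge0.
- by move=> x; apply: integral_ge0 => y _; rewrite lee_fin softlog_ge0.
- by move=> x; rewrite lee_fin softlog_ge0.
move=> x tx; rewrite -[leRHS](@integral_prob_cst _ TR R S).
apply: le_integral_torus => //.
- exact: measurable_softlog_dist_l.
- by move=> y; rewrite lee_fin softlog_ge0.
- by move=> y; rewrite lee_fin softlog_ge0.
by move=> y ty; rewrite lee_fin softlog_le0// torus_dist.
Qed.

Let Del P S (z w : R) : R :=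
  ((distr_fun P w - distr_fun P z) - (distr_fun S w - distr_fun S z))%R.

Let mDel P S : measurable_fun setT (fun u : TR * TR => Del P S u.1 u.2).
Proof.
by apply: measurable_funB; apply: measurable_funB; apply: measurableT_comp => //;
  exact: measurable_distr_fun.
Qed.

(** Cauchy-Schwarz, in the form 2 a |D| <= a^2 + D^2. *)
Lemma mean_square_increment P S (a : R) : (0 <= a)%R ->
  a%:E < \int[haar]_z \int[haar]_w `|Del P S z w|%:E ->
  (a ^+ 2)%:E <= \int[haar]_z \int[haar]_w (Del P S z w ^+ 2)%:E.
Proof.
move=> a0; have mabs : measurable_fun setT (fun u : TR * TR => `|Del P S u.1 u.2|%:E).
  by apply/measurable_EFinP; apply: measurableT_comp.
have msq : measurable_fun setT (fun u : TR * TR => (Del P S u.1 u.2 ^+ 2)%:E).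
  by apply/measurable_EFinP; exact: measurable_funX.
rewrite !integral_iter//; last by move=> z w; rewrite lee_fin sqr_ge0.
set PP := prod_prob _ _; set A := \int[PP]_u _; set B := \int[PP]_u _ => aA.
have h : (2 * a)%:E * A <= (a ^+ 2)%:E + B.
  rewrite -(@integral_prob_cst _ _ R PP (a ^+ 2)%:E) -ge0_integralZl//; last first.
    by rewrite lee_fin mulr_ge0.
  rewrite -ge0_integralD//; last 2 first.
  - by move=> u _; rewrite lee_fin sqr_ge0.
  - by move=> u _; rewrite lee_fin sqr_ge0.
  apply: ge0_le_integral => //.
  - by move=> u _; rewrite -EFinM lee_fin !mulr_ge0.
  - exact: emeasurable_funM.
  - exact: emeasurable_funD.
  move=> u _; rewrite -EFinM -EFinD lee_fin -(real_normK (num_real (Del _ _ _ _))).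
  by have := sqr_ge0 (a - `|Del P S u.1 u.2|); rewrite sqrrB -mulr_natl; lra.
have : (2 * a)%:E * a%:E <= (a ^+ 2)%:E + B.
  by apply: le_trans h; apply: lee_wpmul2l; rewrite ?lee_fin ?mulr_ge0// ltW.
rewrite -EFinM; have : 0 <= B by apply: integral_ge0 => u _; rewrite lee_fin sqr_ge0.
case: B {h} => [b _|_ _|//]; last by rewrite leey.
by rewrite -EFinD !lee_fin expr2; lra.
Qed.

(** The constant 1/(8 pi) leaves room: [softlog_gap] yields
    (1 - d)^2 r^2 / 8, and (9/10)^2 > 1/pi. *)
Lemma softlog_energy_gap d P S (r : R) : (0 < d)%R -> (d <= 10^-1)%R ->
  torus_prob P -> torus_prob S -> (0 < r)%R -> r%:E < W1 P S ->
  2%:E * softlog_energy d P S + ((8 * pi)^-1 * r ^+ 2)%:E <=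
  softlog_energy d P P + softlog_energy d S S.
Proof.
move=> d0 d10 tP tS r0 rW; have d1 : (d < 1)%R by lra.
have pi0 := pi_gt0 R; have pi2 := pi_ge2 R.
apply: le_trans (softlog_gap d0 d1 tP tS _ _ _); rewrite ?softlog_energy_lty//.
rewrite leeD2l//.
have : (r / (2 * pi))%:E < \int[haar]_z \int[haar]_w `|Del P S z w|%:E.
  have := lt_le_trans rW (W1_le_mean tP tS).
  have -> : \int[haar]_y \int[haar]_x
    `|(distr_fun P x - distr_fun S x) - (distr_fun P y - distr_fun S y)|%:E
    = \int[haar]_z \int[haar]_w `|Del P S z w|%:E.
    apply: eq_integral => z _; apply: eq_integral => w _; congr (`|_|%:E)%R.
    by rewrite /Del; ring.
  move=> h; rewrite [(r / _)%R]mulrC EFinM lte_pdivrMl// mulr_gt0//.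
move=> /mean_square_increment h.
have twopi0 : (2 * pi != 0 :> R)%R by rewrite mulf_neq0// gt_eqF.
apply: (@le_trans _ _ ((2^-1 * ((1 - d) / 2) ^+ 2 * (2 * pi) ^+ 2)%:E * ((r / (2 * pi)) ^+ 2)%:E)).
  have E : ((2 * pi) ^+ 2 * (r / (2 * pi)) ^+ 2 = r ^+ 2)%R by rewrite -exprMn mulrC divfK.
  rewrite -EFinM lee_fin -(mulrA _ ((2 * pi) ^+ 2)%R) E.
  rewrite ler_wpM2r ?sqr_ge0// invfM exprMn.
  have h1 : (pi^-1 <= 2^-1 :> R)%R by rewrite lef_pV2 ?posrE.
  have h2 : (9 / 10 * (9 / 10) <= (1 - d) ^+ 2)%R.
    by rewrite expr2; apply: ler_pM; lra.
  lra.
apply: lee_wpmul2l.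
  by rewrite lee_fin; apply: mulr_ge0; [apply: mulr_ge0 => //; exact: sqr_ge0|exact: sqr_ge0].
by apply: h; rewrite divr_ge0 ?mulr_ge0 ?ltW.
Qed.

Section bounded_density.
Variables (mu : probability TR R) (tmu : torus_prob mu) (M : R).
Hypothesis muM : forall A, measurable A -> mu A <= M%:E * haar A.

Lemma density_bound_ge0 : (0 <= M)%R.
Proof.
have := muM measurableT; rewrite !probability_setT mule1 lee_fin.
exact: le_trans.
Qed.

Lemma integral_dominated (f : TR -> \bar R) : measurable_fun setT f ->
  (forall x, 0 <= f x) -> \int[mu]_x f x <= M%:E * \int[haar]_x f x.
Proof.
move=> mf f0.
rewrite -(@ge0_integral_mscale _ _ R haar setT measurableT (NngNum density_bound_ge0))//.
exact: ge0_le_measure_integral.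
Qed.

Lemma dominated_set1 (a : R) : mu [set a] = 0.
Proof.
apply/eqP; rewrite eq_le measure_ge0 andbT.
apply: le_trans (muM _) _ => //.
have h : haar [set a] = 0.
  have /null_content_dominatesP := @dominates_uniform_prob R _ _ ltNpi_pi.
  by apply => //; exact: lebesgue_measure_set1.
by rewrite h mule0.
Qed.

(** The points y = x and y = pi, which the pointwise comparison
    [kernel_le_softlog] excludes, are null sets for a measure that is dominated
    by dx/(2 pi). *)
Lemma potential_le_softlog (d x : R) : (0 < d)%R -> (d < 1)%R -> torus x ->
  potential mu x <= \int[mu]_y (softlog d `|x - y|%R)%:E +
    (2 * Num.sqrt (2 * d) * M * singularity_mass)%:E.
Proof.
move=> d0 d1 tx.
have msx : measurable_fun setT (fun y : TR => (singularity x y)%:E).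
  by apply/measurable_EFinP; exact: measurable_singularity.
have k0 : (0 <= 2 * Num.sqrt (2 * d))%R by rewrite mulr_ge0// sqrtr_ge0.
apply: (@le_trans _ _ (\int[mu]_y ((softlog d `|x - y|%R)%:E +
    (2 * Num.sqrt (2 * d))%:E * (singularity x y)%:E))).
  apply: ae_ge0_le_integral => //.
  - by move=> y _; exact: log_kernel_ge0.
  - exact: measurable_log_kernel_l.
  - by move=> y _; rewrite adde_ge0 ?mule_ge0 ?lee_fin ?softlog_ge0 ?singularity_ge0.
  - by apply: emeasurable_funD; [exact: measurable_softlog_dist_l|exact: emeasurable_funM].
  case: (torus_ae tmu) => N [mN N0 sN].
  exists (N `|` ([set x] `|` [set pi])); split.
  - by apply: measurableU => //; exact: measurableU.
  - have U0 (A B : set TR) : measurable A -> measurable B -> mu A = 0 -> mu B = 0 ->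
        mu (A `|` B) = 0.
      move=> mA mB A0 B0; apply/eqP; rewrite eq_le measure_ge0 andbT.
      have : mu (A `|` B) <= mu A + mu B by exact: measureU2.
      by rewrite A0 B0 adde0.
    apply: (U0) => //; first exact: measurableU.
    by apply: (U0); rewrite ?dominated_set1.
  move=> y /= /not_implyP[_ hy]; apply: contrapT => nU; apply: hy.
  have ty : torus y by apply: contrapT => /sN ?; apply: nU; left.
  have xy : x != y by apply/eqP => xy; apply: nU; right; left.
  have ypi : y != pi by apply/eqP => ypi; apply: nU; right; right.
  rewrite -EFinM -EFinD; apply: kernel_le_softlog => //.
  by move: ty; rewrite /torus/= in_itv/= => /andP[-> +]; rewrite le_eqVlt (negbTE ypi).
rewrite ge0_integralD//; last 4 first.
- by move=> y _; rewrite lee_fin softlog_ge0.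
- exact: measurable_softlog_dist_l.
- by move=> y _; rewrite mule_ge0// lee_fin singularity_ge0.
- exact: emeasurable_funM.
rewrite leeD2l// ge0_integralZl//; last first.
  by move=> y _; rewrite lee_fin singularity_ge0.
rewrite -(mulrA (2 * Num.sqrt (2 * d))%R) [leRHS]EFinM.
apply: lee_wpmul2l; first by rewrite lee_fin.
apply: le_trans (integral_dominated msx _) _.
  by move=> y; rewrite lee_fin singularity_ge0.
rewrite EFinM; apply: lee_wpmul2l; first by rewrite lee_fin density_bound_ge0.
apply: integral_singularity; move: tx; rewrite /torus/= in_itv/= => /andP[/ltW -> ->].
by [].
Qed.

Definition potential_bound : R :=
  (softlog 2^-1 0 + 2 * Num.sqrt (2 * 2^-1) * M * singularity_mass)%R.

Lemma potential_le x : torus x -> potential mu x <= potential_bound%:E.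
Proof.
move=> tx; have h0 : (0 < 2^-1 :> R)%R by rewrite invr_gt0.
have h1 : (2^-1 < 1 :> R)%R by lra.
apply: le_trans (potential_le_softlog h0 h1 tx) _; rewrite EFinD leeD2r//.
rewrite -[leRHS](@integral_prob_cst _ TR R mu).
apply: le_integral_torus => //.
- exact: measurable_softlog_dist_l.
- by move=> y; rewrite lee_fin softlog_ge0.
- by move=> y; rewrite lee_fin softlog_ge0.
by move=> y ty; rewrite lee_fin softlog_le0// torus_dist.
Qed.

Lemma log_energyE : log_energy mu = \int[mu]_x potential mu x.
Proof. by []. Qed.

Lemma log_energy_lty : log_energy mu < +oo.
Proof.
apply: (@le_lt_trans _ _ potential_bound%:E); last exact: ltry.
rewrite -(@integral_prob_cst _ TR R mu potential_bound%:E).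
have pb0 : (0 <= potential_bound)%R.
  have := potential_le (x := 0); rewrite /torus/= in_itv/= oppr_lt0 pi_gt0 pi_ge0.
  by move=> /(_ isT); rewrite -lee_fin; apply: le_trans; exact: potential_ge0.
apply: le_integral_torus => //.
- exact: measurable_potential.
- by move=> x; exact: potential_ge0.
- exact: potential_le.
Qed.

End bounded_density.

End kernel_energy.

(** * Relative entropy *)

Section relative_entropy_density.
Context {R : realType}.
Local Notation TR := (measurableTypeR R).
Implicit Types s t : R.

(** The Bregman divergence of s ln s; as ln 0 = 0 here, the value at s = 0 is
    the correct limit t. *)
Definition bregman s t : R := s * ln s - s * ln t - s + t.

(** For s > 0 divide by s: this is e^v > 1 + v at v = ln (t/s). *)
Lemma bregman_gt0 s t : 0 <= s -> 0 < t -> s != t -> 0 < bregman s t.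
Proof.
move=> s0 t0 st; have [->|sn0] := eqVneq s 0.
  by rewrite /bregman !mul0r !subr0 add0r.
have {sn0}s0 : 0 < s by rewrite lt_def sn0.
have lnst : ln t - ln s != 0.
  rewrite subr_eq0; apply/eqP => lts; move/eqP: st; apply.
  by rewrite -(lnK (x := s))// -lts lnK.
have := expR_gt1Dx lnst; rewrite expRB !lnK ?posrE// ltr_pdivlMr// /bregman.
by nra.
Qed.

Lemma bregmanxx t : bregman t t = 0.
Proof. by rewrite /bregman subrr sub0r addNr. Qed.

Lemma bregman_ge0 s t : 0 <= s -> 0 < t -> 0 <= bregman s t.
Proof.
move=> s0 t0; have [->|st] := eqVneq s t; first by rewrite bregmanxx.
by rewrite ltW// bregman_gt0.
Qed.

(** For a probability density f with respect to m, f ln f and ent f have the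
    same integral, and ent f >= 0, so that the entropy becomes an integral of a
    nonnegative function. *)
Definition ent s : R := s * ln s - s + 1.

Lemma ent_ge0 s : 0 <= s -> 0 <= ent s.
Proof.
by move=> s0; have := bregman_ge0 s0 ltr01; rewrite /bregman ln1 mulr0 subr0.
Qed.

(** The convexity defect at the barycenter y is the barycenter of the two
    divergences from y. *)
Lemma ent_convex (e s t : R) : 0 < e -> e <= 1 -> 0 <= s -> 0 < t ->
  ent ((1 - e) * s + e * t) <= (1 - e) * ent s + e * ent t.
Proof.
move=> e0 e1 s0 t0; set y := _ + _.
have y0 : 0 < y by rewrite /y ltr_wpDl ?mulr_gt0// mulr_ge0// subr_ge0.
have hs := bregman_ge0 s0 y0; have ht := bregman_ge0 (ltW t0) y0.
rewrite -subr_ge0.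
have -> : (1 - e) * ent s + e * ent t - ent y =
    (1 - e) * bregman s y + e * bregman t y.
  by rewrite /ent /bregman /y; ring.
by rewrite addr_ge0// mulr_ge0// ?subr_ge0// ltW.
Qed.

Lemma measurable_ent : measurable_fun setT ent.
Proof.
apply: measurable_funD => //; apply: measurable_funB => //.
by apply: measurable_funM => //; exact: measurable_ln.
Qed.

Local Open Scope ereal_scope.

Lemma lneEFin s : lne s%:E = if (s <= 0)%R then -oo else (ln s)%:E.
Proof. by rewrite /lne/=. Qed.

Lemma measurable_lneEFin : measurable_fun setT (fun s : R => lne s%:E).
Proof.
apply: (eq_measurable_fun (fun s : R => if (s <= 0)%R then -oo else (ln s)%:E)).
  by move=> s _; rewrite lneEFin.
apply: measurable_fun_ifT => //; first exact: measurable_fun_ler.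
by apply/measurable_EFinP; exact: measurable_ln.
Qed.

Lemma measurable_lne d (T : measurableType d) (f : T -> \bar R) :
  measurable_fun setT f -> measurable_fun setT (fun x => lne (f x)).
Proof.
move=> mf; apply: (eq_measurable_fun (fun x => if f x <= 0 then -oo else
    if f x < +oo then (ln (fine (f x)))%:E else +oo)).
  move=> x _; case: (f x) => [r| |]//=; first by rewrite ltry lee_fin.
  by rewrite leNye.
apply: measurable_fun_ifT => //; first exact: measurable_fun_lee.
apply: measurable_fun_ifT => //; first exact: measurable_fun_lte.
apply/measurable_EFinP; apply: (@measurableT_comp _ _ _ _ _ _ (@ln R)).
  exact: measurable_ln.
exact: measurableT_comp.
Qed.

(** The integral of lne (dnu/dm) is a difference of the integrals of the
    positive and of the negative part. Since f ln f >= f - 1, the negative part of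
    f ln f has integral at most 1, so the difference can be compared with the
    nonnegative integral of ent f even when the entropy is infinite. *)
Lemma relative_entropy_density (nu m : probability TR R) (f : TR -> R) :
  measurable_fun setT f -> (forall x, (0 <= f x)%R) ->
  (forall A, measurable A -> nu A = \int[m]_(x in A) (f x)%:E) ->
  relative_entropy nu m = \int[m]_x (ent (f x))%:E.
Proof.
move=> mf f0 nuf; have numu := density_dominates mf nuf.
have mlf : measurable_fun setT (fun x : TR => lne (f x)%:E).
  exact: (measurableT_comp measurable_lneEFin).
have ml : measurable_fun setT (fun x : TR => f x * ln (f x))%R.
  apply: measurable_funM => //; apply: (@measurableT_comp _ _ _ _ _ _ (@ln R)) => //.
have mlE : measurable_fun setT (fun x : TR => (f x * ln (f x))%:E).
  exact/measurable_EFinP.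
rewrite /relative_entropy asboolT//.
transitivity (\int[nu]_x lne (f x)%:E).
  have := density_Radon_Nikodym mf f0 nuf.
  move=> fRN; apply: ae_eq_integral => //.
    apply: measurable_lne; apply: measurable_int; exact: Radon_Nikodym_integrable.
  move/null_content_dominatesP : numu => numu.
  case: fRN => A [mA A0 sA]; exists A; split => //; first exact: numu.
  move=> x /= h; apply: sA => /= h'; apply: h => _.
  by rewrite -(h' I).
pose g (x : TR) := (f x * ln (f x))%:E.
have maxM (a c : R) : (0 <= c)%R -> maxe a%:E 0 * c%:E = maxe (a * c)%:E 0.
  by move=> c0; rewrite -(EFin_max a 0%R) -EFinM maxr_pMl// mul0r EFin_max.
have maxN (a : R) : (Num.max (- a) 0 = Num.max a 0 - a)%R.
  have [a0|a0] := leP a 0%R.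
    by rewrite sub0r; apply/max_idPl; rewrite oppr_ge0.
  by rewrite subrr; apply/max_idPr; rewrite oppr_le0 ltW.
have posE (s : R) : (0 <= s)%R -> maxe (lne s%:E) 0 * s%:E = maxe (s * ln s)%:E 0.
  rewrite le_eqVlt => /predU1P[<-|s0]; first by rewrite mule0 mul0r maxxx.
  by rewrite lneEFin leNgt s0/= maxM ?ltW// mulrC.
have negE (s : R) : (0 <= s)%R -> maxe (- lne s%:E) 0 * s%:E = maxe (- (s * ln s)%:E) 0.
  rewrite le_eqVlt => /predU1P[<-|s0]; first by rewrite mule0 mul0r oppe0 maxxx.
  by rewrite lneEFin leNgt s0/= maxM ?ltW// mulNr mulrC.
have -> : \int[nu]_x lne (f x)%:E = \int[m]_x g^\+ x - \int[m]_x g^\- x.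
  rewrite integralE; congr (_ - _).
    rewrite (ge0_integral_density mf f0 nuf)//; last exact: measurable_funepos.
    by apply: eq_integral => x _; rewrite !funeposE /g posE.
  rewrite (ge0_integral_density mf f0 nuf)//; last exact: measurable_funeneg.
  by apply: eq_integral => x _; rewrite !funenegE /g negE.
have f1 : \int[m]_x (f x)%:E = 1 by rewrite -nuf// probability_setT.
have gneg : \int[m]_x g^\- x <= 1.
  rewrite -(@integral_prob_cst _ TR R m 1); apply: ge0_le_integral => //.
    exact: measurable_funeneg.
  move=> x _; rewrite funenegE /g ge_max lee01 andbT -EFinN lee_fin.
  by have := ent_ge0 (f0 x); rewrite /ent; have := f0 x; lra.
have e0 : 0 <= \int[m]_x (ent (f x))%:E.
  by apply: integral_ge0 => x _; rewrite lee_fin ent_ge0.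
have : \int[m]_x (ent (f x))%:E + (\int[m]_x g^\- x + 1) = \int[m]_x g^\+ x + 1.
  have m1 : measurable_fun setT (fun x => (ent (f x))%:E).
    by apply/measurable_EFinP; exact: measurableT_comp measurable_ent mf.
  rewrite -[in LHS]f1 -[in RHS](@integral_prob_cst _ TR R m 1) -!ge0_integralD//.
  - apply: eq_integral => x _; rewrite funeposE funenegE /g -EFinN.
    rewrite -(EFin_max _ 0%R) -(EFin_max _ 0%R) -!EFinD.
    congr _%:E; rewrite /ent.
    by rewrite maxN; ring.
  - exact: measurable_funepos.
  - by move=> x _; rewrite lee_fin ent_ge0.
  - by move=> x _; rewrite adde_ge0// lee_fin.
  - apply: emeasurable_funD; first exact: measurable_funeneg.
    exact/measurable_EFinP.
  - exact: measurable_funeneg.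
  - by move=> x _; rewrite lee_fin.
  - exact/measurable_EFinP.
have : 0 <= \int[m]_x g^\+ x by exact: integral_ge0.
have : 0 <= \int[m]_x g^\- x by exact: integral_ge0.
case: (\int[m]_x g^\- x) gneg => // b _ _; case: (\int[m]_x g^\+ x) => // [a|] _.
  case: (\int[m]_x (ent (f x))%:E) e0 => // e _ /eqP; rewrite -!EFinD eqe => /eqP h.
  by congr _%:E; lra.
by case: (\int[m]_x (ent (f x))%:E) e0.
Qed.

End relative_entropy_density.

(** * The Euler-Lagrange equation of the equilibrium measure *)

Section density_prob.
Context d (T : measurableType d) (R : realType) (m : probability T R) (f : T -> R)
  (mf : measurable_fun setT f) (f0 : forall x, 0 <= f x)
  (f1 : (\int[m]_x (f x)%:E = 1)%E).
Local Open Scope ereal_scope.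

(** The proof arguments make the set function canonically a probability. *)
Definition density_prob of measurable_fun setT f & (forall x, (0 <= f x)%R) &
  \int[m]_x (f x)%:E = 1 : set T -> \bar R := fun A => \int[m]_(x in A) (f x)%:E.

Let density_prob_set0 : density_prob mf f0 f1 set0 = 0.
Proof. exact: integral_set0. Qed.

Let density_prob_ge0 A : 0 <= density_prob mf f0 f1 A.
Proof. by apply: integral_ge0 => x _; rewrite lee_fin. Qed.

Let density_prob_sigma_additive : semi_sigma_additive (density_prob mf f0 f1).
Proof.
apply: semi_sigma_additive_nng_induced => [|x]; last by rewrite lee_fin.
exact/measurable_EFinP.
Qed.

HB.instance Definition _ := isMeasure.Build _ _ _ (density_prob mf f0 f1)
  density_prob_set0 density_prob_ge0 density_prob_sigma_additive.

Let density_prob_setT : density_prob mf f0 f1 setT = 1.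
Proof. exact: f1. Qed.

HB.instance Definition _ :=
  @Measure_isProbability.Build _ _ R (density_prob mf f0 f1) density_prob_setT.

Lemma density_prob_exists : exists nu : probability T R,
  forall A, measurable A -> nu A = \int[m]_(x in A) (f x)%:E.
Proof. by exists (density_prob mf f0 f1). Qed.

End density_prob.

Section integral_density_set.
Context d (T : measurableType d) (R : realType) (nu m : probability T R) (f : T -> R).
Hypotheses (mf : measurable_fun setT f) (f0 : forall x, 0 <= f x).
Hypothesis nuf : forall A, measurable A -> (nu A = \int[m]_(x in A) (f x)%:E)%E.
Local Open Scope ereal_scope.

Lemma ge0_integral_density_set (k : T -> \bar R) A : measurable A ->
  measurable_fun setT k -> (forall x, 0 <= k x) ->
  \int[nu]_(x in A) k x = \int[m]_(x in A) (k x * (f x)%:E).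
Proof.
move=> mA mk k0; rewrite integral_mkcond [RHS]integral_mkcond.
rewrite (ge0_integral_density mf f0 nuf).
- by apply: eq_integral => x _; rewrite /patch; case: ifPn => // _; rewrite mul0e.
- by apply/measurable_restrict => //; rewrite setTI; exact: measurable_funTS.
- by move=> x; rewrite /patch; case: ifPn.
Qed.

End integral_density_set.

Section dominated_by_haar.
Context {R : realType}.
Local Notation TR := (measurableTypeR R).
Local Open Scope ereal_scope.
Implicit Types nu m : probability TR R.

Lemma torus_prob_dominated nu (M : R) :
  (forall A, measurable A -> nu A <= M%:E * haar A) -> torus_prob nu.
Proof.
move=> nuM; have mt : measurable (torus : set TR) by exact: measurable_itv.
have hC : haar (~` torus : set TR) = 0.
  by rewrite probability_setC// haar_torus_prob subee.
have nC : nu (~` torus : set TR) = 0.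
  apply/eqP; rewrite eq_le measure_ge0 andbT.
  by apply: le_trans (nuM _ _) _; rewrite ?hC ?mule0//; exact: measurableC.
by have := probability_setC nu (measurableC mt); rewrite setCK nC sube0.
Qed.

Lemma density_le_haar nu (f : TR -> R) (M : R) : measurable_fun setT f ->
  (forall x, (0 <= f x)%R) -> (0 <= M)%R -> (forall x, torus x -> (f x <= M)%R) ->
  (forall A, measurable A -> nu A = \int[haar]_(x in A) (f x)%:E) ->
  forall A, measurable A -> nu A <= M%:E * haar A.
Proof.
move=> mf f0 M0 fM nuf A mA; rewrite nuf// -integral_cst//.
have restrict (g : TR -> \bar R) : \int[haar]_(x in A) g x = \int[haar]_x (g \_ A) x.
  exact: integral_mkcond.
rewrite (restrict (EFin \o f)) (restrict (cst M%:E)).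
apply: (le_integral_torus (haar_torus_prob R)).
- by apply/measurable_restrict => //; apply: measurable_funTS; exact/measurable_EFinP.
- by apply/measurable_restrict => //; exact: measurable_funTS.
- by move=> x; rewrite /patch; case: ifPn => // _; rewrite lee_fin.
- by move=> x; rewrite /patch; case: ifPn => // _; rewrite lee_fin.
- by move=> x tx; rewrite /patch; case: ifPn => // _; rewrite lee_fin fM.
Qed.

Lemma integral_potentialC nu m :
  \int[nu]_x potential m x = \int[m]_x potential nu x.
Proof.
rewrite /potential (integral_swap nu m measurable_log_kernel log_kernel_ge0).
by apply: eq_integral => y _; apply: eq_integral => x _; rewrite log_kernelC.
Qed.

(** The potential is finite nu-almost everywhere when its nu-integral is. *)
Lemma integral_fine_potential nu m : \int[nu]_x potential m x < +oo ->
  \int[nu]_x (fine (potential m x))%:E = \int[nu]_x potential m x.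
Proof.
move=> fin; apply: ae_eq_integral => //.
- apply/measurable_EFinP; apply: measurableT_comp => //; exact: measurable_potential.
- exact: measurable_potential.
have : nu.-integrable setT (potential m).
  apply/integrableP; split; first exact: measurable_potential.
  by under eq_integral do rewrite gee0_abs ?potential_ge0//.
move=> /integrable_ae -/(_ measurableT) [A [mA A0 sA]]; exists A; split => //.
by apply: subset_trans sA; apply: subsetC => x /= h _; rewrite fineK// h.
Qed.

Lemma integral_potential_lty nu m (M : R) : torus_prob nu -> torus_prob m ->
  (forall A, measurable A -> m A <= M%:E * haar A) ->
  \int[nu]_x potential m x < +oo.
Proof.
move=> tnu tm mM; have pb0 : 0 <= (potential_bound M)%:E.
  have t0 : torus (0%R : R) by rewrite /torus/= in_itv/= oppr_lt0 pi_gt0 pi_ge0.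
  exact: le_trans (potential_ge0 m 0%R) (potential_le tm mM t0).
apply: (@le_lt_trans _ _ (potential_bound M)%:E); last exact: ltry.
rewrite -(@integral_prob_cst _ TR R nu (potential_bound M)%:E).
apply: le_integral_torus => //.
- exact: measurable_potential.
- by move=> x; exact: potential_ge0.
- exact: potential_le.
Qed.

End dominated_by_haar.

Section small_steps.
Context {R : realType}.

Lemma le_of_small_steps (a b c : R) :
  (forall t, 0 < t -> t <= 1 -> a <= b + t * c) -> a <= b.
Proof.
move=> h; rewrite leNgt; apply/negP => ba; set D := `|c| + (a - b).
have D0 : 0 < D by rewrite ltr_wpDl// subr_gt0.
have := h ((a - b) / (2 * D)).
have t0 : 0 < (a - b) / (2 * D) by rewrite divr_gt0 ?subr_gt0 ?mulr_gt0.
have t1 : (a - b) / (2 * D) * D = (a - b) / 2 by field; rewrite gt_eqF.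
have t2 : (a - b) / (2 * D) <= 1.
  rewrite ler_pdivrMr ?mulr_gt0// mul1r /D.
  by have := normr_ge0 c; lra.
move=> /(_ t0 t2); apply/negP; rewrite -ltNge.
have : (a - b) / (2 * D) * c <= (a - b) / (2 * D) * D.
  rewrite ler_wpM2l ?ltW// /D.
  by have := ler_norm c; lra.
by rewrite t1; lra.
Qed.

End small_steps.

Section gibbs_identity.
Context {R : realType}.
Local Notation TR := (measurableTypeR R).
Local Open Scope ereal_scope.
Variables (m : probability TR R) (w : TR -> R) (Z : R).
Hypotheses (mw : measurable_fun setT w) (w0 : forall x, (0 <= w x)%R).
Hypotheses (Z0 : (0 < Z)%R) (Z1 : (Z <= 1)%R) (ZE : \int[m]_x (expR (- w x))%:E = Z%:E).

Definition gibbs_density (x : TR) : R := (Z^-1 * expR (- w x))%R.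

Lemma gibbs_density_gt0 x : (0 < gibbs_density x)%R.
Proof. by rewrite mulr_gt0 ?invr_gt0 ?expR_gt0. Qed.

Lemma gibbs_density_le x : (gibbs_density x <= Z^-1)%R.
Proof.
apply: ler_piMr; first by rewrite invr_ge0 ltW.
by rewrite -expR0 ler_expR oppr_le0.
Qed.

Lemma measurable_gibbs_density : measurable_fun setT gibbs_density.
Proof.
apply: measurable_funM => //; apply: measurableT_comp => //.
exact: measurableT_comp.
Qed.

Lemma integral_gibbs_density : \int[m]_x (gibbs_density x)%:E = 1.
Proof.
under eq_integral do rewrite EFinM.
rewrite ge0_integralZl ?ZE -?EFinM ?mulVf ?gt_eqF//.
- apply/measurable_EFinP; apply: measurableT_comp => //; exact: measurableT_comp.
- by rewrite lee_fin invr_ge0 ltW.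
Qed.

Lemma ln_gibbs_density x : ln (gibbs_density x) = (- ln Z - w x)%R.
Proof. by rewrite lnM ?posrE ?invr_gt0 ?expR_gt0// lnV ?posrE// expRK. Qed.

Lemma ent_gibbs_density_le x : (ent (gibbs_density x) <= Z^-1 * (- ln Z) + 1)%R.
Proof.
rewrite /ent ln_gibbs_density; have q0 := gibbs_density_gt0 x.
have qZ := gibbs_density_le x; have wx := w0 x.
have lZ : (0 <= - ln Z)%R by rewrite oppr_ge0 ln_le0.
have : (gibbs_density x * (- ln Z - w x) <= gibbs_density x * - ln Z)%R.
  by rewrite ler_wpM2l ?(ltW q0)//; lra.
have : (gibbs_density x * - ln Z <= Z^-1 * - ln Z)%R by rewrite ler_wpM2r.
lra.
Qed.

Section density.
Variables (nu : probability TR R) (f : TR -> R).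
Hypotheses (mf : measurable_fun setT f) (f0 : forall x, (0 <= f x)%R).
Hypothesis nuf : forall A, measurable A -> nu A = \int[m]_(x in A) (f x)%:E.

Lemma measurable_bregman_gibbs :
  measurable_fun setT (fun x => bregman (f x) (gibbs_density x)).
Proof.
have mq := measurable_gibbs_density.
apply: measurable_funD => //; apply: measurable_funB => //; apply: measurable_funB.
  by apply: measurable_funM => //; exact: (@measurableT_comp _ _ _ _ _ _ (@ln R)).
by apply: measurable_funM => //; exact: (@measurableT_comp _ _ _ _ _ _ (@ln R)).
Qed.

(** Pointwise, with q = e^(-w)/Z: ent f + w f + q = bregman f q + 1 - f ln Z.
    Each term that is integrated is nonnegative because ln Z <= 0. *)
Lemma gibbs_identity :
  \int[m]_x (bregman (f x) (gibbs_density x))%:E + (1 + (- ln Z)%:E) =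
  relative_entropy nu m + (\int[nu]_x (w x)%:E + 1).
Proof.
have lZ : (0 <= - ln Z)%R by rewrite oppr_ge0 ln_le0.
have mfE : measurable_fun setT (fun x => (f x)%:E) by exact/measurable_EFinP.
have int1 : \int[m]_x (f x)%:E = 1 by rewrite -nuf// probability_setT.
have -> : (- ln Z)%:E = \int[m]_x ((- ln Z)%:E * (f x)%:E).
  by rewrite ge0_integralZl ?int1 ?mule1// => x _; rewrite lee_fin.
have intw : \int[nu]_x (w x)%:E = \int[m]_x ((w x)%:E * (f x)%:E).
  by rewrite (ge0_integral_density mf f0 nuf)//; exact/measurable_EFinP.
rewrite intw (relative_entropy_density mf f0 nuf) -[in RHS]integral_gibbs_density.
rewrite -[1 in LHS](@integral_prob_cst _ TR R m 1).
have mb : measurable_fun setT (fun x => (bregman (f x) (gibbs_density x))%:E).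
  by apply/measurable_EFinP; exact: measurable_bregman_gibbs.
have me : measurable_fun setT (fun x => (ent (f x))%:E).
  by apply/measurable_EFinP; exact: measurableT_comp measurable_ent mf.
have mg : measurable_fun setT (fun x => (gibbs_density x)%:E).
  by apply/measurable_EFinP; exact: measurable_gibbs_density.
have mwf : measurable_fun setT (fun x => (w x)%:E * (f x)%:E).
  by apply: emeasurable_funM => //; exact/measurable_EFinP.
have mzf : measurable_fun setT (fun x => (- ln Z)%:E * (f x)%:E).
  exact: emeasurable_funM.
have ge1 x : 0 <= (w x)%:E * (f x)%:E by rewrite -EFinM lee_fin mulr_ge0.
have ge2 x : 0 <= (- ln Z)%:E * (f x)%:E by rewrite -EFinM lee_fin mulr_ge0.
have ge3 x : 0 <= (gibbs_density x)%:E by rewrite lee_fin ltW// gibbs_density_gt0.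
rewrite -!ge0_integralD//.
- apply: eq_integral => x _; rewrite -!EFinM -!EFinD; congr _%:E.
  by rewrite /bregman /ent ln_gibbs_density; ring.
- by move=> x _; rewrite lee_fin ent_ge0.
- by move=> x _; exact: adde_ge0.
- exact: emeasurable_funD.
- by move=> x _; rewrite lee_fin bregman_ge0// gibbs_density_gt0.
- by move=> x _; exact: adde_ge0.
- exact: emeasurable_funD.
Qed.

Lemma integral_bregman_eq0 : \int[m]_x (bregman (f x) (gibbs_density x))%:E = 0 ->
  forall A, measurable A -> nu A = \int[m]_(x in A) (gibbs_density x)%:E.
Proof.
move=> b0 A mA; rewrite nuf//.
have mb : measurable_fun setT (fun x => (bregman (f x) (gibbs_density x))%:E).
  by apply/measurable_EFinP; exact: measurable_bregman_gibbs.
have /(ae_eq_integral_abs m measurableT mb) [N [mN N0 sN]] :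
    \int[m]_x `|(bregman (f x) (gibbs_density x))%:E| = 0.
  rewrite -[RHS]b0; apply: eq_integral => x _.
  by rewrite gee0_abs// lee_fin bregman_ge0// gibbs_density_gt0.
apply: ae_eq_integral => //.
- by apply: measurable_funTS; exact/measurable_EFinP.
- by apply: measurable_funTS; apply/measurable_EFinP; exact: measurable_gibbs_density.
exists N; split => //; apply: subset_trans sN; apply: subsetC => x /= h _.
have {h} [/eqP h] := h I; congr _%:E; apply/eqP; apply: contraTT h => fq.
by rewrite gt_eqF// bregman_gt0// gibbs_density_gt0.
Qed.

End density.
End gibbs_identity.

Section equilibrium.
Context {R : realType}.
Local Notation TR := (measurableTypeR R).
Local Open Scope ereal_scope.
Variables (beta : R) (V : R -> R) (cV : continuous V)
  (nV : \int[haar]_x (expR (- V x))%:E = 1) (mu : probability TR R).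
Hypotheses (b0 : (0 < beta)%R) (eq_mu : equilibrium_measure beta cV nV mu).

Let m0 : probability TR R := mu0 cV nV.

Let tmu : torus_prob mu. Proof. by case: eq_mu. Qed.

Let meV : measurable_fun setT (fun x : TR => expR (- V x)).
Proof.
apply: measurableT_comp => //; apply: measurableT_comp => //.
exact: continuous_measurable_fun.
Qed.

Let eV0 (x : TR) : (0 <= expR (- V x))%R. Proof. exact: expR_ge0. Qed.

Let m0E A : measurable A -> m0 A = \int[haar]_(x in A) (expR (- V x))%:E.
Proof. by []. Qed.

Lemma weight_bounded : exists2 W : R, (0 < W)%R & forall x, torus x -> (expR (- V x) <= W)%R.
Proof.
have [|c _ cM] := @EVT_max R (fun x => expR (- V x)) (- pi)%R pi (ltW (ltNpi_pi (R := R))).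
  apply: continuous_subspaceT => x; apply: continuous_comp; last exact: continuous_expR.
  by apply: continuousN; exact: cV.
exists (expR (- V c)); first exact: expR_gt0.
move=> x; rewrite /torus/= in_itv/= => /andP[h1 h2]; apply: cM.
by rewrite in_itv/= ltW.
Qed.

Lemma mu0_le_haar : exists2 W : R, (0 < W)%R &
  forall A, measurable A -> m0 A <= W%:E * haar A.
Proof.
have [W W0 hW] := weight_bounded; exists W => //.
by apply: (density_le_haar meV eV0) => //; rewrite ltW.
Qed.

(** The minimal free energy is at most that of mu_0, which is finite because
    mu_0 has a bounded density. As beta E >= 0 and the entropy is nonnegative,
    both terms are finite; the entropy is finite only for mu << mu_0. *)
Lemma finite_free_energy : exists e k : R, [/\ (0 <= e)%R, (0 <= k)%R,
  log_energy mu = e%:E, relative_entropy mu m0 = k%:E &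
  exists h : TR -> R, [/\ measurable_fun setT h, forall x, (0 <= h x)%R &
    forall A, measurable A -> mu A = \int[m0]_(x in A) (h x)%:E]].
Proof.
have [W _ hW] := mu0_le_haar; have tm0 := torus_prob_dominated hW.
have Ege0 (P : probability TR R) : 0 <= log_energy P.
  by apply: integral_ge0 => x _; exact: potential_ge0.
have [e0 e00 E0] := nneg_ltyE (Ege0 m0) (log_energy_lty tm0 hW).
have K0 : relative_entropy m0 m0 = 0.
  rewrite (@relative_entropy_density _ _ _ (cst 1%R))//; last first.
    move=> A mA; transitivity (\int[m0]_(x in A) cst 1 x); last exact: eq_integral.
    by rewrite integral_cst// mul1e.
  by rewrite integral0_eq// => x _; rewrite /ent ln1 mulr0 sub0r addNr.
have : free_energy beta cV nV mu <= (beta * e0)%:E.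
  have [_ /(_ m0 tm0)] := eq_mu; rewrite /free_energy -/m0 K0 E0 adde0.
  by rewrite -EFinM.
rewrite /free_energy -/m0.
have [mum0|nmu] := pselect (mu `<< m0); last first.
  rewrite /relative_entropy asboolF// addey ?leye_eq//.
  by rewrite gt_eqF// (@lt_le_trans _ _ 0) ?ltNyr// mule_ge0// lee_fin ltW.
pose f := Radon_Nikodym_SigmaFinite.f mu m0.
pose h := fun x => fine (f x).
have hE x : (h x)%:E = f x by rewrite fineK// Radon_Nikodym_SigmaFinite.f_fin_num.
have h0 x : (0 <= h x)%R by rewrite -lee_fin hE Radon_Nikodym_SigmaFinite.f_ge0.
have mh : measurable_fun setT h.
  apply: measurableT_comp => //; apply: measurable_int.
  exact: Radon_Nikodym_SigmaFinite.f_integrable.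
have muh A : measurable A -> mu A = \int[m0]_(x in A) (h x)%:E.
  move=> mA; rewrite (Radon_Nikodym_SigmaFinite.f_integral mum0)//.
  by apply: eq_integral => x _; rewrite hE.
have KE := relative_entropy_density mh h0 muh.
have K_ge0 : 0 <= relative_entropy mu m0.
  by rewrite KE; apply: integral_ge0 => x _; rewrite lee_fin ent_ge0.
move=> le0.
have [e e_ge0 eE] : exists2 e : R, (0 <= e)%R & log_energy mu = e%:E.
  apply: nneg_ltyE => //; rewrite ltey; apply/eqP => Ey; move: le0.
  rewrite Ey mulry gtr0_sg// mul1e addye ?leye_eq//.
  by rewrite gt_eqF// (@lt_le_trans _ _ 0) ?ltNyr.
have [k k_ge0 kE] : exists2 k : R, (0 <= k)%R & relative_entropy mu m0 = k%:E.
  apply: nneg_ltyE => //; rewrite ltey; apply/eqP => Ky; move: le0.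
  by rewrite Ky eE -EFinM addey ?leye_eq.
by exists e, k; split => //; exists h.
Qed.

Let u (x : R) : R := fine (potential mu x).
Let w (x : TR) : R := (2 * beta * u x)%R.

Let u0 x : (0 <= u x)%R. Proof. exact/fine_ge0/potential_ge0. Qed.

Let mu_ : measurable_fun setT (u : TR -> R).
Proof. by apply: measurableT_comp => //; exact: measurable_potential. Qed.

Let mw : measurable_fun setT w. Proof. exact: measurable_funM. Qed.

Let w0 x : (0 <= w x)%R. Proof. by rewrite !mulr_ge0// ltW. Qed.

Let mew : measurable_fun setT (fun x : TR => (expR (- w x))%:E).
Proof. by apply/measurable_EFinP; apply: measurableT_comp => //; exact: measurableT_comp. Qed.

(** If the integral vanished then so would a positive function, almost
    everywhere for a probability. *)
Lemma gibbs_normalization : exists Z : R,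
  [/\ (0 < Z)%R, (Z <= 1)%R & \int[m0]_x (expR (- w x))%:E = Z%:E].
Proof.
have I1 : \int[m0]_x (expR (- w x))%:E <= 1.
  rewrite -(@integral_prob_cst _ TR R m0 1); apply: ge0_le_integral => //.
  - by move=> x _; rewrite lee_fin -expR0 ler_expR oppr_le0.
have [|Z Z0 ZE] := nneg_ltyE _ (le_lt_trans I1 (ltry 1)).
  by apply: integral_ge0 => x _; rewrite lee_fin expR_ge0.
exists Z; rewrite ZE in I1; split => //; rewrite lt_def Z0 andbT; apply/eqP => Z00.
have /(ae_eq_integral_abs m0 measurableT mew) [N [mN N0 sN]] :
    \int[m0]_x `|(expR (- w x))%:E| = 0.
  rewrite Z00 in ZE; rewrite -[RHS]ZE; apply: eq_integral => x _.
  by rewrite gee0_abs// lee_fin expR_ge0.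
have NT : N = setT.
  rewrite eqEsubset; split => // x _; apply: sN => /= /(_ I) /eqP.
  by rewrite eqe gt_eqF// expR_gt0.
by have := @probability_setT _ _ _ m0; rewrite -NT N0 => /esym/eqP; rewrite onee_eq0.
Qed.

(** With e = E(mu), b = int U dnu, e' = E(nu) and k, k' the entropies of mu and
    of the competitor nu = q mu_0, minimality along (1 - t) mu + t nu gives
    k + 2 beta e <= k' + 2 beta b at first order in t. Through [gibbs_identity] for
    mu and for nu, this says that the divergence of the density of mu from q has
    integral at most 0. *)
Lemma equilibrium_density : exists Z : R, [/\ (0 < Z)%R,
  (forall A, measurable A ->
    mu A = \int[haar]_(x in A) (gibbs_density w Z x * expR (- V x))%:E) &
  exists2 M : R, (0 < M)%R & forall A, measurable A -> mu A <= M%:E * haar A].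
Proof.
have [Z [Z0 Z1 ZE]] := gibbs_normalization.
have [e [k [e0 k0 eE kE [h [mh h0 muh]]]]] := finite_free_energy.
pose q := gibbs_density w Z.
have mq : measurable_fun setT q by exact: measurable_gibbs_density.
have q0 x : (0 <= q x)%R by rewrite ltW// gibbs_density_gt0.
have q1 : \int[m0]_x (q x)%:E = 1 by exact: integral_gibbs_density ZE.
have [nu nuq] := density_prob_exists mq q0 q1.
have [W W0 hW] := weight_bounded.
have nuhaar A : measurable A ->
    nu A = \int[haar]_(x in A) (q x * expR (- V x))%:E.
  move=> mA; rewrite nuq// (ge0_integral_density_set meV eV0 m0E)//.
  exact/measurable_EFinP.
have nuM A : measurable A -> nu A <= (Z^-1 * W)%:E * haar A.
  apply: (density_le_haar _ _ _ _ nuhaar).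
  - exact: measurable_funM.
  - by move=> x; rewrite mulr_ge0.
  - by rewrite ltW// mulr_gt0 ?invr_gt0.
  - by move=> x tx; rewrite ler_pM// ?hW// gibbs_density_le.
have tnu := torus_prob_dominated nuM.
have [e' e'0 e'E] : exists2 e' : R, (0 <= e')%R & \int[nu]_x potential nu x = e'%:E.
  apply: nneg_ltyE (log_energy_lty tnu nuM).
  by apply: integral_ge0 => x _; exact: potential_ge0.
have [b b0' bE] : exists2 b : R, (0 <= b)%R & \int[mu]_x potential nu x = b%:E.
  apply: nneg_ltyE (integral_potential_lty tmu tnu nuM).
  by apply: integral_ge0 => x _; exact: potential_ge0.
have bE' : \int[nu]_x potential mu x = b%:E by rewrite integral_potentialC.
have eE' : \int[mu]_x potential mu x = e%:E by [].
have muw : \int[mu]_x (w x)%:E = (2 * beta * e)%:E.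
  rewrite /w; under eq_integral do rewrite EFinM.
  rewrite ge0_integralZl//; last by rewrite lee_fin mulr_ge0// ltW.
  - by rewrite integral_fine_potential ?eE' ?ltry.
  - exact/measurable_EFinP.
  - by move=> x _; rewrite lee_fin.
have nuw : \int[nu]_x (w x)%:E = (2 * beta * b)%:E.
  rewrite /w; under eq_integral do rewrite EFinM.
  rewrite ge0_integralZl//; last by rewrite lee_fin mulr_ge0// ltW.
  - by rewrite integral_fine_potential ?bE' ?ltry.
  - exact/measurable_EFinP.
  - by move=> x _; rewrite lee_fin.
have [k' k'0 k'E] : exists2 k' : R, (0 <= k')%R & relative_entropy nu m0 = k'%:E.
  rewrite (relative_entropy_density mq q0 nuq); apply: nneg_ltyE.
    by apply: integral_ge0 => x _; rewrite lee_fin ent_ge0.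
  apply: (@le_lt_trans _ _ (Z^-1 * (- ln Z) + 1)%:E); last exact: ltry.
  rewrite -(@integral_prob_cst _ TR R m0 (Z^-1 * (- ln Z) + 1)%:E).
  apply: ge0_le_integral => //.
  - by move=> x _; rewrite lee_fin ent_ge0.
  - by apply/measurable_EFinP; exact: measurableT_comp measurable_ent mq.
  - by move=> x _; rewrite lee_fin ent_gibbs_density_le.
have first_order : (k + 2 * beta * e <= k' + 2 * beta * b)%R.
  apply: (@le_of_small_steps _ _ _ (beta * (e - 2 * b + e'))) => t t0 t1.
  have t1' : (0 <= 1 - t)%R by rewrite subr_ge0.
  pose p x := ((1 - t) * h x + t * q x)%R.
  have p0 x : (0 <= p x)%R by rewrite addr_ge0// mulr_ge0// ltW.
  have mp : measurable_fun setT p by apply: measurable_funD; exact: measurable_funM.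
  have mixI (f g : TR -> \bar R) : measurable_fun setT f -> measurable_fun setT g ->
      (forall x, 0 <= f x) -> (forall x, 0 <= g x) ->
      \int[m0]_x ((1 - t)%:E * f x + t%:E * g x) =
      (1 - t)%:E * \int[m0]_x f x + t%:E * \int[m0]_x g x.
    move=> mf mg f0 g0; rewrite ge0_integralD//.
    - by rewrite !ge0_integralZl// lee_fin// ltW.
    - by move=> x _; rewrite mule_ge0// lee_fin.
    - exact: emeasurable_funM.
    - by move=> x _; rewrite mule_ge0// lee_fin ltW.
    - exact: emeasurable_funM.
  have mix (nut : probability TR R) (f : TR -> \bar R) :
      (forall A, measurable A -> nut A = \int[m0]_(x in A) (p x)%:E) ->
      measurable_fun setT f -> (forall x, 0 <= f x) ->
      \int[nut]_x f x = (1 - t)%:E * \int[mu]_x f x + t%:E * \int[nu]_x f x.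
    move=> nutp mf f0; rewrite (ge0_integral_density mp p0 nutp)//.
    rewrite (ge0_integral_density mh h0 muh)// (ge0_integral_density mq q0 nuq)//.
    rewrite -mixI.
    - apply: eq_integral => x _.
      rewrite (_ : (p x)%:E = (1 - t)%:E * (h x)%:E + t%:E * (q x)%:E)//.
      rewrite ge0_muleDr ?mule_ge0 ?lee_fin ?(ltW t0)//.
      by rewrite muleCA [X in _ + X]muleCA.
    - by apply: emeasurable_funM => //; exact/measurable_EFinP.
    - by apply: emeasurable_funM => //; exact/measurable_EFinP.
    - by move=> x; rewrite mule_ge0// lee_fin.
    - by move=> x; rewrite mule_ge0// lee_fin.
  have p1 : \int[m0]_x (p x)%:E = 1.
    transitivity (\int[m0]_x ((1 - t)%:E * (h x)%:E + t%:E * (q x)%:E)).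
      by apply: eq_integral => x _; rewrite -!EFinM -EFinD.
    rewrite mixI; last 4 first.
    - exact/measurable_EFinP.
    - exact/measurable_EFinP.
    - by move=> x; rewrite lee_fin.
    - by move=> x; rewrite lee_fin.
    by rewrite -muh// -nuq// !probability_setT !mule1 -EFinD subrK.
  have [nut nutp] := density_prob_exists mp p0 p1.
  have {}mix := fun f => @mix nut f nutp.
  have tnut : torus_prob nut.
    have mt : measurable (torus : set TR) by exact: measurable_itv.
    have ind (P : probability TR R) : P torus = \int[P]_x (\1_(torus : set TR) x)%:E.
      by rewrite integral_indic// setIT.
    rewrite /torus_prob ind mix.
    - by rewrite -!ind tmu tnu !mule1 -EFinD subrK.
    - by apply/measurable_EFinP; exact: measurable_indic.
    - by move=> x; rewrite lee_fin.
  have Et : log_energy nut = ((1 - t) * ((1 - t) * e + t * b) + t * ((1 - t) * b + t * e'))%:E.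
    rewrite log_energyE mix; [|exact: measurable_potential|exact: potential_ge0].
    rewrite (integral_potentialC mu) (integral_potentialC nu).
    rewrite mix; [|exact: measurable_potential|exact: potential_ge0].
    rewrite mix; [|exact: measurable_potential|exact: potential_ge0].
    by rewrite eE' e'E bE bE'.
  have Kt : relative_entropy nut m0 <= ((1 - t) * k + t * k')%:E.
    have mE (f : TR -> R) : measurable_fun setT f ->
        measurable_fun setT (fun x => (ent (f x))%:E).
      by move=> mf; apply/measurable_EFinP; exact: measurableT_comp measurable_ent mf.
    rewrite EFinD !EFinM -kE -k'E (relative_entropy_density mp p0 nutp).
    rewrite (relative_entropy_density mh h0 muh) (relative_entropy_density mq q0 nuq).
    rewrite -mixI; [|exact: mE|exact: mE|by move=> x; rewrite lee_fin ent_ge0|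
      by move=> x; rewrite lee_fin ent_ge0].
    apply: ge0_le_integral => //.
    - by move=> x _; rewrite lee_fin ent_ge0.
    - exact: mE.
    - by apply: emeasurable_funD; apply: emeasurable_funM => //; exact: mE.
    - move=> x _; rewrite -!EFinM -EFinD lee_fin ent_convex//.
      exact: gibbs_density_gt0.
  have [_ /(_ nut tnut)] := eq_mu; rewrite /free_energy -/m0 eE kE Et.
  move=> /le_trans /(_ (leeD2l _ Kt)); rewrite -!EFinM -!EFinD lee_fin => le_t.
  have : (t * (k + 2 * beta * e) <= t * (k' + 2 * beta * b + t * (beta * (e - 2 * b + e'))))%R.
    by rewrite -subr_ge0 in le_t; rewrite -subr_ge0; apply: le_trans le_t _; lra.
  by rewrite ler_pM2l.
have := gibbs_identity mw w0 Z0 Z1 ZE mq q0 nuq.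
rewrite integral0_eq; last by move=> x _; rewrite bregmanxx.
rewrite add0e k'E nuw -!EFinD => /eqP; rewrite eqe => /eqP lnZ.
have := gibbs_identity mw w0 Z0 Z1 ZE mh h0 muh.
rewrite kE muw -!EFinD => breg.
have breg0 : \int[m0]_x (bregman (h x) (gibbs_density w Z x))%:E = 0.
  apply/eqP; rewrite eq_le; apply/andP; split; last first.
    by apply: integral_ge0 => x _; rewrite lee_fin bregman_ge0// gibbs_density_gt0.
  move: breg; case: (\int[m0]_x _) => // B /eqP; rewrite -EFinD eqe lee_fin => /eqP.
  by move: lnZ first_order; lra.
have muq := integral_bregman_eq0 mw Z0 mh h0 muh breg0.
exists Z; split => //; first by move=> A mA; rewrite muq// -nuq// nuhaar.
exists (Z^-1 * W)%R; first by rewrite mulr_gt0 ?invr_gt0.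
by move=> A mA; rewrite muq// -nuq// nuM.
Qed.

End equilibrium.

(** * Integration over configurations *)

Section power_prob_marginals.
Context d (T : measurableType d) (R : realType) (P : probability T R).
Local Open Scope ereal_scope.

Lemma integral_power_prob_tnth n (i : 'I_n) (f : T -> \bar R) :
  measurable_fun setT f -> (forall x, 0 <= f x) ->
  \int[power_prob P n]_t f (tnth t i) = \int[P]_x f x.
Proof.
move=> mf f0; have m k (j : 'I_k) :
    measurable_fun setT (fun t : k.-tuple T => f (tnth t j)).
  by apply: measurableT_comp => //; exact: measurable_tnth.
elim: n i => [|n IHn] i; first by case: i.
rewrite integral_power_probS//; case: (unliftP ord0 i) => [j|] ->.
  under eq_integral => x _ do under eq_integral => t _ do rewrite tnthS.
  by under eq_integral => x _ do rewrite IHn; rewrite integral_prob_cst.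
under eq_integral => x _ do under eq_integral => t _ do rewrite tnth0.
by under eq_integral => x _ do rewrite integral_prob_cst.
Qed.

Lemma integral_power_prob_pair n (i j : 'I_n) (g : T -> T -> \bar R) : (i < j)%N ->
  measurable_fun setT (fun u : T * T => g u.1 u.2) -> (forall x y, 0 <= g x y) ->
  \int[power_prob P n]_t g (tnth t i) (tnth t j) = \int[P]_x \int[P]_y g x y.
Proof.
move=> + mg g0; have m k (a b : 'I_k) :
    measurable_fun setT (fun t : k.-tuple T => g (tnth t a) (tnth t b)).
  exact: (measurableT_comp mg (measurable_fun_pair (measurable_tnth a) (measurable_tnth b))).
have m2 x : measurable_fun setT (g x).
  exact: (measurableT_comp mg (pair1_measurable x)).
elim: n i j => [|n IHn] i j; first by case: i.
rewrite integral_power_probS//; case: (unliftP ord0 j) => [j'|] -> //.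
case: (unliftP ord0 i) => [i'|] -> ij.
  under eq_integral => x _ do under eq_integral => t _ do rewrite !tnthS.
  under eq_integral => x _ do rewrite IHn//.
  by rewrite integral_prob_cst.
apply: eq_integral => x _.
under eq_integral => t _ do rewrite tnth0 tnthS.
exact: integral_power_prob_tnth.
Qed.

(** This carries means under the power of the equilibrium measure, where they
    are easy to compute, over to the power of dx/(2 pi) that defines the gas. *)
Lemma integral_power_prob_density (S : probability T R) (f : T -> R) n
    (F : n.-tuple T -> \bar R) :
  measurable_fun setT f -> (forall x, (0 <= f x)%R) ->
  (forall A, measurable A -> S A = \int[P]_(x in A) (f x)%:E) ->
  measurable_fun setT F -> (forall t, 0 <= F t) ->
  \int[power_prob S n]_t F t =
  \int[power_prob P n]_t (F t * (\prod_(i < n) f (tnth t i))%:E).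
Proof.
move=> mf f0 Sf.
have mprod k : measurable_fun setT (fun t : k.-tuple T => (\prod_(i < k) f (tnth t i))%:E).
  apply/measurable_EFinP; apply: measurable_prod => i _ //.
  by apply: measurableT_comp => //; exact: measurable_tnth.
have prod0 k (t : k.-tuple T) : 0 <= (\prod_(i < k) f (tnth t i))%:E.
  by rewrite lee_fin; apply: prodr_ge0 => i _.
elim: n F => [|n IHn] F mF F0.
  rewrite !integral_power_prob0//.
  - by rewrite big_ord0 mule1.
  - exact: (emeasurable_funM mF (mprod 0%N)).
  - by move=> t; rewrite mule_ge0.
have mcons : measurable_fun setT (fun u : T * n.-tuple T => F (tuple_cons u)).
  by apply: measurableT_comp => //; exact: measurable_tuple_cons.
have mFx x : measurable_fun setT (fun t : n.-tuple T => F [tuple of x :: t]).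
  by apply: measurableT_comp => //; exact: measurable_cons_r.
rewrite !integral_power_probS//; last 2 first.
- exact: (emeasurable_funM mF (mprod n.+1)).
- by move=> t; rewrite mule_ge0.
rewrite (ge0_integral_density mf f0 Sf); last 2 first.
- exact: (@measurable_fun_fubini_tonelli_F _ _ _ _ _ (power_prob S n)
    (fun u => F (tuple_cons u))).
- by move=> x; exact: integral_ge0.
apply: eq_integral => x _; rewrite IHn// -ge0_integralZr//.
- apply: eq_integral => t _; rewrite -muleA -EFinM; congr (_ * _%:E).
  by rewrite big_ord_recl tnth0 mulrC; congr (_ * _)%R; apply: eq_bigr => i _; rewrite tnthS.
- exact: (emeasurable_funM (mFx x) (mprod n)).
- by move=> t _; rewrite mule_ge0.
- by rewrite lee_fin.
Qed.

End power_prob_marginals.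

Section sum_over_pairs.
Context {R : realType}.

Lemma sum_sym_pairs n (g : 'I_n -> 'I_n -> R) : (forall i j, g i j = g j i) ->
  \sum_(i < n) \sum_(j < n) g i j =
  2 * (\sum_(i < n) \sum_(j < n | (i < j)%N) g i j) + \sum_(i < n) g i i.
Proof.
move=> gC.
have -> : \sum_(i < n) \sum_(j < n) g i j =
    \sum_(i < n) ((\sum_(j < n | (i < j)%N) g i j + \sum_(j < n | (j < i)%N) g i j) + g i i).
  apply: eq_bigr => i _; rewrite (bigD1 i)//= addrC; congr (_ + _).
  rewrite (bigID (fun j : 'I_n => (i < j)%N))/=; congr (_ + _).
    by apply: eq_bigl => j; rewrite neq_ltn andb_orl; case: (ltngtP i j).
  by apply: eq_bigl => j; rewrite neq_ltn; case: (ltngtP i j).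
rewrite !big_split/= mulr2n mulrDl mul1r; congr (_ + _ + _).
rewrite (exchange_big_dep xpredT)//=.
by apply: eq_bigr => i _; apply: eq_bigr => j _; rewrite gC.
Qed.

End sum_over_pairs.

Section torus_power.
Context {R : realType}.
Local Notation TR := (measurableTypeR R).
Local Open Scope ereal_scope.

(** The indicator of the configurations on the torus as a product, so that its
    integral over a power of P factorizes. *)
Definition torus_indic n (t : n.-tuple TR) : R :=
  (\prod_(i < n) \1_(torus : set TR) (tnth t i))%R.

Lemma measurable_torus_indic n : measurable_fun setT (@torus_indic n).
Proof.
apply: measurable_prod => i _ //; apply: (@measurableT_comp _ _ _ _ _ _ (\1_torus : TR -> R)).
  by apply: measurable_indic; exact: measurable_itv.
exact: measurable_tnth.
Qed.

Lemma torus_indicE n (t : n.-tuple TR) :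
  (forall i, torus (tnth t i)) \/ torus_indic t = 0%R.
Proof.
have [h|/existsNP[i ti]] := pselect (forall i, torus (tnth t i)); first by left.
by right; rewrite /torus_indic (bigD1 i)//= indicE memNset// mul0r.
Qed.

(** The configurations with a coordinate outside ]- pi, pi] are negligible:
    allowing the value +oo for the bound there does not change its integral. *)
Lemma le_integral_torus_power (P : probability TR R) n (A : set (n.-tuple TR))
    (f g : n.-tuple TR -> \bar R) :
  torus_prob P -> measurable_fun setT g ->
  (forall t, 0 <= f t) -> (forall t, 0 <= g t) ->
  (forall t, A t -> (forall i, torus (tnth t i)) -> f t <= g t) ->
  \int[power_prob P n]_(t in A) f t <= \int[power_prob P n]_t g t.
Proof.
move=> tP mg f0 g0 fg; pose b := @torus_indic n.
have mb : measurable_fun setT b by exact: measurable_torus_indic.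
have b01 t : (0 <= b t <= 1)%R.
  rewrite prodr_ge0//= prodr_ile1// => i _; rewrite indicE.
  by case: (_ \in _); rewrite ?ler01 ?lexx.
have b1 : \int[power_prob P n]_t (b t)%:E = 1.
  rewrite integral_power_prob_prod//.
  - have mt : measurable (torus : set TR) by exact: measurable_itv.
    have -> : \int[P]_x (\1_(torus : set TR) x)%:E = 1.
      by rewrite integral_indic// setIT; exact: tP.
    by rewrite -(EFin_expe 1%R) expr1n.
  - by apply: measurable_indic; exact: measurable_itv.
have : \int[power_prob P n]_t (1 - b t)%:E = 0.
  have : \int[power_prob P n]_t (1 - b t)%:E + \int[power_prob P n]_t (b t)%:E = 1.
    rewrite -ge0_integralD//; last 4 first.
    - by move=> t _; rewrite lee_fin subr_ge0; have /andP[] := b01 t.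
    - by apply/measurable_EFinP; exact: measurable_funB.
    - by move=> t _; rewrite lee_fin; have /andP[] := b01 t.
    - exact/measurable_EFinP.
    rewrite -[RHS](@integral_prob_cst _ _ R (power_prob P n) 1).
    by apply: eq_integral => t _; rewrite -EFinD subrK.
  rewrite b1; case: (\int[_]_t _) => // r /eqP; rewrite -EFinD eqe => /eqP h.
  by congr _%:E; lra.
move=> b0; have mb' : measurable_fun setT (fun t => (1 - b t)%:E).
  by apply/measurable_EFinP; exact: measurable_funB.
have : \int[power_prob P n]_t `|(1 - b t)%:E| = 0.
  rewrite -[RHS]b0; apply: eq_integral => t _.
  by rewrite gee0_abs// lee_fin subr_ge0; have /andP[] := b01 t.
move=> /(ae_eq_integral_abs (power_prob P n) measurableT mb') bae.
pose g' t := if (0 < b t)%R then g t else +oo.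
have mg' : measurable_fun setT g'.
  by apply: measurable_fun_ifT => //; exact: measurable_fun_ltr.
have g'0 t : 0 <= g' t by rewrite /g'; case: ifP.
have -> : \int[power_prob P n]_t g t = \int[power_prob P n]_t g' t.
  apply: ae_eq_integral => //; case: bae => N [mN N0 sN]; exists N; split => //.
  apply: subset_trans sN; apply: subsetC => t /= h _; rewrite /g'.
  by have /(congr1 fine)/= /eqP := h I; rewrite subr_eq0 => /eqP <-; rewrite ltr01.
apply: ge0_le_integral_set => // t At; rewrite /g'.
case: ifPn => [bt|_]; last exact: leey.
by apply: fg => //; have [//|b0t] := torus_indicE t; move: bt; rewrite /b b0t ltxx.
Qed.

End torus_power.

Section empirical.
Context {R : realType}.
Local Notation TR := (measurableTypeR R).
Local Open Scope ereal_scope.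
Variables (N : nat) (x : N.-tuple TR).
Hypothesis N0 : (0 < N)%N.

Lemma integral_empirical (f : TR -> \bar R) : measurable_fun setT f ->
  (forall y, 0 <= f y) ->
  \int[empirical_measure x]_y f y = (N%:R^-1)%:E * \sum_(i < N) f (tnth x i).
Proof.
move=> mf f0; rewrite ge0_integral_mscale//; congr (_ * _).
rewrite ge0_integral_measure_sum//; apply: eq_bigr => i _.
by rewrite integral_dirac// diracT mul1e (tnth_nth 0%R).
Qed.

(** Normalizing a measure of mass 1 leaves it unchanged and packs it as a
    probability. *)
Lemma empirical_measure_prob : exists P : probability TR R,
  [/\ (forall A, P A = empirical_measure x A) &
   forall f : TR -> \bar R, measurable_fun setT f -> (forall y, 0 <= f y) ->
     \int[P]_y f y = (N%:R^-1)%:E * \sum_(i < N) f (tnth x i)].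
Proof.
have eT : empirical_measure x setT = 1.
  have := @integral_empirical (cst 1) (measurable_cst _) (fun=> lee01).
  rewrite integral_cst// mul1e => ->; rewrite sumEFin big_const_ord iter_addr_0.
  by rewrite -EFinM mulVf// pnatr_eq0 -lt0n.
pose P : probability TR R := mnormalize (empirical_measure x) haar.
have PE A : P A = empirical_measure x A.
  by rewrite /P/= /mnormalize/= eT onee_eq0/= invr1 mule1.
exists P; split => // f mf f0; rewrite -integral_empirical//.
by apply: eq_measure_integral => A _ _; exact: PE.
Qed.

End empirical.

Lemma eq_W1 {R : realType} (mu nu S : {measure set (measurableTypeR R) -> \bar R}) :
  (forall A, mu A = nu A) -> W1 mu S = W1 nu S.
Proof.
move=> munu; congr ereal_inf; apply/seteqP; split => _ [g hg <-]; exists g => // A mA;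
  by have [h1 h2] := hg A mA; rewrite ?munu// -?munu.
Qed.

(** * The gas *)

(** The pairs as a sequence turn the double sums and products over i < j into
    single unconditional ones. *)
Definition pairs N : seq ('I_N * 'I_N) :=
  [seq p : 'I_N * 'I_N <- index_enum _ | (p.1 < p.2)%N].

Lemma big_pairs (S : Type) (idx : S) (op : Monoid.com_law idx) N (F : 'I_N -> 'I_N -> S) :
  \big[op/idx]_(i < N) \big[op/idx]_(j < N | (i < j)%N) F i j =
  \big[op/idx]_(p <- pairs N) F p.1 p.2.
Proof.
by rewrite (pair_big_dep xpredT (fun i j : 'I_N => (i < j)%N))/= big_filter.
Qed.

Lemma mem_pairs N p : (p \in pairs N) = (p.1 < p.2)%N.
Proof. by rewrite mem_filter mem_index_enum andbT. Qed.

Section interaction.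
Context {R : realType}.
Local Notation TR := (measurableTypeR R).
Variables (N : nat).
Implicit Types t : N.-tuple TR.

Lemma sum_pairs (g : 'I_N -> 'I_N -> R) : (forall i j, g i j = g j i) ->
  \sum_(i < N) \sum_(j < N) g i j = 2 * (\sum_(p <- pairs N) g p.1 p.2) + \sum_(i < N) g i i.
Proof. by move=> /sum_sym_pairs ->; rewrite big_pairs. Qed.

(** [sum_pairs] for the constant 1 counts the pairs. *)
Lemma sum_pairs1 : 2 * (\sum_(p <- pairs N) 1 : R) = N%:R * (N%:R - 1).
Proof.
have := @sum_pairs (fun _ _ => 1) (fun _ _ => erefl).
rewrite !sumr_const !card_ord => /eqP; rewrite -subr_eq => /eqP <-.
by rewrite mulrBr mulr1 mulr_natr.
Qed.

Definition interaction (a : R) t : R :=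
  \prod_(p <- pairs N) `|sin ((tnth t p.1 - tnth t p.2) / 2)| `^ a.

Definition pair_energy t : \bar R :=
  (\sum_(p <- pairs N) log_kernel (tnth t p.1) (tnth t p.2))%E.

Lemma interaction_ge0 a t : 0 <= interaction a t.
Proof. by apply: prodr_ge0 => p _; exact: powR_ge0. Qed.

Lemma pair_energy_ge0 t : (0 <= pair_energy t)%E.
Proof. by apply: sume_ge0 => p _; exact: log_kernel_ge0. Qed.

Let mpair (p : 'I_N * 'I_N) :
  measurable_fun setT (fun t => (tnth t p.1, tnth t p.2)).
Proof. by apply: measurable_fun_pair; exact: measurable_tnth. Qed.

Lemma measurable_pair_energy : measurable_fun setT pair_energy.
Proof.
apply: emeasurable_sum => p.
exact: (measurableT_comp measurable_log_kernel (mpair p)).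
Qed.

Lemma measurable_interaction a : measurable_fun setT (interaction a).
Proof.
apply: measurable_prod => p _.
apply: (@measurableT_comp _ _ _ _ _ _ (fun s : TR => s `^ a)); first exact: measurable_powR.
apply: measurableT_comp => //.
apply: (@measurableT_comp _ _ _ _ _ _ (@sin R)).
  by apply: continuous_measurable_fun; exact: continuous_sin.
by apply: measurable_funM => //; apply: measurable_funB; exact: measurable_tnth.
Qed.

Lemma interaction_energy (a : R) t : 0 < a ->
  pair_energy t = +oo%E \/
  exists s : R, pair_energy t = s%:E /\ interaction a t = expR (- (a * s)).
Proof.
move=> a0; have [h|/existsNP[p /not_implyP[pp /negP]]] := pselect (forall p, p \in pairs N ->
    0 < `|sin ((tnth t p.1 - tnth t p.2) / 2)|); last first.
  rewrite -leNgt normr_le0 => /eqP s0; left.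
  rewrite /pair_energy (big_rem p)//= {1}/log_kernel s0 normr0 /=.
  rewrite lexx /= addye// gt_eqF// (@lt_le_trans _ _ 0%E) ?ltNyr//.
  by apply: sume_ge0 => q _; exact: log_kernel_ge0.
right; exists (\sum_(p <- pairs N) - ln `|sin ((tnth t p.1 - tnth t p.2) / 2)|); split.
  rewrite /pair_energy -sumEFin; apply: eq_big_seq => p /h s0.
  by rewrite /log_kernel lne_EFin.
rewrite mulr_sumr -sumrN expR_sum; apply: eq_big_seq => p /h s0.
by rewrite mulrN opprK [(a * _)%R]mulrC expRM lnK ?posrE.
Qed.

(** The tangent line at m of the exponential, e^v >= e^m (1 + v - m) with
    v = T - a S. The terms of negative sign stand on the right so that every
    term is nonnegative and S = +oo is covered. *)
Lemma interaction_ge (a m T : R) t : 0 < a -> 0 <= m ->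
  ((expR m * (1 + T))%:E <= (interaction a t * expR T)%:E +
    ((expR m * a)%:E * pair_energy t + (expR m * m)%:E))%E.
Proof.
move=> a0 m0; have e0 := expR_gt0 m.
have [->|[s [-> ->]]] := interaction_energy t a0.
  by rewrite gt0_muley ?lte_fin ?mulr_gt0// addye// addey// leey.
rewrite -EFinM -!EFinD lee_fin -expRD.
have -> : - (a * s) + T = m + (T - a * s - m) by ring.
rewrite expRD -mulrA -!mulrDr ler_pM2l//.
by have := expR_ge1Dx (T - a * s - m); lra.
Qed.

Lemma gas_weightE (beta : R) (V : R -> R) t : gas_weight beta V t =
  (\prod_(p <- pairs N) 2 `^ (2 * beta / N%:R)) *
  (interaction (2 * beta / N%:R) t * \prod_(i < N) expR (- V (tnth t i))).
Proof.
rewrite /gas_weight big_pairs mulrA -big_split/=; congr (_ * _).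
by apply: eq_bigr => p _; rewrite chordE powRM.
Qed.

End interaction.

Lemma singularity_mass_ge0 (R : realType) : 0 <= singularity_mass :> R.
Proof. by rewrite !mulr_ge0 ?sqrtr_ge0 ?invr_ge0 ?mulr_ge0 ?pi_ge0. Qed.

Section gas_bounds.
Context {R : realType}.
Local Notation TR := (measurableTypeR R).
Variables (beta : R) (V : R -> R) (cV : continuous V) (mu : probability TR R).
Variables (M Z e : R) (N : nat).
Let w (x : TR) : R := 2 * beta * fine (potential mu x).
Hypotheses (b0 : 0 < beta) (Z0 : 0 < Z) (e0 : 0 <= e) (N10 : (10 <= N)%N).
Hypotheses (tmu : torus_prob mu)
  (muM : forall A, measurable A -> (mu A <= M%:E * haar A)%E)
  (muw : forall A, measurable A ->
    (mu A = \int[haar]_(x in A) (gibbs_density w Z x * expR (- V x))%:E)%E)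
  (eE : log_energy mu = e%:E).

Let a : R := 2 * beta / N%:R.
Let p (x : TR) : R := gibbs_density w Z x * expR (- V x).
Let f (x : TR) : R := expR (- w x) * expR (- V x).

Let N0 : 0 < N%:R :> R. Proof. by rewrite ltr0n; apply: leq_trans N10. Qed.

Let a0 : 0 < a. Proof. by rewrite divr_gt0// mulr_gt0. Qed.

Let w0 x : 0 <= w x.
Proof.
by apply: mulr_ge0; [rewrite mulr_ge0 ?ltW|exact/fine_ge0/potential_ge0].
Qed.

Let mw : measurable_fun setT w.
Proof.
by apply: measurable_funM => //; apply: measurableT_comp => //; exact: measurable_potential.
Qed.

Let meV : measurable_fun setT (fun x : TR => expR (- V x)).
Proof.
apply: measurableT_comp => //; apply: measurableT_comp => //.
exact: continuous_measurable_fun.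
Qed.

Let mf : measurable_fun setT f.
Proof. by apply: measurable_funM => //; apply: measurableT_comp => //; exact: measurableT_comp. Qed.

Let f0 x : 0 <= f x. Proof. by rewrite mulr_ge0 ?expR_ge0. Qed.

Let pE x : p x = Z^-1 * f x. Proof. by rewrite /p /f /gibbs_density mulrA. Qed.

Let mp : measurable_fun setT p.
Proof. by rewrite (funext pE); exact: measurable_funM. Qed.

Let p0 x : 0 <= p x. Proof. by rewrite pE mulr_ge0// invr_ge0 ltW. Qed.

Let integral_f : (\int[haar]_x (f x)%:E = Z%:E)%E.
Proof.
have : (\int[haar]_x (p x)%:E = 1)%E by rewrite -muw// probability_setT.
under eq_integral do rewrite pE EFinM.
rewrite ge0_integralZl//; last by rewrite lee_fin invr_ge0 ltW.
- move=> h; rewrite -[LHS]mul1e -(divff (lt0r_neq0 Z0)) EFinM -muleA h.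
  by rewrite mule1.
- exact/measurable_EFinP.
- by move=> x _; rewrite lee_fin.
Qed.

Let integral_w : (\int[mu]_x (w x)%:E = (2 * beta * e)%:E)%E.
Proof.
have eE' : (\int[mu]_x potential mu x = e%:E)%E by [].
rewrite /w; under eq_integral do rewrite EFinM.
rewrite ge0_integralZl//; last by rewrite lee_fin mulr_ge0// ltW.
- by rewrite integral_fine_potential ?eE' ?ltry.
- apply/measurable_EFinP; apply: measurableT_comp => //; exact: measurable_potential.
- by move=> x _; rewrite lee_fin; exact/fine_ge0/potential_ge0.
Qed.

(** The factors 2^(2 beta/N) of the chords, that is 2^(beta (N - 1)). *)
Definition kappa : R := \prod_(q <- pairs N) 2 `^ a.

Let kappa0 : 0 < kappa.
Proof. by apply: prodr_gt0 => q _; exact: powR_gt0. Qed.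

Definition total_potential (t : N.-tuple TR) : R := \sum_(i < N) w (tnth t i).

Let mT : measurable_fun setT total_potential.
Proof.
apply: measurable_sum => i; apply: (measurableT_comp mw); exact: measurable_tnth.
Qed.

Let T0 t : 0 <= total_potential t. Proof. by apply: sumr_ge0. Qed.

Let mW : measurable_fun setT (fun t : N.-tuple TR =>
  (interaction a t * expR (total_potential t))%:E).
Proof.
apply/measurable_EFinP; apply: measurable_funM; first exact: measurable_interaction.
exact: measurableT_comp.
Qed.

Local Open Scope ereal_scope.

(** Jensen's inequality for the exponential under mu^N: m is the mean of the
    exponent, since the sum of the w(x_i) has mean 2 beta N e and the
    N (N - 1)/2 pairs contribute - (2 beta/N) e each. Integrating
    [interaction_ge] leaves e^m. *)
Lemma integral_interaction_ge :
  (expR (beta * (N%:R + 1) * e))%:E <=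
  \int[power_prob mu N]_t (interaction a t * expR (total_potential t))%:E.
Proof.
set m := (beta * (N%:R + 1) * e)%R.
have m0 : (0 <= m)%R by rewrite !mulr_ge0// ?ltW// addr_gt0.
have em := expR_gt0 m.
have mpe := @measurable_pair_energy R N.
have ge1 t : 0 <= (interaction a t * expR (total_potential t))%:E.
  by rewrite lee_fin mulr_ge0 ?interaction_ge0 ?expR_ge0.
have ge2 (t : N.-tuple TR) : 0 <= (expR m * a)%:E * pair_energy t.
  by rewrite mule_ge0 ?pair_energy_ge0// lee_fin mulr_ge0 ?ltW.
have ge3 : 0 <= (expR m * m)%:E by rewrite lee_fin mulr_ge0 ?expR_ge0.
have : \int[power_prob mu N]_t (expR m * (1 + total_potential t))%:E <=
    \int[power_prob mu N]_t ((interaction a t * expR (total_potential t))%:E +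
    ((expR m * a)%:E * pair_energy t + (expR m * m)%:E)).
  apply: ge0_le_integral => //.
  - by move=> t _; rewrite lee_fin mulr_ge0 ?expR_ge0// addr_ge0.
  - apply/measurable_EFinP; apply: measurable_funM => //; exact: measurable_funD.
  - apply: emeasurable_funD => //; apply: emeasurable_funD => //.
    exact: emeasurable_funM.
  - by move=> t _; exact: interaction_ge.
have -> : \int[power_prob mu N]_t (expR m * (1 + total_potential t))%:E =
    (expR m * (1 + N%:R * (2 * beta * e)))%:E.
  under eq_integral do rewrite EFinM EFinD.
  rewrite ge0_integralZl//; last 2 first.
  - by apply: emeasurable_funD => //; exact/measurable_EFinP.
  - by move=> t _; rewrite adde_ge0// lee_fin.
  rewrite ge0_integralD//; last 2 first.
  - by move=> t _; rewrite lee_fin.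
  - exact/measurable_EFinP.
  rewrite (@integral_prob_cst _ _ _ (power_prob mu N)).
  have -> : \int[power_prob mu N]_t (total_potential t)%:E =
      \int[power_prob mu N]_t \sum_(i < N) (w (tnth t i))%:E.
    by apply: eq_integral => t _; rewrite sumEFin.
  rewrite ge0_integral_sum//; last 2 first.
  - move=> i; apply/measurable_EFinP; apply: (measurableT_comp mw); exact: measurable_tnth.
  - by move=> i t _; rewrite lee_fin.
  rewrite (eq_bigr (fun=> (2 * beta * e)%:E)) => [|i _]; last first.
    rewrite (integral_power_prob_tnth mu i (f := fun x => (w x)%:E)).
    - exact: integral_w.
    - exact/measurable_EFinP.
    - by move=> x; rewrite lee_fin.
  by rewrite sumEFin sumr_const card_ord [(N%:R * _)%R]mulr_natl.
rewrite ge0_integralD//; last 2 first.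
- by move=> t _; exact: adde_ge0.
- by apply: emeasurable_funD => //; exact: emeasurable_funM.
rewrite ge0_integralD//; last 1 first.
- exact: emeasurable_funM.
rewrite ge0_integralZl//; last 2 first.
- by move=> t _; exact: pair_energy_ge0.
- by rewrite lee_fin mulr_ge0 ?ltW.
rewrite (@integral_prob_cst _ _ _ (power_prob mu N)).
have -> : \int[power_prob mu N]_t pair_energy t = (\sum_(q <- pairs N) e)%:E.
  rewrite ge0_integral_sum//; last 2 first.
  - move=> q; exact: (measurableT_comp measurable_log_kernel
      (measurable_fun_pair (measurable_tnth q.1) (measurable_tnth q.2))).
  - by move=> q t _; exact: log_kernel_ge0.
  rewrite -sumEFin; apply: eq_big_seq => q; rewrite mem_pairs => q12.
  rewrite (integral_power_prob_pair mu q12 measurable_log_kernel)//.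
  by move=> x y; exact: log_kernel_ge0.
have -> : (\sum_(q <- pairs N) e = e * (N%:R * (N%:R - 1)) / 2)%R.
  rewrite -sum_pairs1 (_ : (\sum_(q <- pairs N) e = e * \sum_(q <- pairs N) 1)%R).
    by field.
  by rewrite mulr_sumr; apply: eq_bigr => q _; rewrite mulr1.
rewrite -EFinM -EFinD.
case: (\int[power_prob mu N]_t _) => [J| |]; last by [].
  rewrite -EFinD !lee_fin.
  have -> : (expR m * a * (e * (N%:R * (N%:R - 1)) / 2) = expR m * (beta * (N%:R - 1) * e))%R.
    by rewrite /a; field; rewrite gt_eqF.
  rewrite /m; nra.
by move=> _; rewrite leey.
Qed.

(** The density of mu is p = e^(-w - V)/Z, hence prod e^(-V(x_i)) is
    Z^N prod e^(w(x_i)) p(x_i). *)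
Lemma integral_gas_weight_ge :
  (kappa * Z ^+ N * expR (beta * (N%:R + 1) * e))%:E <=
  \int[power_prob haar N]_t (gas_weight beta V t)%:E.
Proof.
have kZ : (0 <= kappa * Z ^+ N)%R by rewrite mulr_ge0 ?exprn_ge0 ?ltW.
rewrite EFinM.
apply: (@le_trans _ _ ((kappa * Z ^+ N)%:E *
    \int[power_prob mu N]_t (interaction a t * expR (total_potential t))%:E)).
  by apply: lee_wpmul2l; [rewrite lee_fin|exact: integral_interaction_ge].
have ge1 (t : N.-tuple TR) : 0 <= (interaction a t * expR (total_potential t))%:E.
  by rewrite lee_fin mulr_ge0 ?interaction_ge0 ?expR_ge0.
rewrite (integral_power_prob_density mp p0 muw)//.
rewrite -ge0_integralZl//; last 2 first.
- apply: (emeasurable_funM mW); apply/measurable_EFinP; apply: measurable_prod => i _ //.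
  by apply: (measurableT_comp mp); exact: measurable_tnth.
- by move=> t _; rewrite mule_ge0// lee_fin prodr_ge0.
rewrite le_eqVlt; apply/orP; left; apply/eqP; apply: eq_integral => t _.
rewrite -!EFinM gas_weightE -/a -/kappa; congr _%:E.
have -> : (\prod_(i < N) p (tnth t i) = Z^-1 ^+ N * (expR (- total_potential t) *
    \prod_(i < N) expR (- V (tnth t i))))%R.
  rewrite /total_potential -sumrN expR_sum -big_split/=.
  under eq_bigr do rewrite pE.
  by rewrite big_split/= prodr_const card_ord.
rewrite expRN exprVn; field.
by rewrite !gt_eqF ?exprn_gt0 ?expR_gt0.
Qed.

Local Close Scope ereal_scope.

Lemma abs_sin_le_softlog (d x y : R) : 0 < d -> d < 1 -> torus x -> torus y ->
  `|sin ((x - y) / 2)| <= expR (- softlog d `|x - y|).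
Proof.
move=> d0 d1 tx ty; have := softlog_le_kernel d0 d1 tx ty.
rewrite /log_kernel; have [s0|s0] := ltP 0 `|sin ((x - y) / 2)|; last first.
  by move=> _; apply: le_trans s0 _; exact: expR_ge0.
by rewrite lne_EFin// lee_fin lerNr => h; rewrite -{1}(lnK s0) ler_expR.
Qed.

(** With d = N^(-4) the diagonal costs ln (2/d) = ln 2 + 4 ln N and the error
    2 N O(sqrt d) made on the potentials is bounded. *)
Lemma interaction_le (r : R) (t : N.-tuple TR) : 0 < r ->
  (forall i, torus (tnth t i)) -> (r%:E < W1 (empirical_measure t) mu)%E ->
  interaction a t <= expR (beta * (8 * M * singularity_mass + N%:R * e + ln 2 +
    4 * ln N%:R - N%:R * ((8 * pi)^-1 * r ^+ 2))) * expR (- total_potential t).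
Proof.
move=> r0 tt rW; have NN0 : (0 < N)%N by apply: leq_trans N10.
have [P [PE intP]] := empirical_measure_prob t NN0.
have tP : torus_prob P.
  have mt : measurable (torus : set TR) by exact: measurable_itv.
  rewrite /torus_prob -(setIT (torus : set TR)) -(integral_indic P measurableT mt).
  rewrite intP; last 2 first.
  - by apply/measurable_EFinP; exact: measurable_indic.
  - by move=> y; rewrite lee_fin.
  rewrite sumEFin (eq_bigr (fun=> 1)) => [|i _]; last by rewrite indicE mem_set.
  by rewrite sumr_const card_ord -EFinM mulVf// gt_eqF.
have {}rW : (r%:E < W1 P mu)%E by rewrite (eq_W1 _ PE).
pose v : R := N%:R^-1; have v0 : 0 < v by rewrite invr_gt0.
have v10 : v <= 10^-1 by rewrite lef_pV2 ?posrE// ler_nat.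
have Nv : N%:R * v = 1 by rewrite mulfV// gt_eqF.
pose d : R := v ^+ 4; have d0 : 0 < d by rewrite exprn_gt0.
have v1 : v <= 1 by apply: le_trans v10 _; lra.
have d10 : d <= 10^-1 by apply: le_trans v10; rewrite /d ler_iXnr// ltW.
have d1 : d < 1 by lra.
have S0 : 0 <= singularity_mass :> R by exact: singularity_mass_ge0.
have M0 := density_bound_ge0 muM.
pose s i j := softlog d `|tnth t i - tnth t j|.
pose u i := fine (potential mu (tnth t i)).
have uE i : potential mu (tnth t i) = (u i)%:E.
  rewrite fineK// ge0_fin_numE ?potential_ge0//.
  exact: le_lt_trans (potential_le tmu muM (tt i)) (ltry _).
have s0 (x y : R) : (0 <= (softlog d `|x - y|)%:E)%E by rewrite lee_fin softlog_ge0.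
have mi (S : probability TR R) : measurable_fun setT
    (fun x : TR => (\int[S]_y (softlog d `|x - y|)%:E)%E).
  by apply: measurable_integral_l; [exact: measurable_softlog_dist|exact: s0].
have i0 (S : probability TR R) (x : TR) : (0 <= \int[S]_y (softlog d `|x - y|)%:E)%E.
  by apply: integral_ge0 => y _; exact: s0.
have IPP : softlog_energy d P P = (v * \sum_(i < N) (v * \sum_(j < N) s i j))%:E.
  rewrite /softlog_energy intP// EFinM -sumEFin; congr (_ * _)%E.
  apply: eq_bigr => i _; rewrite intP//; last exact: measurable_softlog_dist_l.
  by rewrite sumEFin -EFinM.
set eps := 2 * Num.sqrt (2 * d) * M * singularity_mass.
have IPmu : ((v * \sum_(i < N) (u i - eps))%:E <= softlog_energy d P mu)%E.
  rewrite /softlog_energy intP// EFinM -sumEFin lee_wpmul2l ?lee_fin ?(ltW v0)//.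
  apply: lee_sum => i _; have := potential_le_softlog tmu muM d0 d1 (tt i).
  by rewrite uE -/eps EFinB leeBlDr.
have Imm : (softlog_energy d mu mu <= e%:E)%E.
  rewrite -eE; apply: le_integral_torus => //.
  - exact: measurable_potential.
  - by move=> x; exact: potential_ge0.
  move=> x tx; apply: le_integral_torus => //.
  - exact: measurable_softlog_dist_l.
  - exact: measurable_log_kernel_l.
  - by move=> y; exact: log_kernel_ge0.
  - by move=> y ty; exact: softlog_le_kernel.
have gap : 2 * (v * \sum_(i < N) (u i - eps)) + (8 * pi)^-1 * r ^+ 2 <=
    v * (\sum_(i < N) (v * \sum_(j < N) s i j)) + e.
  rewrite -lee_fin !EFinD -IPP.
  apply: le_trans (leeD2l _ Imm); apply: le_trans (softlog_energy_gap d0 d10 tP tmu r0 rW).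
  by rewrite leeD2r// EFinM; apply: lee_wpmul2l => //; rewrite lee_fin.
have epsN : 2 * N%:R * eps <= 8 * M * singularity_mass.
  have sq : Num.sqrt (2 * d) <= 2 * v ^+ 2.
    have v20 : 0 <= 2 * v ^+ 2 by rewrite mulr_ge0// sqr_ge0.
    rewrite -[leRHS](ger0_norm v20) -sqrtr_sqr ler_sqrt ?sqr_ge0//.
    rewrite /d exprMn -exprM ler_wpM2r//; first by rewrite exprn_ge0// ltW.
    by rewrite expr2; lra.
  have MS0 : 0 <= M * singularity_mass by rewrite mulr_ge0.
  have : N%:R * Num.sqrt (2 * d) <= 2.
    apply: (@le_trans _ _ (N%:R * (2 * v ^+ 2))); first by rewrite ler_pM2l.
    by rewrite mulrCA expr2 (mulrA N%:R) Nv mul1r; lra.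
  move=> /(ler_wpM2r MS0); rewrite /eps; lra.
have logd : softlog d 0 <= ln 2 + 4 * ln N%:R.
  apply: le_trans (softlog0_le d0 d1) _.
  by rewrite /d /v lnXn ?invr_gt0// lnV ?posrE// -mulr_natl; lra.
have inter_s : interaction a t <= expR (- (a * \sum_(q <- pairs N) s q.1 q.2)).
  rewrite mulr_sumr -sumrN expR_sum; apply: ler_prod => q _.
  rewrite powR_ge0/= -mulrN [a * _]mulrC expRM ge0_ler_powR ?nnegrE ?expR_ge0 ?(ltW a0)//.
  exact: abs_sin_le_softlog.
apply: le_trans inter_s _; rewrite -expRD ler_expR.
have sumE := @sum_pairs _ N s (fun i j => congr1 (softlog d) (distrC _ _)).
have sii : \sum_(i < N) s i i = N%:R * softlog d 0.
  rewrite (eq_bigr (fun=> softlog d 0)) => [|i _]; last by rewrite /s subrr normr0.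
  by rewrite sumr_const card_ord mulr_natl.
have -> : total_potential t = 2 * beta * \sum_(i < N) u i by rewrite mulr_sumr.
move: gap; rewrite -!mulr_sumr sumrB sumr_const card_ord -[eps *+ N]mulr_natl sumE sii.
set Sp := \sum_(q <- pairs N) _; set Su := \sum_(i < N) u i.
set c := (8 * pi)^-1 * r ^+ 2 => gap.
have Nn0 : N%:R != 0 :> R by rewrite gt_eqF.
have E1 : N%:R * (2 * (v * (Su - N%:R * eps)) + c) = 2 * Su - 2 * N%:R * eps + N%:R * c.
  by rewrite /v; field.
have E2 : N%:R * (v * (v * (2 * Sp + N%:R * softlog d 0)) + e) =
    v * (2 * Sp) + softlog d 0 + N%:R * e.
  by rewrite /v; field.
have := ler_wpM2l (ltW N0) gap; rewrite E1 E2 => {}gap.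
have : - (v * (2 * Sp)) <= (8 * M * singularity_mass + N%:R * e + ln 2 +
    4 * ln N%:R - N%:R * c) - 2 * Su by lra.
by move=> /(ler_wpM2l (ltW b0)); rewrite /a -/v; lra.
Qed.

(** Numerator and denominator share the factor kappa Z^N. If the partition
    function were infinite, its real value would be 0 and the bound trivial. *)
Lemma gas_prob_le (r : R) : 0 < r ->
  (gas_prob beta V [set t : N.-tuple TR | r%:E < W1 (empirical_measure t) mu] <=
   (expR (- (beta * ((8 * pi)^-1 * N%:R * r ^+ 2 - 5 * ln N%:R -
      (8 * M * singularity_mass + ln 2)))))%:E)%E.
Proof.
move=> r0; rewrite /gas_prob /partition_function.
set B := expR (beta * (8 * M * singularity_mass + N%:R * e + ln 2 +
    4 * ln N%:R - N%:R * ((8 * pi)^-1 * r ^+ 2))).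
have kB : 0 <= kappa * B by rewrite mulr_ge0 ?expR_ge0// ltW.
have num : (\int[power_prob haar N]_(t in [set t : N.-tuple TR |
    r%:E < W1 (empirical_measure t) mu]) (gas_weight beta V t)%:E <=
    (kappa * B * Z ^+ N)%:E)%E.
  rewrite EFinM EFin_expe -integral_f -integral_power_prob_prod// -ge0_integralZl//; last 2 first.
  - apply/measurable_EFinP; apply: measurable_prod => i _ //.
    by apply: (measurableT_comp mf); exact: measurable_tnth.
  - by move=> t _; rewrite lee_fin prodr_ge0.
  have gas_ge0 (t : N.-tuple TR) : (0 <= (gas_weight beta V t)%:E)%E.
    rewrite lee_fin gas_weightE !mulr_ge0 ?interaction_ge0 ?(ltW kappa0)//.
    by apply: prodr_ge0 => i _; exact: expR_ge0.
  apply: le_integral_torus_power => //.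
  - exact: haar_torus_prob.
  - apply: emeasurable_funM => //; apply/measurable_EFinP; apply: measurable_prod => i _ //.
    by apply: (measurableT_comp mf); exact: measurable_tnth.
  - by move=> t; rewrite mule_ge0// lee_fin ?prodr_ge0.
  move=> t /= rW tt; rewrite -EFinM lee_fin gas_weightE -/a -/kappa -mulrA ler_pM2l//.
  rewrite (_ : \prod_(i < N) f (tnth t i) =
      expR (- total_potential t) * \prod_(i < N) expR (- V (tnth t i))); last first.
    by rewrite /total_potential -sumrN expR_sum -big_split.
  rewrite mulrA ler_wpM2r//; last exact: interaction_le.
  by apply: prodr_ge0 => i _; exact: expR_ge0.
have := integral_gas_weight_ge.
have L0 : 0 < kappa * Z ^+ N * expR (beta * (N%:R + 1) * e).
  by rewrite !mulr_gt0 ?exprn_gt0 ?expR_gt0.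
case: (\int[power_prob haar N]_t (gas_weight beta V t)%:E)%E => [D| |] //=; last first.
  by move=> _; rewrite invr0 mul0e lee_fin expR_ge0.
rewrite lee_fin => LD; have D0 : 0 < D by apply: lt_le_trans LD.
have D'0 : 0 <= D^-1 by rewrite invr_ge0 ltW.
apply: (le_trans (lee_wpmul2l _ num)); first by rewrite lee_fin.
rewrite -EFinM lee_fin ler_pdivrMl//.
apply: le_trans (ler_wpM2r (expR_ge0 _) LD).
rewrite -(mulrA (kappa * _)) -expRD mulrAC ler_pM2l ?mulr_gt0 ?exprn_gt0//.
rewrite /B ler_expR.
have lnN : 0 <= ln (N%:R : R) by rewrite ln_ge0// ler1n; apply: leq_trans N10.
have : 0 <= beta * (ln N%:R + e) by rewrite mulr_ge0 ?addr_ge0// ltW.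
lra.
Qed.

End gas_bounds.

Theorem theorem1p4 (R : realType) (mu : probability (measurableTypeR R) R) :
  exists C : R, 0 < C /\
  forall (beta : R) (V V' : R -> R) (cV : continuous V)
    (nV : (\int[haar]_x (expR (- V x))%:E = 1)%E),
  0 < beta -> torus_fun V -> V' \in Lfun haar 2%:E -> weak_derivative V V' ->
  equilibrium_measure beta cV nV mu ->
  forall (N : nat) (r : R), (10 <= N)%N -> 0 < r ->
  (gas_prob beta V [set x : N.-tuple (measurableTypeR R) | r%:E < W1 (empirical_measure x) mu]
    <= (expR (- (beta * ((8 * pi)^-1 * N%:R * r ^+ 2 - 5 * ln N%:R - C))))%:E)%E.
Proof.
(* Without a bounded density mu is an equilibrium measure for no beta and V. *)
have [[M M0 muM]|noM] := pselect (exists2 M : R, 0 < M & forall A : set (measurableTypeR R),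
    measurable A -> (mu A <= M%:E * haar A)%E); last first.
  exists 1; split => // beta V V' cV nV b0 _ _ _ eq_mu.
  by have [Z [_ _ /noM]] := equilibrium_density b0 eq_mu.
have S0 : 0 <= singularity_mass :> R by exact: singularity_mass_ge0.
exists (8 * M * singularity_mass + ln 2); split.
  apply: ltr_wpDl; last by rewrite ln_gt0// ltr1n.
  by rewrite mulr_ge0// mulr_ge0// ltW.
move=> beta V V' cV nV b0 _ _ _ eq_mu N r N10 r0.
have [Z [Z0 muZ _]] := equilibrium_density b0 eq_mu.
have [e [_ [e0 _ eE _ _]]] := finite_free_energy b0 eq_mu.
have [tmu _] := eq_mu.
exact: (gas_prob_le cV b0 Z0 e0 N10 tmu muM muZ eE r0).
Qed.
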